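(* Let $r>0$, let $(\eta_n)$ be i.i.d. with density $\frac{r^r}{\Gamma(r)}x^{r-1}e^{-rx}$ ($x>0$), and let $\lambda_n=\ell(n)n^{-\gamma}$ with $\gamma>1/2$ and $\ell$ slowly varying at $\infty$, the sequence being positive and non-increasing with $\frac1r\sum_n\lambda_n^2=1$. Let $\sigma_M^2=\frac1r\sum_{n\ge M}\lambda_n^2$, $\tilde Y_M=\sigma_M^{-1}\sum_{n=M}^\infty\lambda_n(\eta_n-1)$ and $\kappa_{k,M}=\frac{(k-1)!}{r^{k-1}\sigma_M^k}\sum_{n\ge M}\lambda_n^k$. Then for each $N\ge2$, as $M\to\infty$, $$\mathrm P[\tilde Y_M\le x]=\Phi(x)-\phi(x)\left\{\sum_{\eta(N)}\left[\prod_{m=3}^N\frac1{k_m!}\left(\frac{\kappa_{m,M}}{m!}\right)^{k_m}\right]H_{\zeta(k_3,\dots,k_N)}(x)\right\}+O\!\left(M^{-\frac{N-1}2}\right),$$ where the $O(M^{-(N-1)/2})$ term is uniform in $x\in\mathbb{R}$.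
   Context: $\Phi,\phi$ are the standard normal CDF and density. $\eta(N)$ is the set of tuples of non-negative integers $(k_3,\dots,k_N)$ with $1\le k_3+2k_4+\dots+(N-2)k_N\le N-2$ (empty for $N=2$), and $\zeta(k_3,\dots,k_N)=3k_3+4k_4+\dots+Nk_N-1$. $H_k$ are the Hermite polynomials $H_0=1$, $H_k(x)=(-1)^ke^{x^2/2}\frac{d^k}{dx^k}e^{-x^2/2}$ (so $H_1=x$, $H_2=x^2-1$, $H_3=x^3-3x,\dots$). *)

(* Defs.v *)
From HB Require Import structures.
From mathcomp Require Import all_boot all_order all_algebra.
From mathcomp Require Import all_classical all_reals all_analysis.
Set Implicit Arguments. Unset Strict Implicit. Unset Printing Implicit Defensive.
Import Order.TTheory GRing.Theory Num.Theory.
Import numFieldNormedType.Exports.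
Local Open Scope classical_set_scope.
Local Open Scope ring_scope.

Section defs.
Variable R : realType.

(** real series starting at index [M]: limit of the partial sums
    \sum_(M <= n < K) f n as K -> oo (the value is [lim]'s default
    if the series diverges). *)
Definition tailsum (M : nat) (f : nat -> R) : R :=
  limn (fun K => \sum_(M <= n < K) f n).

Definition std_normal_pdf (x : R) : R :=
  expR (- (x ^+ 2) / 2) / Num.sqrt (pi *+ 2).

Definition std_normal_cdf (x : R) : R :=
  Rintegral lebesgue_measure `]-oo, x] std_normal_pdf.

Definition hermite (k : nat) (x : R) : R :=
  (-1) ^+ k * expR (x ^+ 2 / 2) *
  derive1n k (fun y : R => expR (- (y ^+ 2) / 2)) x.

Definition Gamma_fun (r : R) : R :=
  Rintegral lebesgue_measure `]0, +oo[ (fun x : R => x `^ (r - 1) * expR (- x)).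

Definition gamma_rr_pdf (r : R) (x : R) : R :=
  r `^ r / Gamma_fun r * x `^ (r - 1) * expR (- (r * x)).

Definition slowly_varying (l : R -> R) : Prop :=
  (exists a : R, measurable_fun `[a, +oo[ l /\ forall x, a <= x -> 0 < l x) /\
  forall t : R, 0 < t -> (l (t * x) / l x) @[x --> +oo] --> (1 : R).

End defs.

Section prob.
Variables (d : measure_display) (T : measurableType d) (R : realType).

Definition mutually_independent (P : probability T R) (X : nat -> T -> R) : Prop :=
  (forall n, measurable_fun setT (X n)) /\
  forall (s : seq nat) (B : nat -> set R), uniq s ->
    (forall i, measurable (B i)) ->
    P (\big[setI/setT]_(i <- s) (X i @^-1` B i)) =
    (\prod_(i <- s) P (X i @^-1` B i))%E.

Definition has_gamma_rr_law (P : probability T R) (r : R) (X : T -> R) : Prop :=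
  forall B : set R, measurable B ->
    P (X @^-1` B) =
    (\int[lebesgue_measure]_(x in B `&` `]0%R, +oo[) (gamma_rr_pdf r x)%:E)%E.
End prob.

(* Main.v *)
Require Import Defs.
From HB Require Import structures.
From mathcomp Require Import all_boot all_order all_algebra.
From mathcomp Require Import all_classical all_reals all_analysis.
From mathcomp Require Import measurable_realfun.
From mathcomp Require Import ring lra zify complex.
Set Implicit Arguments. Unset Strict Implicit. Unset Printing Implicit Defensive.
Import Order.TTheory GRing.Theory Num.Theory.
Import numFieldNormedType.Exports.
Local Open Scope classical_set_scope.
Local Open Scope ring_scope.

(** Since [lambda] is regularly varying of index [- gamma] with [gamma > 1/2], the
    tail [sum_(n >= M) lambda_n^2] is comparable to [M lambda_M^2].  Hence the
    normalised weights [a_n = lambda_n / (r sigma_M)], [n >= M], are at most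
    [e = a_M], of exact order [M^(-1/2)], and comparable to [e] for [M <= n < 2M].
    The characteristic function of [Ytilde_M] is the limit of
    [prod_n exp (r (log (1 - i a_n t)^-1 - i a_n t))].  For [e t] small, expanding
    the logarithm shows that it is [exp (- t^2 / 2)] times the exponential of the
    cumulant series, whose truncation is the Edgeworth polynomial; for larger [t]
    the [M] comparable factors make it smaller than any power of [e].  Altogether
    the distance of the two transforms is at most [C e^(N-1) t / (1 + t^2)] for all
    [t > 0].  This bound is integrable against [dt / t], so that Fourier inversion,
    justified by Gaussian smoothing, turns it into a uniform bound between
    distribution functions; the transform of the Edgeworth polynomial is inverted
    by differentiating [int_0^oo sin (t x) / t exp (- t^2 / 2) dt]. *)

Import ComplexField.Normc.
Local Open Scope complex_scope.
Local Notation Re := complex.Re.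
Local Notation Im := complex.Im.

(** The tail variable is defined pathwise by [limn], so its transform is reachable only through
    finite sums: every estimate is proved for the block from M to K and then passed to the limit,
    which requires almost sure convergence of the series. For finite K the variance
    [power_sum r a M K 2] is only at most 1, hence it stays in the Gaussian exponents until K tends
    to infinity. No frequency cut-off as in Esseen's inequality occurs: the transforms are compared
    on the whole half-line, so for fixed M the variance of the smoothing Gaussian can be sent to 0
    and leaves no error. The price is a bound with a factor t near 0, to cancel dt / t, and with
    decay at infinity; the former is left over from (t e)^(n+1), the latter comes from one factor (1
    + y)^-1 that is not spent on smallness. The threshold t e = 1 / (4 (n + 1)) makes all
    exponentials lost in the truncation cost at most exp (t^2 / 4), half of the exponent available.
    Complex integration is avoided: the transform of the gamma law solves a differential equation
    supplied by Stein's identity. *)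

Lemma derive_ge0_le {R : realType} (g dg : R -> R) (a b : R) : a <= b ->
  (forall x, a <= x <= b -> is_derive x 1 g (dg x)) ->
  (forall x, a <= x <= b -> 0 <= dg x) -> g a <= g b.
Proof.
rewrite le_eqVlt => /orP[/eqP <-//|ab] gd dg0.
have [||c cab] := @MVT R g dg a b ab.
- by move=> x; rewrite in_itv /= => /andP[/ltW ax /ltW xb]; apply/gd/andP.
- apply: derivable_within_continuous => x; rewrite in_itv /= => xab.
  by have [] := gd x xab.
rewrite -subr_ge0 => ->; rewrite mulr_ge0 ?subr_ge0 ?(ltW ab) // dg0 //.
by move: cab; rewrite in_itv /= => /andP[/ltW -> /ltW ->].
Qed.

Section derive_comp.
Context {R : realType}.
Variables (g : R -> R) (x dg : R).
Hypothesis gd : is_derive x 1 g dg.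

Lemma is_derive_ln_comp : 0 < g x -> is_derive x 1 (fun y => ln (g y)) (dg / g x).
Proof.
move=> g0; have hd := is_derive1_ln g0.
by apply: (is_derive_eq (@is_derive1_comp _ (@ln R) g _ _ _ hd gd)); rewrite mulrC.
Qed.

Lemma is_derive_expR_comp : is_derive x 1 (fun y => expR (g y)) (dg * expR (g x)).
Proof.
by apply: (is_derive_eq (@is_derive1_comp _ (@expR R) g _ _ _ _ gd)); rewrite mulrC.
Qed.

Lemma is_derive_cos_comp : is_derive x 1 (fun y => cos (g y)) (- (dg * sin (g x))).
Proof.
apply: (is_derive_eq (@is_derive1_comp _ (@cos R) g _ _ _ _ gd)).
by rewrite mulNr mulrC.
Qed.

Lemma is_derive_sin_comp : is_derive x 1 (fun y => sin (g y)) (dg * cos (g x)).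
Proof.
by apply: (is_derive_eq (@is_derive1_comp _ (@sin R) g _ _ _ _ gd)); rewrite mulrC.
Qed.

Lemma is_derive_atan_comp :
  is_derive x 1 (fun y => atan (g y)) (dg / (1 + g x ^+ 2)).
Proof.
apply: (is_derive_eq (@is_derive1_comp _ (@atan R) g _ _ _ (is_derive1_atan _) gd)).
by rewrite mulrC.
Qed.

Lemma is_derive_expr n :
  is_derive x 1 (fun y : R => g y ^+ n) (n%:R * g x ^+ n.-1 * dg).
Proof.
rewrite (_ : (fun y => _) = g ^+ n); last first.
  by apply/funext => y; rewrite exprfctE.
by apply: (is_derive_eq (is_deriveX n gd)).
Qed.

Lemma is_derive_scale c : is_derive x 1 (fun y => c * g y) (c * dg).
Proof. exact: is_deriveZ. Qed.

End derive_comp.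

Lemma is_derive_scale_id {R : realType} (c x : R) : is_derive x 1 (fun y => c * y) c.
Proof. by apply: (is_derive_eq (is_derive_scale (is_derive_id x 1) c)); rewrite mulr1. Qed.

Lemma is_derive_exprn {R : realType} n (x : R) :
  is_derive x 1 (fun y : R => y ^+ n) (n%:R * x ^+ n.-1).
Proof. by apply: (is_derive_eq (is_derive_expr (is_derive_id x 1) n)); rewrite mulr1. Qed.

(** * Complex exponential and logarithm *)

Section complex_exponential.
Context {R : realType}.
Implicit Types (z w : R[i]) (x y : R).

Definition cexp z : R[i] :=
  (expR (Re z) * cos (Im z)) +i* (expR (Re z) * sin (Im z)).

Lemma cexpD z w : cexp (z + w) = cexp z * cexp w.
Proof.
case: z w => [a b] [c d]; apply/eqP; rewrite eq_complex /= expRD cosD sinD.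
by apply/andP; split; apply/eqP; ring.
Qed.

Lemma cexp0 : cexp 0 = 1.
Proof. by rewrite /cexp /= expR0 cos0 sin0 mulr0 mulr1. Qed.

Lemma normc_cexp z : normc (cexp z) = expR (Re z).
Proof.
by rewrite /cexp /= !exprMn -mulrDr cos2Dsin2 mulr1 sqrtr_sqr ger0_norm.
Qed.

Lemma cexp_sum (I : Type) (s : seq I) (P : pred I) (f : I -> R[i]) :
  cexp (\sum_(i <- s | P i) f i) = \prod_(i <- s | P i) cexp (f i).
Proof. exact: (big_morph _ cexpD cexp0). Qed.

Lemma normc_ge0 z : 0 <= normc z.
Proof. by case: z => a b; exact: sqrtr_ge0. Qed.

Lemma normcX z n : normc (z ^+ n) = normc z ^+ n.
Proof. by elim: n => [|n ih]; rewrite ?expr0 ?normc1 // !exprS normcM ih. Qed.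

Lemma normc_real x : normc x%:C = `|x|.
Proof. by rewrite /= expr0n addr0 sqrtr_sqr. Qed.

Lemma normc_Re z : `|Re z| <= normc z.
Proof.
by case: z => a b /=; rewrite -sqrtr_sqr ler_wsqrtr // lerDl sqr_ge0.
Qed.

Lemma normc_Im z : `|Im z| <= normc z.
Proof.
by case: z => a b /=; rewrite -sqrtr_sqr ler_wsqrtr // lerDr sqr_ge0.
Qed.

Lemma normc_i : normc ('i : R[i]) = 1.
Proof. by rewrite /= expr0n add0r expr1n sqrtr1. Qed.

Lemma normc_sum (I : Type) (s : seq I) (P : pred I) (f : I -> R[i]) :
  normc (\sum_(i <- s | P i) f i) <= \sum_(i <- s | P i) normc (f i).
Proof.
elim/big_ind2 : _ => [|a b c d ab cd|//]; first by rewrite normc0.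
by rewrite (le_trans (le_normcD _ _)) // lerD.
Qed.

Lemma normc_prod (I : Type) (s : seq I) (P : pred I) (f : I -> R[i]) :
  normc (\prod_(i <- s | P i) f i) = \prod_(i <- s | P i) normc (f i).
Proof. exact: (big_morph _ (@normcM R) (@normc1 R)). Qed.

Lemma Re_realM x z : Re (x%:C * z) = x * Re z.
Proof. by case: z => a b /=; rewrite mul0r subr0. Qed.

Lemma Im_realM x z : Im (x%:C * z) = x * Im z.
Proof. by case: z => a b /=; rewrite mul0r addr0. Qed.

Lemma normcJ z : normc z^* = normc z.
Proof. by case: z => a b /=; rewrite sqrrN. Qed.

Lemma normc_sqr z : normc z ^+ 2 = Re z ^+ 2 + Im z ^+ 2.
Proof. by case: z => a b /=; rewrite sqr_sqrtr // addr_ge0 // sqr_ge0. Qed.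

Definition is_cderive x (f : R -> R[i]) (df : R[i]) :=
  is_derive x 1 (fun y => Re (f y)) (Re df) /\
  is_derive x 1 (fun y => Im (f y)) (Im df).

Lemma is_cderiveD x f g (df dg : R[i]) : is_cderive x f df ->
  is_cderive x g dg -> is_cderive x (fun y => f y + g y) (df + dg).
Proof.
move=> [f1 f2] [g1 g2]; rewrite /is_cderive !raddfD /=.
under eq_fun do rewrite raddfD.
under [X in _ /\ is_derive _ _ X _]eq_fun do rewrite raddfD.
by split; exact: is_deriveD.
Qed.

Lemma is_cderiveN x f (df : R[i]) : is_cderive x f df ->
  is_cderive x (fun y => - f y) (- df).
Proof.
move=> [f1 f2]; rewrite /is_cderive !raddfN /=.
under eq_fun do rewrite raddfN.
under [X in _ /\ is_derive _ _ X _]eq_fun do rewrite raddfN.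
by split; exact: is_deriveN.
Qed.

Lemma is_cderive_cst x z : is_cderive x (fun=> z) 0.
Proof. by split; exact: is_derive_cst. Qed.

Lemma is_cderive_sum x (I : Type) (s : seq I) (f : I -> R -> R[i]) (df : I -> R[i]) :
  (forall i, is_cderive x (f i) (df i)) ->
  is_cderive x (fun y => \sum_(i <- s) f i y) (\sum_(i <- s) df i).
Proof.
move=> fd; elim: s => [|i s ih].
  rewrite big_nil; under eq_fun do rewrite big_nil; exact: is_cderive_cst.
by rewrite big_cons; under eq_fun do rewrite big_cons; exact: is_cderiveD.
Qed.

Lemma is_cderive_realM (h : R -> R) (dh x : R) z : is_derive x 1 h dh ->
  is_cderive x (fun y => (h y)%:C * z) (dh%:C * z).
Proof.
move=> hd; rewrite /is_cderive Re_realM Im_realM mulrC [dh * Im z]mulrC.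
under eq_fun do rewrite Re_realM mulrC.
under [X in _ /\ is_derive _ _ X _]eq_fun do rewrite Im_realM mulrC.
by split; exact: is_deriveZ.
Qed.

(* Projecting on the direction of the endpoint value reduces the vector-valued
   mean value inequality to a scalar one. *)
Lemma normc_le_derive (f df : R -> R[i]) (B dB : R -> R) (b : R) : 0 <= b ->
  (forall x, 0 <= x <= b -> is_cderive x f (df x)) ->
  (forall x, 0 <= x <= b -> is_derive x 1 B (dB x)) ->
  (forall x, 0 <= x <= b -> normc (df x) <= dB x) ->
  normc (f 0) <= B 0 -> normc (f b) <= B b.
Proof.
move=> b0 fd fB dfB f0B0.
have CS (u : R[i]) z : Re u * Re z + Im u * Im z <= normc u * normc z.
  rewrite -(normcJ u) -normcM (le_trans _ (normc_Re _)) //.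
  rewrite (le_trans _ (ler_norm _)) //.
  by case: u z => [p q] [p' q'] /=; rewrite mulNr opprK.
have key (u : R[i]) : normc u <= 1 -> Re u * Re (f b) + Im u * Im (f b) <= B b.
  move=> u1; pose g x := B x - (Re u * Re (f x) + Im u * Im (f x)).
  have gd x : 0 <= x <= b ->
      is_derive x 1 g (dB x - (Re u * Re (df x) + Im u * Im (df x))).
    move=> xb; have ? := fB x xb; have [? ?] := fd x xb.
    apply: is_deriveB; apply: is_deriveD; exact: is_deriveZ.
  have : g 0 <= g b.
    apply: (derive_ge0_le b0 gd) => x xb; rewrite subr_ge0 (le_trans (CS _ _)) //.
    by rewrite (le_trans _ (dfB _ xb)) // ler_piMl // normc_ge0.
  rewrite /g => gb; rewrite -subr_ge0 (le_trans _ gb) // subr_ge0.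
  by rewrite (le_trans (CS _ _)) // (le_trans _ f0B0) // ler_piMl // normc_ge0.
have [->|fneq0] := eqVneq (f b) 0.
  by have := key 0; rewrite normc0 /= !mul0r addr0; apply.
have nf0 : normc (f b) != 0 by apply: contra_neq fneq0; exact: eq0_normc.
have := key ((normc (f b))^-1%:C * f b).
rewrite normcM normc_real ger0_norm ?invr_ge0 ?normc_ge0 // mulVf // => /(_ (lexx _)).
rewrite Re_realM Im_realM -!mulrA -mulrDr -!expr2 -normc_sqr expr2 mulKf //.
Qed.

Definition ctexp n z : R[i] := \sum_(j < n) (j`!%:R^-1)%:C * z ^+ j.

Lemma cexp_real x : cexp x%:C = (expR x)%:C.
Proof. by rewrite /cexp /= cos0 sin0 mulr1 mulr0. Qed.

Lemma is_cderive_cexpZ z x :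
  is_cderive x (fun y : R => cexp (y%:C * z)) (z * cexp (x%:C * z)).
Proof.
case: z => a b; rewrite /is_cderive /cexp /=.
have h1 : is_derive x 1 (fun y : R => y * a - 0 * b) a.
  by apply: is_derive_eq; rewrite ?scaler0 ?addr0 ?oppr0 ?addr0 /GRing.scale /= ?mulr1 ?mulr0 ?add0r.
have h2 : is_derive x 1 (fun y : R => y * b + 0 * a) b.
  by apply: is_derive_eq; rewrite /GRing.scale /= ?mulr1 ?mulr0 ?add0r ?addr0.
have e1 := is_derive1_comp (is_derive_expR _) h1.
have c1 := is_derive1_comp (is_derive_cos _) h2.
have s1 := is_derive1_comp (is_derive_sin _) h2.
split; [apply: (is_derive_eq (is_deriveM e1 c1))|apply: (is_derive_eq (is_deriveM e1 s1))];
  by rewrite /GRing.scale /=; ring.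
Qed.

(** Along the ray from 0 to z the derivative of the remainder of order n + 1 is z times the
    remainder of order n, so induction on n and the mean value inequality suffice. The scale s is
    there for this induction. The usual factor 1 / n! is given up, since only the order in z matters
    later. *)
Lemma cexp_ctexp_scale n z (s : R) : 0 <= s ->
  normc (cexp (s%:C * z) - ctexp n (s%:C * z)) <=
  (s * normc z) ^+ n * expR (s * normc z).
Proof.
elim: n s => [|n ih] s s0.
  rewrite /ctexp big_ord0 subr0 expr0 mul1r normc_cexp ler_expR Re_realM.
  by rewrite ler_wpM2l // (le_trans (ler_norm _)) // normc_Re.
pose f y := cexp (y%:C * z) - ctexp n.+1 (y%:C * z).
pose df y := z * (cexp (y%:C * z) - ctexp n (y%:C * z)).
pose B y := (y * normc z) ^+ n.+1 * expR (y * normc z).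
pose dB y := normc z * ((n.+1%:R * (y * normc z) ^+ n + (y * normc z) ^+ n.+1) * expR (y * normc z)).
apply: (@normc_le_derive f df B dB s s0).
- move=> x _; rewrite /f /df mulrBr.
  apply: is_cderiveD; first exact: is_cderive_cexpZ.
  apply: is_cderiveN; rewrite /ctexp.
  under eq_fun do rewrite big_ord_recl /= expr0.
  rewrite -[X in is_cderive _ _ X]add0r mulr_sumr.
  apply: is_cderiveD; first exact: is_cderive_cst.
  apply: is_cderive_sum => j.
  have -> : z * ((j`!%:R^-1)%:C * (x%:C * z) ^+ j) = (x ^+ j / j`!%:R)%:C * z ^+ j.+1.
    by rewrite exprMn exprS rmorphM /= rmorphXn /=; ring.
  under eq_fun do rewrite exprMn mulrA -rmorphXn -rmorphM /=.
  apply: is_cderive_realM.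
  have -> : x ^+ j / j`!%:R = (j.+1)`!%:R^-1 * (j.+1%:R * x ^+ j).
    by rewrite factS natrM invfM mulrACA mulVf ?pnatr_eq0 // mul1r mulrC.
  apply: is_deriveZ; exact: is_derive_exprn.
- move=> x /andP[x0 _]; rewrite /B /dB.
  have h : is_derive x 1 (fun y : R => y * normc z) (normc z).
    by apply: is_derive_eq; rewrite /GRing.scale /= mulr1 mulr0 add0r.
  apply: (is_derive_eq (is_deriveM (is_derive_expr h n.+1)
    (is_derive1_comp (is_derive_expR _) h))).
  by rewrite /GRing.scale /=; ring.
- move=> x /andP[x0 _]; rewrite /df /dB normcM ler_wpM2l ?normc_ge0 //.
  apply: (le_trans (ih _ x0)); rewrite ler_wpM2r ?expR_ge0 //.
  rewrite -[leLHS]addr0 lerD ?exprn_ge0 ?mulr_ge0 ?normc_ge0 //.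
  by rewrite ler_peMl ?exprn_ge0 ?mulr_ge0 ?normc_ge0 // ler1n.
- have -> : B 0 = 0 by rewrite /B !mul0r exprS !mul0r.
  rewrite (_ : f 0 = 0) ?normc0 // /f rmorph0 mul0r cexp0 /ctexp big_ord_recl expr0 mulr1 big1 ?addr0.
    by rewrite fact0 invr1 subrr.
  by move=> i _; rewrite expr0n mulr0.
Qed.

Lemma cexp_ctexp n z :
  normc (cexp z - ctexp n z) <= normc z ^+ n * expR (normc z).
Proof. by have := cexp_ctexp_scale n z ler01; rewrite !mul1r. Qed.

Lemma texp_le_expR n x : 0 <= x -> \sum_(j < n) j`!%:R^-1 * x ^+ j <= expR x.
Proof.
move=> x0; rewrite [leLHS](_ : _ = series (exp_coeff x) n).
  apply: nondecreasing_cvgn_le; last exact: is_cvg_series_exp_coeff.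
  by apply: nondecreasing_series => k _ _; exact: exp_coeff_ge0.
by rewrite /series /= big_mkord; apply: eq_bigr => j _; rewrite exp_coeffE.
Qed.

Lemma normc_ctexp n z : normc (ctexp n z) <= expR (normc z).
Proof.
rewrite (le_trans _ (texp_le_expR n (normc_ge0 z))) // (le_trans (normc_sum _ _ _)) //.
by apply: ler_sum => j _; rewrite normcM normcX normc_real ger0_norm.
Qed.

Lemma cexpB1 z : normc (cexp z - 1) <= normc z * expR (normc z).
Proof.
have := cexp_ctexp 1 z; rewrite /ctexp big_ord_recl big_ord0 expr0 addr0 mulr1.
by rewrite fact0 invr1 expr1.
Qed.

Definition clog u : R[i] := (- (ln (1 + u ^+ 2) / 2)) +i* atan u.

Lemma is_cderive_clog u : is_cderive u clog ('i / (1 - u%:C * 'i)).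
Proof.
have u1 : 0 < 1 + u ^+ 2 by rewrite ltr_pwDl // sqr_ge0.
split; rewrite /clog /=.
  have h : is_derive u 1 (fun y : R => 1 + y ^+ 2) (2 * u).
    apply: (is_derive_eq (is_deriveD (is_derive_cst (1:R) u 1) (is_derive_exprn 2 u))).
    by rewrite add0r expr1.
  have hl := is_derive_ln_comp h u1.
  apply: (is_derive_eq (is_deriveN (is_deriveM hl (is_derive_cst (2^-1:R) u 1)))).
  rewrite scaler0 add0r /GRing.scale /= !mul0r !mul1r !mulr0 !addr0 !subr0 sub0r.
  by rewrite add0r expr1n sqrrN; field; rewrite gt_eqF.
apply: (is_derive_eq (is_derive1_atan u)).
rewrite !mul0r !mul1r !mulr0 !addr0 !subr0 sub0r.
by rewrite add0r expr1n sqrrN mulr1 mul1r.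
Qed.

(** The derivative of the remainder is i (iu)^n / (1 - iu), and |1 - iu| >= 1 on the whole real
    line; hence the bound holds for every u >= 0, beyond the radius of convergence of the series. *)
Lemma clog_expansion n u : 0 <= u ->
  normc (clog u - \sum_(j < n) (j.+1%:R^-1)%:C * (u%:C * 'i) ^+ j.+1) <= u ^+ n.+1.
Proof.
move=> u0.
pose f y := clog y - \sum_(j < n) (j.+1%:R^-1)%:C * (y%:C * 'i) ^+ j.+1.
pose df y := 'i * (y%:C * 'i) ^+ n / (1 - y%:C * 'i) : R[i].
have n1 y : 1 <= normc (1 - y%:C * 'i).
  by rewrite (le_trans _ (normc_Re _)) //= !mul0r !mulr0 !subr0 normr1.
have nz y : 1 - y%:C * 'i != 0 :> R[i].
  by apply/eqP => e; have := n1 y; rewrite e normc0 ler10.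
apply: (@normc_le_derive f df (fun y => y ^+ n.+1) (fun y => n.+1%:R * y ^+ n) u u0).
- move=> x _; rewrite /f.
  have -> : df x = 'i / (1 - x%:C * 'i) - \sum_(j < n) 'i * (x%:C * 'i) ^+ j.
    rewrite /df -mulr_sumr; have := subrX1 (x%:C * 'i) n; rewrite -[_ * 'i - 1]opprB mulNr.
    set g := \sum_(_ < _) _ => /eqP; rewrite subr_eq => /eqP ->.
    by move: (nz x); set w := 1 - _ => w0; field.
  apply: is_cderiveD; first exact: is_cderive_clog.
  apply/is_cderiveN/is_cderive_sum => j.
  under eq_fun do rewrite exprMn mulrA -rmorphXn -rmorphM /=.
  have -> : 'i * (x%:C * 'i) ^+ j = (j.+1%:R^-1 * (j.+1%:R * x ^+ j))%:C * 'i ^+ j.+1 :> R[i].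
    by rewrite mulKf ?pnatr_eq0 // rmorphXn /= exprMn exprS mulrCA.
  by apply/is_cderive_realM/is_deriveZ; exact: is_derive_exprn.
- by move=> x _; exact: is_derive_exprn.
- move=> x /andP[x0 _]; rewrite /df normcM normcV normcM normc_i mul1r normcX normcM.
  rewrite normc_i mulr1 normc_real ger0_norm // (@le_trans _ _ (x ^+ n)) //.
    by rewrite ler_piMr ?exprn_ge0 // invf_le1 // (lt_le_trans ltr01).
  by rewrite ler_peMl ?exprn_ge0 // ler1n.
- have z0 : (0 : R)%:C * 'i = 0 :> R[i] by rewrite rmorph0 mul0r.
  rewrite /f big1 => [|j _]; last by rewrite z0 exprS mul0r mulr0.
  rewrite subr0 /clog [0 ^+ n.+1]exprS mul0r expr0n addr0 ln1 mul0r oppr0 atan0 /=.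
  by rewrite expr0n addr0 sqrtr0.
Qed.

(** * Truncation of the exponential of a cumulant series *)

Lemma normc_prodB (I : Type) (s : seq I) (a b : I -> R[i]) (d E : I -> R) :
  (forall i, normc (a i) <= E i) -> (forall i, normc (b i) <= E i) ->
  (forall i, normc (a i - b i) <= d i * E i) ->
  normc (\prod_(i <- s) a i - \prod_(i <- s) b i) <=
  (\sum_(i <- s) d i) * \prod_(i <- s) E i.
Proof.
move=> aE bE abE; elim: s => [|i s ih]; first by rewrite !big_nil subrr normc0 mul0r.
rewrite !big_cons.
(* One factor is exchanged at a time; [E] majorises both families, so the factors left alone cost at
   most their [E]. *)
rewrite [X in normc X](_ : _ = (a i - b i) * \prod_(j <- s) a j +
  b i * (\prod_(j <- s) a j - \prod_(j <- s) b j)); last by ring.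
rewrite (le_trans (le_normcD _ _)) // !normcM mulrDl lerD //.
  rewrite mulrA ler_pM ?normc_ge0 // normc_prod.
  by apply: ler_prod => j _; rewrite normc_ge0 aE.
by rewrite mulrCA ler_pM ?normc_ge0.
Qed.

(** The index i stands for the cumulant of order i + 3, which has size e^(i+1); so [weight k] is the
    power of e carried by the monomial k. Exponents range over 'I_n.+1 because weight at most n
    forces each k i to be at most n. *)
Definition weight n (k : {ffun 'I_n -> 'I_n.+1}) : nat := \sum_(i < n) (i + 1) * k i.

Lemma prod_expr_weight n (k : {ffun 'I_n -> 'I_n.+1}) x :
  \prod_(i < n) (x ^+ i.+1) ^+ k i = x ^+ weight k.
Proof.
rewrite /weight -prodrXr; apply: eq_bigr => i _; by rewrite -exprM addn1.
Qed.

(** Rankin's trick: since y / delta <= 1, a monomial of weight above n is at most (y / delta)^(n+1)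
    times its majorant at delta. At delta the constraint on the weight is dropped, and the full sum
    factors into truncated exponentials. *)
Lemma sum_heavy_le n (z : 'I_n -> R[i]) (tau y delta : R) :
  0 <= tau -> 0 <= y <= delta -> 0 < delta <= 1 ->
  (forall i, normc (z i) <= tau * y ^+ i.+1) ->
  normc (\sum_(k : {ffun 'I_n -> 'I_n.+1} | (n < weight k)%N)
     \prod_(i < n) (((k i)`!%:R^-1)%:C * z i ^+ k i)) <=
  (y / delta) ^+ n.+1 * expR (tau * (n%:R * delta)).
Proof.
move=> tau0 /andP[y0 yd] /andP[d0 d1] zb.
have d0' := ltW d0.
have term_ge0 i j : 0 <= j`!%:R^-1 * (tau * delta ^+ i) ^+ j.
  by rewrite mulr_ge0 ?invr_ge0 ?exprn_ge0 ?mulr_ge0 ?exprn_ge0.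
have yd0 : 0 <= y / delta by rewrite divr_ge0.
have yd1 : y / delta <= 1 by rewrite ler_pdivrMr // mul1r.
rewrite (le_trans (normc_sum _ _ _)) //.
apply: (@le_trans _ _ (\sum_(k : {ffun 'I_n -> 'I_n.+1} | (n < weight k)%N)
   (y / delta) ^+ n.+1 * \prod_(i < n) ((k i)`!%:R^-1 * (tau * delta ^+ i.+1) ^+ k i))).
  apply: ler_sum => k wk; rewrite normc_prod.
  apply: (@le_trans _ _ (\prod_(i < n) ((k i)`!%:R^-1 * (tau * y ^+ i.+1) ^+ k i))).
    apply: ler_prod => i _; rewrite normc_ge0 /= normcM normcX normc_real.
    rewrite ger0_norm ?invr_ge0 // ler_wpM2l ?invr_ge0 // lerXn2r ?zb //.
    - by rewrite nnegrE normc_ge0.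
    - by rewrite nnegrE mulr_ge0 ?exprn_ge0.
  have -> : \prod_(i < n) ((k i)`!%:R^-1 * (tau * y ^+ i.+1) ^+ k i) =
     (y / delta) ^+ weight k *
     \prod_(i < n) ((k i)`!%:R^-1 * (tau * delta ^+ i.+1) ^+ k i).
    rewrite -prod_expr_weight -big_split /=; apply: eq_bigr => i _.
    rewrite [RHS]mulrCA -[in RHS]exprMn; congr (_ * _ ^+ _).
    by rewrite [RHS]mulrCA -exprMn divfK ?gt_eqF.
  rewrite ler_wpM2r //.
    by apply: prodr_ge0 => i _.
  by rewrite ler_wiXn2l.
rewrite -mulr_sumr ler_wpM2l ?exprn_ge0 //.
apply: (@le_trans _ _ (\sum_(k : {ffun 'I_n -> 'I_n.+1})
    \prod_(i < n) ((k i)`!%:R^-1 * (tau * delta ^+ i.+1) ^+ k i))).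
  rewrite [leRHS](bigID (fun k => (n < weight k)%N)) /= lerDl sumr_ge0 // => k _.
  by apply: prodr_ge0 => i _.
rewrite -(bigA_distr_bigA (fun (i : 'I_n) (j : 'I_n.+1) => j`!%:R^-1 * (tau * delta ^+ i.+1) ^+ j)) /=.
apply: (@le_trans _ _ (\prod_(i < n) expR (tau * delta))).
  apply: ler_prod => i _; rewrite sumr_ge0 //=.
  rewrite (le_trans (texp_le_expR _ _)) ?mulr_ge0 ?exprn_ge0 //.
  by rewrite ler_expR ler_wpM2l // exprS ler_piMr // exprn_ile1.
by rewrite prodr_const card_ord -expRM_natl mulrCA.
Qed.

(** Three errors, each of order y^(n+1), are added: omitting [rho], cutting each exponential after
    degree n, and discarding the monomials of weight above n in the product of the truncated
    exponentials. *)
Lemma edgeworth_truncation n (z : 'I_n -> R[i]) (rho : R[i]) (tau y : R) :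
  0 <= tau -> 0 <= y <= (4 * n.+1%:R)^-1 ->
  (forall i, normc (z i) <= tau * y ^+ i.+1) -> normc rho <= tau * y ^+ n.+1 ->
  normc (cexp (\sum_(i < n) z i + rho) -
     \sum_(k : {ffun 'I_n -> 'I_n.+1} | (weight k <= n)%N)
     \prod_(i < n) (((k i)`!%:R^-1)%:C * z i ^+ k i)) <=
  y ^+ n.+1 * (tau + n%:R * tau ^+ n.+1 + (4 * n.+1%:R) ^+ n.+1) * expR (tau / 4).
Proof.
move=> tau0 /andP[y0 yd] zb rhob.
(* Chosen so that n delta + delta = 1/4: the n terms [z i] and [rho], each at most tau delta,
   together cost no more than exp (tau / 4). *)
set delta := (4 * n.+1%:R)^-1 in yd.
have d0 : 0 < delta by rewrite invr_gt0 mulr_gt0 ?ltr0n.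
have d1 : delta <= 1 by rewrite invf_le1 ?mulr_gt0 ?ltr0n // -natrM ler1n.
have y1 : y <= 1 by exact: le_trans d1.
have nd : n%:R * delta + delta = 4^-1.
  by rewrite -[X in _ + X]mul1r -mulrDl natr1 /delta invfM mulrCA divff ?mulr1.
have zd i : normc (z i) <= tau * delta.
  rewrite (le_trans (zb i)) // ler_wpM2l // exprS (le_trans _ yd) // ler_piMr //.
  by rewrite exprn_ile1.
have rd : normc rho <= tau * delta.
  rewrite (le_trans rhob) // ler_wpM2l // exprS (le_trans _ yd) // ler_piMr //.
  by rewrite exprn_ile1.
set Q := \sum_(k | (weight k <= n)%N) _.
set H := \sum_(k : {ffun 'I_n -> 'I_n.+1} | (n < weight k)%N)
     \prod_(i < n) (((k i)`!%:R^-1)%:C * z i ^+ k i).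
have QH : \prod_(i < n) ctexp n.+1 (z i) = Q + H.
  rewrite (bigA_distr_bigA (fun (i : 'I_n) (j : 'I_n.+1) => (j`!%:R^-1)%:C * z i ^+ j)) /=.
  rewrite (bigID (fun k => (weight k <= n)%N)) /=; congr (_ + _).
  by apply: eq_bigl => k; rewrite -ltnNge.
have -> : cexp (\sum_(i < n) z i + rho) - Q =
   cexp (\sum_(i < n) z i) * (cexp rho - 1) +
   ((\prod_(i < n) cexp (z i) - \prod_(i < n) ctexp n.+1 (z i)) + H).
  by rewrite cexpD cexp_sum QH; ring.
have Hle := sum_heavy_le tau0 (introT andP (conj y0 yd)) (introT andP (conj d0 d1)) zb.
have Edelta : \prod_(i < n) expR (normc (z i)) <= expR (tau * (n%:R * delta)).
  rewrite -expR_sum ler_expR (le_trans (ler_sum _ (fun i _ => zd i))) //.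
  by rewrite sumr_const card_ord -mulrnAr mulr_natl.
have En : expR (tau * (n%:R * delta)) <= expR (tau / 4).
  by rewrite ler_expR ler_wpM2l // -nd lerDl ltW.
have Pd : normc (\prod_(i < n) cexp (z i) - \prod_(i < n) ctexp n.+1 (z i)) <=
    n%:R * tau ^+ n.+1 * y ^+ n.+1 * expR (tau / 4).
  have := @normc_prodB _ (index_enum 'I_n) (fun i => cexp (z i))
    (fun i => ctexp n.+1 (z i)) (fun i => normc (z i) ^+ n.+1)
    (fun i => expR (normc (z i))).
  move=> /(_ _ _ _)/le_trans; apply.
  - move=> i; rewrite normc_cexp ler_expR.
    by rewrite (le_trans (ler_norm _)) // normc_Re.
  - by move=> i; exact: normc_ctexp.
  - by move=> i; exact: cexp_ctexp.
  rewrite ler_pM ?(le_trans Edelta) ?prodr_ge0 ?sumr_ge0 //.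
  - by move=> i _; rewrite exprn_ge0 ?normc_ge0.
  - rewrite -mulrA -exprMn; apply: (@le_trans _ _ (\sum_(i < n) (tau * y) ^+ n.+1)).
      apply: ler_sum => i _; rewrite lerXn2r ?nnegrE ?normc_ge0 ?mulr_ge0 //.
      rewrite (le_trans (zb i)) // ler_wpM2l // exprS ler_piMr // exprn_ile1 //.
    by rewrite sumr_const card_ord mulr_natl.
have Rd : normc (cexp (\sum_(i < n) z i) * (cexp rho - 1)) <= tau * y ^+ n.+1 * expR (tau / 4).
  rewrite normcM cexp_sum normc_prod -nd mulrDr expRD mulrCA.
  rewrite ler_pM ?normc_ge0 ?prodr_ge0 //; first by move=> i _; exact: normc_ge0.
    apply: le_trans Edelta; apply: ler_prod => i _; rewrite normc_ge0 normc_cexp ler_expR.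
    by rewrite (le_trans (ler_norm _)) // normc_Re.
  rewrite (le_trans (cexpB1 _)) // ler_pM ?normc_ge0 //.
  by rewrite ler_expR.
have Hd : normc H <= (4 * n.+1%:R) ^+ n.+1 * y ^+ n.+1 * expR (tau / 4).
  rewrite (le_trans Hle) // ler_pM ?exprn_ge0 ?divr_ge0 // ?(ltW d0) //.
  by rewrite expr_div_n mulrC /delta exprVn invrK.
rewrite (le_trans (le_normcD _ _)) //.
rewrite [leRHS](_ : _ = tau * y ^+ n.+1 * expR (tau / 4) +
  (n%:R * tau ^+ n.+1 * y ^+ n.+1 * expR (tau / 4) +
   (4 * n.+1%:R) ^+ n.+1 * y ^+ n.+1 * expR (tau / 4))).
  by rewrite lerD // (le_trans (le_normcD _ _)) // lerD.
set E := expR _; set Y := y ^+ _; set D := (4 * _) ^+ _; set T := tau ^+ n.+1; ring.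
Qed.

End complex_exponential.


(** * Characteristic functions of gamma sums *)

Section characteristic_estimate.
Context {R : realType}.
Implicit Types (t : R) (c : nat -> R).

(* The [i]-th cumulant coefficient [kappa_(i+3) / (i+3)!] is [c i]. *)
Definition edgeworth_poly n c t : R[i] :=
  \sum_(k : {ffun 'I_n -> 'I_n.+1} | (weight k <= n)%N)
     \prod_(i < n) (((k i)`!%:R^-1)%:C * ((c i)%:C * (t%:C * 'i) ^+ i.+3) ^+ k i).

(** From t^m <= 1 + t^(2m) only an even power has to be treated, and (t^2 / 4)^m / m! is a single
    term of the series of exp (t^2 / 4). *)
Lemma poly_gauss_bounded m : exists2 C : R, 0 <= C &
  forall t, 0 <= t -> t ^+ m * expR (- (t ^+ 2 / 4)) <= C.
Proof.
exists (1 + 4 ^+ m * m`!%:R); first by rewrite addr_ge0 ?mulr_ge0 ?exprn_ge0.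
move=> t t0.
have tm : t ^+ m <= 1 + t ^+ (2 * m).
  have [t1|/ltW t1] := leP t 1.
    by rewrite (le_trans (exprn_ile1 _ _ _)) // lerDl exprn_ge0.
  by rewrite -[leLHS]add0r lerD // ler_weXn2l // leq_pmull.
have e1 : t ^+ (2 * m) * expR (- (t ^+ 2 / 4)) <= 4 ^+ m * m`!%:R.
  rewrite expRN ler_pdivrMr ?expR_gt0 //.
  have := @texp_le_expR R m.+1 (t ^+ 2 / 4) (divr_ge0 (sqr_ge0 t) (ler0n _ _)).
  rewrite big_ord_recr /= => h.
  rewrite exprM -[leLHS](_ : 4 ^+ m * m`!%:R * (m`!%:R^-1 * (t ^+ 2 / 4) ^+ m) = _).
    rewrite ler_wpM2l ?mulr_ge0 ?exprn_ge0 //; apply: le_trans h.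
    rewrite lerDr sumr_ge0 // => i _.
    by rewrite mulr_ge0 ?invr_ge0 ?exprn_ge0 ?divr_ge0 ?sqr_ge0.
  rewrite mulrA mulfK ?pnatr_eq0 -?lt0n ?fact_gt0 // expr_div_n mulrCA mulfV ?mulr1 //.
rewrite (le_trans (ler_wpM2r (expR_ge0 _) tm)) // mulrDl mul1r lerD //.
by rewrite -[leRHS]expR0 ler_expR oppr_le0 divr_ge0 ?sqr_ge0.
Qed.

Section fixed_scale.
Variables (r : R) (a : nat -> R) (M : nat) (e : R).
Hypotheses (r0 : 0 <= r) (ae : forall n, (M <= n)%N -> 0 <= a n <= e).

(** For a n = lambda_n / (r sigma_M) this is the k-th cumulant of the normalised block divided by (k
    - 1)!; hence [power_sum K k / k] plays the role of kappa_k / k!. *)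
Definition power_sum K k := r * \sum_(M <= n < K) a n ^+ k.

(** The characteristic function of the sum of r a_n (eta_n - 1) over M <= n < K, as
    [partial_sum_char] confirms; the term - i a_n t accounts for the centring. *)
Definition gamma_cf K t : R[i] :=
  cexp (\sum_(M <= n < K) r%:C * (clog (a n * t) - (a n * t)%:C * 'i)).

Lemma power_sum_ge0 K k : 0 <= power_sum K k.
Proof.
rewrite mulr_ge0 // big_nat sumr_ge0 // => n /andP[Mn _].
by have /andP[a0 _] := ae Mn; rewrite exprn_ge0.
Qed.

Lemma power_sum_le K k : power_sum K k.+2 <= e ^+ k * power_sum K 2.
Proof.
rewrite /power_sum mulrCA ler_wpM2l // mulr_sumr.
rewrite !big_nat ler_sum // => n /andP[Mn _].
have /andP[a0 an] := ae Mn.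
by rewrite -addn2 exprD ler_wpM2r ?exprn_ge0 // lerXn2r // nnegrE // (le_trans a0).
Qed.

(** Expanding [clog] to order n + 2, the linear term cancels against the centring, the quadratic one
    is the Gaussian exponent, and the other n are the cumulants of order 3 to n + 2. The remainder
    is at most r times the sum of (a_m t)^(n+3), of which two powers are summed and n + 1 are
    bounded by t e. *)
Lemma gamma_log_expansion K n t : 0 <= t -> exists2 rho,
  \sum_(M <= n < K) r%:C * (clog (a n * t) - (a n * t)%:C * 'i) =
   (- (power_sum K 2 * t ^+ 2 / 2))%:C +
   (\sum_(i < n) (power_sum K i.+3 / i.+3%:R)%:C * (t%:C * 'i) ^+ i.+3 + rho) &
  normc rho <= power_sum K 2 * t ^+ 2 * (t * e) ^+ n.+1.
Proof.
move=> t0.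
exists (\sum_(M <= m < K) r%:C * (clog (a m * t) -
    \sum_(j < n.+2) (j.+1%:R^-1)%:C * ((a m * t)%:C * 'i) ^+ j.+1)).
  rewrite [X in _ = _ + (X + _)](_ : _ = \sum_(M <= m < K) r%:C *
    \sum_(i < n) (i.+3%:R^-1)%:C * ((a m * t)%:C * 'i) ^+ i.+3); last first.
    under [RHS]eq_bigr do rewrite mulr_sumr.
    rewrite exchange_big /=; apply: eq_bigr => i _.
    rewrite /power_sum 2!rmorphM /= rmorph_sum /= mulr_sumr !mulr_suml.
    apply: eq_bigr => m _.
    by rewrite rmorphXn rmorphM /= !exprMn; ring.
  have -> : (- (power_sum K 2 * t ^+ 2 / 2))%:C = \sum_(M <= m < K) r%:C *
     ((2%:R^-1)%:C * ((a m * t)%:C * 'i) ^+ 2) :> R[i].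
    rewrite /power_sum -mulr_sumr -mulr_sumr.
    have -> : \sum_(M <= m < K) ((a m * t)%:C * 'i) ^+ 2 =
       (- ((\sum_(M <= m < K) a m ^+ 2) * t ^+ 2))%:C :> R[i].
      rewrite mulr_suml -sumrN rmorph_sum /=; apply: eq_bigr => m _.
      by rewrite exprMn sqr_i -rmorphXn mulrN1 rmorphN /= exprMn.
    set S := \sum_(_ <= m < _) _.
    rewrite [X in X%:C = _](_ : _ = r * (2^-1 * - (S * t ^+ 2))); last by ring.
    by rewrite rmorphM rmorphM.
  rewrite -!big_split /=; apply: eq_bigr => m _; rewrite -!mulrDr; congr (_ * _).
  rewrite 2!big_ord_recl /= invr1 mul1r expr1.
  rewrite [X in _ - (_ + (_ + X))](_ : _ =
    \sum_(i < n) (i.+3%:R^-1)%:C * ((a m * t)%:C * 'i) ^+ i.+3); last exact: eq_bigr.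
  rewrite /bump /=; set S1 := \sum_(i < n) _; set x := (a m * t)%:C * 'i.
  by set c := (_^-1)%:C * x ^+ 2; set y := clog _; ring.
rewrite (le_trans (normc_sum _ _ _)) //.
rewrite [leRHS](_ : _ = \sum_(M <= m < K) r * (a m ^+ 2 * e ^+ n.+1 * t ^+ n.+3)); last first.
  rewrite /power_sum -mulr_sumr -!mulr_suml exprMn -[n.+3]addn2 exprD /=; ring.
rewrite !big_nat ler_sum // => m /andP[Mm _]; have /andP[a0 am] := ae Mm.
rewrite normcM normc_real ger0_norm // ler_wpM2l //.
rewrite (le_trans (clog_expansion _ _)) ?mulr_ge0 // exprMn ler_wpM2r ?exprn_ge0 //.
rewrite -[n.+3]addn2 addnC exprD ler_wpM2l ?exprn_ge0 // lerXn2r // nnegrE //.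
exact: le_trans am.
Qed.

(** [edgeworth_truncation] with tau = p t^2 and y = t e, where p is the variance of the block. Its
    loss exp (tau / 4) uses up half of the Gaussian factor exp (- tau / 2). *)
Lemma gamma_cf_estimate K n t : 0 <= t -> t * e <= (4 * n.+1%:R)^-1 ->
  power_sum K 2 <= 1 ->
  normc (gamma_cf K t - (expR (- (power_sum K 2 * t ^+ 2 / 2)))%:C *
    edgeworth_poly n (fun i => power_sum K i.+3 / i.+3%:R) t) <=
  (t * e) ^+ n.+1 * (t ^+ 2 + n%:R * (t ^+ 2) ^+ n.+1 + (4 * n.+1%:R) ^+ n.+1) *
  expR (- (power_sum K 2 * t ^+ 2 / 4)).
Proof.
move=> t0 ted p1.
have [rho E rhob] := @gamma_log_expansion K n t t0.
have e0 : 0 <= e by have /andP[a0 aM] := ae (leqnn M); exact: le_trans aM.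
rewrite /gamma_cf E cexpD cexp_real -mulrBr normcM normc_real ger0_norm ?expR_ge0 //.
set p := power_sum K 2 in rhob E p1 *; set tau := p * t ^+ 2.
have p0 : 0 <= p by exact: power_sum_ge0.
have tau0 : 0 <= tau by rewrite mulr_ge0 ?sqr_ge0.
have te0 : 0 <= t * e by rewrite mulr_ge0.
have h := @edgeworth_truncation R n
  (fun i => (power_sum K i.+3 / i.+3%:R)%:C * (t%:C * 'i) ^+ i.+3) rho tau (t * e).
have {h} := h tau0 (introT andP (conj te0 ted)) _ rhob.
move=> /(_ _)/(ler_wpM2l (expR_ge0 (- (tau / 2))))/le_trans; apply.
  move=> i; rewrite normcM normcX normcM normc_i !normc_real mulr1 !ger0_norm //; last first.
    by rewrite divr_ge0 ?power_sum_ge0.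
  rewrite [leRHS](_ : _ = e ^+ i.+1 * p * t ^+ i.+3); last first.
    by rewrite /tau exprMn -[i.+3]addn2 exprD; ring.
  rewrite ler_wpM2r ?exprn_ge0 // (le_trans _ (power_sum_le _ _)) //.
  by rewrite ler_piMr ?power_sum_ge0 // invf_le1 ?ler1n ?ltr0n.
rewrite mulrCA -expRD (_ : - (tau / 2) + tau / 4 = - (tau / 4)); last by lra.
rewrite ler_wpM2r ?expR_ge0 // ler_wpM2l ?exprn_ge0 // lerD2r.
have tt : tau <= t ^+ 2 by rewrite ler_piMl ?sqr_ge0.
by rewrite lerD // ler_wpM2l // lerXn2r // nnegrE ?sqr_ge0.
Qed.

Lemma gamma_cf_decay K m b t : 0 <= b -> (M + m <= K)%N ->
  (forall n, (M <= n < M + m)%N -> b <= a n) ->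
  normc (gamma_cf K t) <= expR (- (r * m%:R / 2 * ln (1 + (b * t) ^+ 2))).
Proof.
move=> b0 MmK ab; rewrite normc_cexp ler_expR.
have lnge0 (x : R) : 0 <= ln (1 + x ^+ 2) by rewrite ln_ge0 // lerDl sqr_ge0.
rewrite [leLHS](_ : _ = - (r / 2 * \sum_(M <= n < K) ln (1 + (a n * t) ^+ 2))).
  rewrite lerN2 [r * _ / 2]mulrAC -[leLHS]mulrA ler_wpM2l ?divr_ge0 //.
  rewrite (@big_cat_nat _ _ _ (M + m)%N) ?leq_addr //=.
  rewrite -[leLHS]addr0 lerD ?sumr_ge0 //.
  rewrite mulr_natl -[m in leLHS](addKn M) -sumr_const_nat !big_nat ler_sum // => n nM.
  rewrite ler_ln ?posrE ?ltr_pwDl ?sqr_ge0 // lerD2l !exprMn ler_wpM2r ?sqr_ge0 //.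
  by rewrite lerXn2r // ?nnegrE ?ab // (le_trans b0) ?ab.
rewrite -mulr_sumr Re_realM raddf_sum /= [RHS](_ : _ = r * - (2^-1 * \sum_(M <= n < K)
  ln (1 + (a n * t) ^+ 2))); last by ring.
congr (r * _).
rewrite mulr_sumr -sumrN; apply: eq_bigr => n _ /=.
by rewrite mulr0 mul0r !subr0 mulrC.
Qed.

End fixed_scale.

Lemma ReB (z w : R[i]) : Re (z - w) = Re z - Re w.
Proof. by case: z w => [? ?] []. Qed.

Lemma ImB (z w : R[i]) : Im (z - w) = Im z - Im w.
Proof. by case: z w => [? ?] []. Qed.

Lemma cvg_exprn (u : nat -> R) (x : R) n :
  u @ \oo --> x -> (fun k => u k ^+ n) @ \oo --> x ^+ n.
Proof.
move=> ux; elim: n => [|n ih]; first by under eq_fun do rewrite expr0; exact: cvg_cst.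
by under eq_fun do rewrite exprS; rewrite exprS; exact: cvgM.
Qed.

Lemma normc_le_limit (z_ : nat -> R[i]) (z : R[i]) (b_ : nat -> R) (b : R) :
  (fun K => Re (z_ K)) @ \oo --> Re z -> (fun K => Im (z_ K)) @ \oo --> Im z ->
  b_ @ \oo --> b -> (\forall K \near \oo, normc (z_ K) <= b_ K) -> normc z <= b.
Proof.
move=> zR zI bb zb; have zE (w : R[i]) : normc w = Num.sqrt (Re w ^+ 2 + Im w ^+ 2).
  by case: w.
apply: (ler_cvg_to _ bb zb).
under eq_fun do rewrite zE; rewrite zE.
apply: continuous_cvg; first exact: sqrt_continuous.
by apply: cvgD; apply: cvgM.
Qed.

Lemma edgeworth_polyE n c t : edgeworth_poly n c t =
  \sum_(k : {ffun 'I_n -> 'I_n.+1} | (weight k <= n)%N)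
    (\prod_(i < n) ((k i)`!%:R^-1 * c i ^+ k i))%:C *
    (t%:C * 'i) ^+ (\sum_(i < n) i.+3 * k i).
Proof.
apply: eq_bigr => k _; rewrite rmorph_prod -prodrXr -big_split /=.
by apply: eq_bigr => i _; rewrite rmorphM rmorphXn /= exprMn exprM mulrA.
Qed.

Lemma edgeworth_poly_cvg n (c_ : nat -> nat -> R) c t :
  (forall i, c_ ^~ i @ \oo --> c i) ->
  (fun K => Re (edgeworth_poly n (c_ K) t)) @ \oo --> Re (edgeworth_poly n c t) /\
  (fun K => Im (edgeworth_poly n (c_ K) t)) @ \oo --> Im (edgeworth_poly n c t).
Proof.
move=> cc; have coef (k : {ffun 'I_n -> 'I_n.+1}) :
    (fun K => \prod_(i < n) ((k i)`!%:R^-1 * c_ K i ^+ k i)) @ \oo -->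
    \prod_(i < n) ((k i)`!%:R^-1 * c i ^+ k i).
  apply: cvg_big => [|i _]; first exact: mul_continuous.
  by apply: cvgMr; exact: cvg_exprn.
rewrite edgeworth_polyE; under eq_fun do rewrite edgeworth_polyE.
under [X in _ /\ (X @ _ --> _)]eq_fun do rewrite edgeworth_polyE.
rewrite !raddf_sum /=; under eq_fun do rewrite raddf_sum /=.
under [X in _ /\ (X @ _ --> _)]eq_fun do rewrite raddf_sum /=.
split; apply: cvg_big => [|k _]; do 1?exact: add_continuous.
  under eq_fun do rewrite Re_realM; rewrite Re_realM; exact: cvgMl.
under eq_fun do rewrite Im_realM; rewrite Im_realM; exact: cvgMl.
Qed.

(** Since i + 3 <= 3 (i + 1), weight at most n gives degree at most 3 n; with coefficients in [0, 1]
    each monomial is then at most t^(3n). *)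
Lemma normc_edgeworth_poly n c t : 1 <= t -> (forall i, 0 <= c i <= 1) ->
  normc (edgeworth_poly n c t) <= #|{ffun 'I_n -> 'I_n.+1}|%:R * t ^+ (3 * n).
Proof.
move=> t1 c1; have t0 : 0 <= t by exact: le_trans t1.
rewrite edgeworth_polyE (le_trans (normc_sum _ _ _)) //.
apply: (@le_trans _ _ (\sum_(k : {ffun 'I_n -> 'I_n.+1} | (weight k <= n)%N) t ^+ (3 * n))).
  apply: ler_sum => k wk; rewrite normcM normcX normcM normc_i !normc_real mulr1.
  rewrite (ger0_norm t0) -[leRHS]mul1r ler_pM ?exprn_ge0 //.
    rewrite ger0_norm; last first.
      by apply: prodr_ge0 => i _; have /andP[? ?] := c1 i; rewrite mulr_ge0 ?invr_ge0 ?exprn_ge0.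
    apply: prodr_ile1 => i _; have /andP[? ?] := c1 i.
    rewrite mulr_ge0 ?invr_ge0 ?exprn_ge0 //= mulr_ile1 ?invr_ge0 ?exprn_ge0 ?exprn_ile1 //.
    by rewrite invf_le1 ?ltr0n ?ler1n ?fact_gt0.
  rewrite ler_weXn2l // (leq_trans _ (leq_mul (leqnn 3) wk)) // /weight big_distrr /=.
  by apply: leq_sum => i _; rewrite mulnA leq_mul2r; apply/orP; right; lia.
rewrite [leRHS](_ : _ = \sum_(k : {ffun 'I_n -> 'I_n.+1}) t ^+ (3 * n)); last first.
  by rewrite sumr_const mulr_natl.
by rewrite [leRHS](bigID (fun k => (weight k <= n)%N)) /= lerDl sumr_ge0 // => k _; rewrite exprn_ge0.
Qed.


(** [C] and [M0] are chosen before M, the weights and the scale, which is the uniformity needed in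
    M. Two regimes meet at t e = delta: below it the expansion is compared term by term, above it
    the transform and its approximation are small separately. *)
Lemma edgeworth_cf_bound (r c1 c2 : R) n : 0 < r -> 0 < c1 -> 0 < c2 ->
  exists2 C : R, 0 <= C & exists M0 : nat, forall M (a s : nat -> R) (e : R) (phi : R -> R[i]),
  (M0 <= M)%N -> 0 < e <= (4 * n.+1%:R)^-1 -> c2 <= M%:R * e ^+ 2 ->
  (forall m, (M <= m)%N -> 0 <= a m <= e) ->
  (forall m, (M <= m < M + M)%N -> c1 * e <= a m) ->
  (forall K, power_sum r a M K 2 <= 1) ->
  (fun K => power_sum r a M K 2) @ \oo --> (1 : R) ->
  (forall i, (fun K => power_sum r a M K i.+3 / i.+3%:R) @ \oo --> s i) ->
  (forall t, (fun K => Re (gamma_cf r a M K t)) @ \oo --> Re (phi t)) ->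
  (forall t, (fun K => Im (gamma_cf r a M K t)) @ \oo --> Im (phi t)) ->
  forall t, 0 < t -> normc (phi t - (expR (- (t ^+ 2 / 2)))%:C * edgeworth_poly n s t)
    <= C * e ^+ n.+1 * (t / (1 + t ^+ 2)).
Proof.
move=> r0 c10 c20.
set delta : R := (4 * n.+1%:R)^-1.
have d0 : 0 < delta by rewrite invr_gt0 mulr_gt0 ?ltr0n.
have d1 : delta <= 1 by rewrite invf_le1 ?mulr_gt0 ?ltr0n // -natrM ler1n.
(* The additional factor t^m makes the induction on the Horner form p X + c close. *)
have gauss_poly (p : {poly R}) : exists2 C : R, 0 <= C &
    forall t, 0 <= t -> p.[t] * expR (- (t ^+ 2 / 4)) <= C.
  suff /(_ 0%N)[C C0 CP] : forall m, exists2 C : R, 0 <= C &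
    forall t, 0 <= t -> p.[t] * t ^+ m * expR (- (t ^+ 2 / 4)) <= C.
    by exists C => // t /CP; rewrite expr0 mulr1.
  elim/poly_ind: p => [|p c ih] m.
    by exists 0 => // t t0; rewrite horner0 !mul0r.
  have [C C0 CP] := ih m.+1; have [D D0 DP] := poly_gauss_bounded m.
  exists (C + `|c| * D) => [|t t0]; first by rewrite addr_ge0 ?mulr_ge0.
  rewrite hornerMXaddC !mulrDl -[_ * t * _]mulrA -exprS lerD ?CP //.
  rewrite -mulrA (le_trans (ler_wpM2r _ (ler_norm c))) ?ler_wpM2l ?DP //.
  by rewrite mulr_ge0 ?exprn_ge0 ?expR_ge0.
have [B1 B10 B1P] := gauss_poly ((1 + 'X^2) * 'X^n *
   ('X^2 + n%:R%:P * 'X^2 ^+ n.+1 + ((4 * n.+1%:R) ^+ n.+1)%:P)).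
have gauss_pow m : exists2 C : R, 0 <= C &
    forall t, 0 <= t -> (1 + t ^+ 2) * t ^+ m * expR (- (t ^+ 2 / 4)) <= C.
  have [C C0 CP] := gauss_poly ((1 + 'X^2) * 'X^m); exists C => // t /CP.
  by rewrite !hornerE.
have [B2 B20 B2P] := gauss_pow (n + 3 * n)%N.
(* For t e > delta, [l0] bounds ln (1 + (c1 e t)^2) from below. [B3] collects the constants of [h2]
   and [h3], and [B4] those of the Gaussian polynomial in the same regime. *)
pose l0 : R := ln (1 + (c1 * delta) ^+ 2).
have l00 : 0 < l0 by rewrite ln_gt0 // ltrDl exprn_gt0 // mulr_gt0.
pose B3 : R := expR l0 * (n.+3)`!%:R * (2 / (l0 * r * c2)) ^+ n.+3 / c1 ^+ 2.
have q0 : 0 <= 2 / (l0 * r * c2).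
  by rewrite divr_ge0 // ltW // !mulr_gt0.
have B30 : 0 <= B3.
  by rewrite /B3 divr_ge0 ?sqr_ge0 // mulr_ge0 ?exprn_ge0 // mulr_ge0 ?expR_ge0.
pose B4 : R := #|{ffun 'I_n -> 'I_n.+1}|%:R * delta ^- n.+1 * B2.
have B40 : 0 <= B4 by rewrite !mulr_ge0 // invr_ge0 exprn_ge0 // ltW.
exists (B1 + (B3 * 2 + B4)); first by rewrite !addr_ge0 // mulr_ge0.
(* [M0] is taken so large that r M / 2 >= 1, which allows a full factor (1 + y)^-1 to be split off
   in [h2]. *)
near \oo => M0; exists M0 => M a s e phi M0M /andP[e0 ed] Me2 ae ca p1 p2 ps phiR phiI t t0.
have e1 : e <= 1 by exact: le_trans d1.
have tt0 : 0 < 1 + t ^+ 2 by rewrite ltr_pwDl // sqr_ge0.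
have e0' := ltW e0; have t0' := ltW t0.
have p2t (c : R) : (fun K => expR (- (power_sum r a M K 2 * t ^+ 2 / c))) @ \oo -->
    expR (- (t ^+ 2 / c)).
  rewrite -[X in - (X / c)]mul1r.
  apply: continuous_cvg; first exact: continuous_expR.
  by apply: cvgN; apply: cvgMl; apply: cvgMl.
have [ted|ted] := leP (t * e) delta.
  have est : normc (phi t - (expR (- (t ^+ 2 / 2)))%:C * edgeworth_poly n s t) <=
     (t * e) ^+ n.+1 * (t ^+ 2 + n%:R * (t ^+ 2) ^+ n.+1 + (4 * n.+1%:R) ^+ n.+1) *
     expR (- (t ^+ 2 / 4)).
    apply: (@normc_le_limit (fun K => gamma_cf r a M K t -
      (expR (- (power_sum r a M K 2 * t ^+ 2 / 2)))%:C *
      edgeworth_poly n (fun i => power_sum r a M K i.+3 / i.+3%:R) t) _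
      (fun K => (t * e) ^+ n.+1 * (t ^+ 2 + n%:R * (t ^+ 2) ^+ n.+1 + (4 * n.+1%:R) ^+ n.+1) *
      expR (- (power_sum r a M K 2 * t ^+ 2 / 4)))).
    - rewrite ReB Re_realM; under eq_fun do rewrite ReB Re_realM.
      apply: cvgB; [by []|apply: cvgM; first exact: p2t].
      by have [] := edgeworth_poly_cvg n t ps.
    - rewrite ImB Im_realM; under eq_fun do rewrite ImB Im_realM.
      apply: cvgB; [by []|apply: cvgM; first exact: p2t].
      by have [] := edgeworth_poly_cvg n t ps.
    - exact: cvgMr.
    - by apply: nearW => K; exact: gamma_cf_estimate (ltW r0) ae _ _ _ t0' ted (p1 K).
  have GE := B1P t t0'; rewrite !hornerE in GE.
  set G : R := t ^+ 2 + n%:R * (t ^+ 2) ^+ n.+1 + (4 * n.+1%:R) ^+ n.+1 in GE.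
  set E : R := expR _ in GE.
  have {}GE : t ^+ n * G * E <= B1 / (1 + t ^+ 2).
    by rewrite ler_pdivlMr // mulrC !mulrA.
  have et0 : 0 <= e ^+ n.+1 * (t / (1 + t ^+ 2)).
    by rewrite mulr_ge0 ?exprn_ge0 // divr_ge0 // ltW.
  have fin : B1 * (e ^+ n.+1 * (t / (1 + t ^+ 2))) <=
      (B1 + (B3 * 2 + B4)) * (e ^+ n.+1 * (t / (1 + t ^+ 2))).
    by rewrite ler_wpM2r // lerDl addr_ge0 // mulr_ge0.
  apply: (le_trans est); rewrite -/G -/E -(mulrA _ G) -(mulrA (B1 + _)); apply: le_trans fin.
  (* One of the n + 1 powers of t is set aside: it is the factor t that makes the bound integrable
     against dt / t near 0. The other n go into the Gaussian. *)
  have -> : (t * e) ^+ n.+1 * (G * E) = e ^+ n.+1 * t * (t ^+ n * G * E).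
    by rewrite exprMn [t ^+ n.+1]exprS; ring.
  apply: le_trans (ler_wpM2l (mulr_ge0 (exprn_ge0 _ e0') t0') GE) _.
  by rewrite le_eqVlt; apply/orP; left; apply/eqP; ring.
have t1 : 1 <= t.
  rewrite -(ler_pM2r e0) mul1r (le_trans ed) // ltW //.
have tlarge : 1 / t ^+ 2 <= 2 * (t / (1 + t ^+ 2)).
  rewrite mulrA ler_pdivlMr // mulrC mulrA mulr1 ler_pdivrMr ?exprn_gt0 //.
  have : 1 <= t ^+ 2 by rewrite expr_ge1.
  by nra.
have phib : normc (phi t) <= B3 * e ^+ n.+1 * (1 / t ^+ 2).
  pose y := (c1 * e * t) ^+ 2.
  have y0 : 0 < y by rewrite exprn_gt0 // !mulr_gt0.
  have h1 : normc (phi t) <= expR (- (r * M%:R / 2 * ln (1 + y))).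
    apply: (@normc_le_limit (fun K => gamma_cf r a M K t) _
      (fun=> expR (- (r * M%:R / 2 * ln (1 + y))))) => //; first exact: cvg_cst.
    near=> K; apply: (gamma_cf_decay (ltW r0) _ _ _ ca); first by rewrite mulr_ge0 // ltW.
    by near: K; exact: nbhs_infty_ge.
  have A1 : 1 <= r * M%:R / 2.
    rewrite ler_pdivlMr // mul1r mulrC -ler_pdivrMr //.
    rewrite (@le_trans _ _ M0%:R) ?ler_nat //.
    by near: M0; exact: nbhs_infty_ger.
  have ly : l0 <= ln (1 + y).
    rewrite ler_ln ?posrE ?ltr_pwDl ?sqr_ge0 // lerD2l /y lerXn2r ?nnegrE ?mulr_ge0 ?(ltW c10) ?(ltW d0) //.
    by rewrite -mulrA ler_wpM2l ?(ltW c10) // mulrC ltW.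
  set A := r * M%:R / 2 in A1 h1.
  (* The factor 1 / y provides the decay in t; the remaining exponent A - 1 is evaluated at the
     lower bound [l0] and provides smallness in e. *)
  have h2 : expR (- (A * ln (1 + y))) <= expR l0 * expR (- (A * l0)) / y.
    rewrite (_ : - (A * ln (1 + y)) = - ((A - 1) * ln (1 + y)) - ln (1 + y)); last by ring.
    rewrite expRD (_ : expR (- ln (1 + y)) = (1 + y)^-1); last first.
      by rewrite expRN lnK // posrE ltr_pwDl // ltW.
    rewrite ler_pM ?expR_ge0 ?invr_ge0 ?addr_ge0 ?(ltW y0) //.
      rewrite -expRD ler_expR; have : (A - 1) * l0 <= (A - 1) * ln (1 + y).
        by rewrite ler_wpM2l // subr_ge0.
      lra.
    by rewrite lef_pV2 ?posrE ?ltr_pwDl ?(ltW y0) // lerDr.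
  (* Here A is at least of order e^-2, so the exponential beats any power of e. The power n + 3 is
     wanted because 1 / y, with y = (c1 e t)^2, costs e^-2. *)
  have h3 : expR (- (A * l0)) <= (n.+3)`!%:R * (2 / (l0 * r * c2)) ^+ n.+3 * e ^+ n.+3.
    pose X := l0 * r * c2 / (2 * e ^+ 2).
    have X0 : 0 < X by rewrite divr_gt0 ?mulr_gt0 ?exprn_gt0.
    have XA : X <= A * l0.
      rewrite ler_pdivrMr ?mulr_gt0 ?exprn_gt0 // /A.
      rewrite [leRHS](_ : _ = l0 * r * (M%:R * e ^+ 2)); last by field.
      by rewrite ler_wpM2l // mulr_ge0 // ltW.
    have hX : X ^+ n.+3 / (n.+3)`!%:R <= expR (A * l0).
      rewrite (@le_trans _ _ (expR X)) ?ler_expR //.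
      apply: le_trans (texp_le_expR n.+4 (ltW X0)).
      rewrite big_ord_recr /= mulrC lerDr sumr_ge0 // => i _.
      by rewrite mulr_ge0 ?invr_ge0 ?exprn_ge0 // ltW.
    rewrite expRN (@le_trans _ _ (X ^+ n.+3 / (n.+3)`!%:R)^-1) //.
      by rewrite lef_pV2 // posrE ?expR_gt0 // divr_gt0 ?exprn_gt0 // ltr0n fact_gt0.
    rewrite invf_div -mulrA -exprVn -exprMn ler_wpM2l // lerXn2r ?nnegrE ?invr_ge0 ?(ltW X0) //.
      by rewrite mulr_ge0.
    rewrite /X invf_div [leLHS](_ : _ = 2 / (l0 * r * c2) * e * e); last by rewrite expr2; ring.
    by rewrite ler_piMr // mulr_ge0.
  rewrite (le_trans h1) // (le_trans h2) //.
  have := ler_wpM2l (expR_ge0 l0) h3 => /(ler_wpM2r _)-/(_ y^-1).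
  move=> /(_ _)/le_trans; apply; first by rewrite invr_ge0 ltW.
  rewrite le_eqVlt; apply/orP; left; apply/eqP; rewrite /B3 /y [e ^+ n.+3](_ : _ = e ^+ n.+1 * e ^+ 2);
    last by rewrite -exprD addn2.
  set b := (2 / _) ^+ _; set f := _%:R; set g := expR l0; set h := e ^+ n.+1.
  by field; rewrite ?gt_eqF.
have Qb : normc ((expR (- (t ^+ 2 / 2)))%:C * edgeworth_poly n s t) <=
    B4 * e ^+ n.+1 * (t / (1 + t ^+ 2)).
  have s01 i : 0 <= s i <= 1.
    have pK K : 0 <= power_sum r a M K i.+3 / i.+3%:R <= 1.
      have pge0 := power_sum_ge0 (ltW r0) ae K.
      rewrite divr_ge0 //= ler_pdivrMr // mul1r (@le_trans _ _ 1) ?ler1n //.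
      rewrite (le_trans (power_sum_le (ltW r0) ae K i.+1)) // -[leRHS]mul1r.
      by rewrite ler_pM ?exprn_ge0 // exprn_ile1.
    apply/andP; split.
      by apply: (ler_cvg_to (cvg_cst (0 : R)) (ps i)); apply: nearW => K; have /andP[] := pK K.
    by apply: (ler_cvg_to (ps i) (cvg_cst (1 : R))); apply: nearW => K; have /andP[] := pK K.
  have B2b := B2P t t0'.
  rewrite normcM normc_real ger0_norm ?expR_ge0 //.
  have Qt := normc_edgeworth_poly n t1 s01.
  set D : R := #|_|%:R in Qt B4 B40 *.
  have E2 : expR (- (t ^+ 2 / 2)) <= expR (- (t ^+ 2 / 4)).
    by rewrite ler_expR; have := sqr_ge0 t; lra.
  (* The Gaussian polynomial contains no power of e; in this regime t e / delta > 1, so multiplying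
     by its (n+1)-th power creates e^(n+1) at the cost of powers of t. *)
  have te1 : 1 <= (t * e / delta) ^+ n.+1.
    by rewrite exprn_ege1 // ler_pdivlMr // mul1r ltW.
  rewrite (le_trans (ler_pM (expR_ge0 _) (normc_ge0 _) E2 Qt)) //.
  rewrite (le_trans (ler_peMr _ te1)) ?mulr_ge0 ?expR_ge0 ?exprn_ge0 ?ler0n //.
  rewrite expr_div_n exprMn [t ^+ n.+1]exprS.
  rewrite [leLHS](_ : _ = D * delta ^- n.+1 * e ^+ n.+1 * t * (t ^+ n * t ^+ (3 * n) * expR (- (t ^+ 2 / 4)))); last by ring.
  have {}B2b : t ^+ n * t ^+ (3 * n) * expR (- (t ^+ 2 / 4)) <= B2 / (1 + t ^+ 2).
    by rewrite ler_pdivlMr // mulrC mulrA -exprD.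
  rewrite (le_trans (ler_wpM2l _ B2b)) //.
    by rewrite !mulr_ge0 ?ler0n ?invr_ge0 ?exprn_ge0 // ltW.
  by rewrite le_eqVlt; apply/orP; left; apply/eqP; rewrite /B4; ring.
rewrite (le_trans (le_normcD _ _)) // normcN.
have et0 : 0 <= e ^+ n.+1 * (t / (1 + t ^+ 2)).
  by rewrite mulr_ge0 ?exprn_ge0 // divr_ge0 // ltW.
have phib' : normc (phi t) <= B3 * 2 * e ^+ n.+1 * (t / (1 + t ^+ 2)).
  rewrite (le_trans phib) // [leRHS](_ : _ = B3 * e ^+ n.+1 * (2 * (t / (1 + t ^+ 2)))); last by ring.
  by rewrite ler_wpM2l // mulr_ge0 ?exprn_ge0.
rewrite (le_trans (lerD phib' Qb)) // -!mulrDl -(mulrA (B1 + _)) -(mulrA (B3 * 2 + _)).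
by rewrite ler_wpM2r // lerDr.
Unshelve. all: by end_near. Qed.

End characteristic_estimate.

(** * Series of independent random variables *)

Section block_independence.
Context (d : measure_display) (T : measurableType d) (R : realType) (P : probability T R).
Variable X : nat -> T -> R.
Hypothesis indepX : mutually_independent P X.

Let mX n : measurable_fun setT (X n). Proof. by case: indepX => + _; exact. Qed.

(** A pi-system generating the sigma-algebra of X_m, ..., X_(k-1). *)
Definition rectangles (m k : nat) : set (set T) :=
  [set A | exists2 B : nat -> set R, (forall i, measurable (B i)) &
     A = \big[setI/setT]_(m <= i < k) (X i @^-1` B i)].

Lemma measurable_rectangles m k A : rectangles m k A -> measurable A.
Proof.
move=> [B mB ->]; apply: bigsetI_measurable => i _.
by rewrite -[X in measurable X]setTI; exact: mX.
Qed.

Lemma rectangles_setI m k : setI_closed (rectangles m k).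
Proof.
move=> A1 A2 [B1 mB1 ->] [B2 mB2 ->]; exists (fun i => B1 i `&` B2 i).
  by move=> i; exact: measurableI.
by rewrite -big_split /=; apply: eq_bigr => i _; rewrite preimage_setI.
Qed.

Lemma sigma_rectangles_measurable m k A : <<s rectangles m k >> A -> measurable A.
Proof.
apply: smallest_sub; first exact: sigma_algebra_measurable.
by move=> B; exact: measurable_rectangles.
Qed.

Lemma lambda_system_indep (A : set T) : measurable A ->
  lambda_system setT [set B | measurable B /\ P (A `&` B) = (P A * P B)%E].
Proof.
move=> mA; apply/dynkin_lambda_system; split => /=.
- by rewrite setIT probability_setT mule1.
- move=> B [mB PAB]; split; first exact: measurableC.
  rewrite -setDE measureD //; last by rewrite (le_lt_trans (probability_le1 _ _)) ?ltry.
  transitivity (P A - P A * P B)%E; first by congr (_ - _)%E; exact: PAB.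
  rewrite probability_setC // muleBr ?mule1 //.
  exact: fin_num_measure.
- move=> F tF FP; have mF i := (FP i).1; split; first exact: bigcupT_measurable.
  rewrite setI_bigcupr measure_bigcup //=; last 2 first.
  + by move=> i _; exact: measurableI.
  + by apply: trivIset_setIl.
  rewrite measure_bigcup //=.
  rewrite -(fineK (fin_num_measure P A mA)) -nneseriesZl //.
  by apply: eq_eseriesr => i _; rewrite fineK ?fin_num_measure //; exact: (FP i).2.
Qed.

Lemma rectangles_indep m k l A B : (m <= k <= l)%N ->
  rectangles m k A -> rectangles k l B -> P (A `&` B) = (P A * P B)%E.
Proof.
move=> /andP[mk kl] [BA mBA ->] [BB mBB ->].
have rectP (i j : nat) (C : nat -> set R) : (forall i, measurable (C i)) ->
   P (\big[setI/setT]_(i <= n < j) (X n @^-1` C n)) = (\prod_(i <= n < j) P (X n @^-1` C n))%E.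
  by move=> mC; case: indepX => _ -> //; exact: iota_uniq.
(* [C] glues the two families at k, so that a single use of mutual independence covers the range
   from m to l. *)
rewrite !rectP //; pose C i := if (i < k)%N then BA i else BB i.
have EA : \big[setI/setT]_(m <= i < k) (X i @^-1` BA i) =
    \big[setI/setT]_(m <= i < k) (X i @^-1` C i).
  by rewrite !big_nat; apply: eq_bigr => i /andP[_ ik]; rewrite /C ik.
have EB : \big[setI/setT]_(k <= i < l) (X i @^-1` BB i) =
    \big[setI/setT]_(k <= i < l) (X i @^-1` C i).
  by rewrite !big_nat; apply: eq_bigr => i /andP[ik _]; rewrite /C ltnNge ik.
rewrite EA EB -big_cat_nat // rectP; last by move=> i; rewrite /C; case: ifP.
rewrite (@big_cat_nat _ _ _ k) //=; congr (_ * _)%E; rewrite !big_nat; apply: eq_bigr.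
  by move=> i /andP[_ ik]; rewrite /C ik.
by move=> i /andP[ik _]; rewrite /C ltnNge ik.
Qed.

(** The pi-lambda argument is applied twice: first B is extended to the generated sigma-algebra with
    A a rectangle, then A with B arbitrary. *)
Lemma blocks_indep m k l A B : (m <= k <= l)%N ->
  <<s rectangles m k >> A -> <<s rectangles k l >> B ->
  P (A `&` B) = (P A * P B)%E.
Proof.
move=> mkl sA sB.
have step A' : rectangles m k A' -> forall B', <<s rectangles k l >> B' ->
    P (A' `&` B') = (P A' * P B')%E.
  move=> rA' B' sB'; have mA' := measurable_rectangles rA'.
  suff : <<s rectangles k l >> `<=` [set B | measurable B /\ P (A' `&` B) = (P A' * P B)%E].
    by move=> /(_ _ sB')[].
  apply: lambda_system_subset => //; first exact: rectangles_setI.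
  - exact: lambda_system_indep.
  - move=> B'' rB''; split; first exact: measurable_rectangles rB''.
    exact: (rectangles_indep mkl rA' rB'').
have mB := sigma_rectangles_measurable sB.
suff : <<s rectangles m k >> `<=` [set A | measurable A /\ P (B `&` A) = (P B * P A)%E].
  by move=> /(_ _ sA)[_]; rewrite setIC muleC.
apply: lambda_system_subset => //; first exact: rectangles_setI.
- exact: lambda_system_indep.
- move=> A' rA'; split; first exact: measurable_rectangles rA'.
  by rewrite setIC step // muleC.
Qed.

Definition block_measurable m k (f : T -> R) :=
  @measurable_fun _ _ (g_sigma_algebraType (rectangles m k)) R setT f.

Lemma block_measurable_X m k i : (m <= i < k)%N -> block_measurable m k (X i).
Proof.
move=> mik _ B mB; rewrite setTI; apply: sub_sigma_algebra.
exists (fun j => if j == i then B else setT); first by move=> j; case: ifP.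
rewrite (bigD1_seq i) ?iota_uniq ?mem_index_iota //= eqxx big1 ?setIT //.
by move=> j /negbTE ->; rewrite preimage_setT.
Qed.

Lemma block_measurable_sum m k (a b : nat) : (m <= a)%N -> (b <= k)%N ->
  block_measurable m k (fun w => \sum_(a <= i < b) X i w).
Proof.
move=> ma bk; rewrite /block_measurable /index_iota.
have : forall i, i \in iota a (b - a) -> (m <= i < k)%N.
  by move=> i; rewrite mem_iota => /andP[ai ib]; lia.
elim: (iota a (b - a)) => [|i s ih] imk.
  by under eq_fun do rewrite big_nil; exact: measurable_cst.
under eq_fun do rewrite big_cons; apply: measurable_funD.
  by apply: block_measurable_X; apply: imk; rewrite inE eqxx.
by apply: ih => j js; apply: imk; rewrite inE js orbT.
Qed.

Lemma block_preimage m k f (B : set R) : block_measurable m k f -> measurable B ->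
  <<s rectangles m k >> (f @^-1` B).
Proof. by move=> mf mB; rewrite -[f @^-1` B]setTI; exact: mf. Qed.

End block_independence.

(** * Expectation of a product of two independent variables *)

Section independent_expectation.
Context (d : measure_display) (T : measurableType d) (R : realType) (P : probability T R).
Variables U V : T -> R.
Hypotheses (iU : P.-integrable setT (EFin \o U)) (iV : P.-integrable setT (EFin \o V)).
Hypothesis indepUV : forall A B : set R, measurable A -> measurable B ->
  P (U @^-1` A `&` V @^-1` B) = (P (U @^-1` A) * P (V @^-1` B))%E.

Let mU : measurable_fun setT U.
Proof. by have /measurable_int/measurable_EFinP := iU. Qed.
Let mV : measurable_fun setT V.
Proof. by have /measurable_int/measurable_EFinP := iV. Qed.
Let mUV : measurable_fun setT (fun w => (U w, V w)).
Proof. exact: measurable_fun_pair. Qed.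

Let U' : {RV P >-> R} := HB.pack U (isMeasurableFun.Build _ _ _ _ U mU).
Let V' : {RV P >-> R} := HB.pack V (isMeasurableFun.Build _ _ _ _ V mV).
Let UV' : {RV P >-> (R * R)%type} :=
  HB.pack (fun w => (U w, V w)) (isMeasurableFun.Build _ _ _ _ _ mUV).

(** Independence says that the law of the pair agrees with the product law on measurable rectangles,
    which determine the product measure. *)
Let joint X : measurable X ->
  (distribution P U' \x distribution P V')%E X = distribution P UV' X.
Proof. by apply: product_measure_unique => A B mA mB; exact: indepUV. Qed.

Let mmul : measurable_fun setT (fun z : R * R => (z.1 * z.2)%:E).
Proof. by apply/measurable_EFinP; exact: measurable_funM. Qed.

Let int_mul : (distribution P U' \x distribution P V')%E.-integrable setT
  (fun z : R * R => (z.1 * z.2)%:E).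
Proof.
apply/integrable12ltyP => //.
have mabs : measurable_fun setT (fun y : R => `|y|%:E).
  by apply/measurable_EFinP; exact: normr_measurable.
under eq_integral => x _.
  under eq_integral => y _ do rewrite /= normrM EFinM.
  rewrite ge0_integralZl //= (ge0_integral_distribution V') //.
  over.
have /integrableP[_ hV] := iV; have /integrableP[_ hU] := iU.
have fV : (\int[P]_x `|V x|%:E)%E \is a fin_num.
  by rewrite ge0_fin_numE ?integral_ge0.
rewrite ge0_integralZr //=; last by rewrite integral_ge0.
rewrite (ge0_integral_distribution U') // lte_mul_pinfty //.
  by apply: integral_ge0 => x _; rewrite /= lee_fin.
by rewrite ge0_fin_numE //; apply: integral_ge0 => x _; rewrite /= lee_fin.
Qed.

Lemma integrable_indep_mul : P.-integrable setT (fun w => (U w * V w)%:E).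
Proof.
have /integrableP[_] := int_mul.
rewrite (eq_measure_integral (distribution P UV')); last by move=> A mA _; exact: joint.
rewrite (ge0_integral_distribution UV') //; last exact: measurableT_comp.
by move=> ioo; apply/integrableP; split => //; apply/measurable_EFinP; exact: measurable_funM.
Qed.

Lemma integral_indep_mul :
  (\int[P]_w (U w * V w)%:E = \int[P]_w (U w)%:E * \int[P]_w (V w)%:E)%E.
Proof.
have fV : (\int[P]_x (V x)%:E)%E \is a fin_num by exact: integrable_fin_num.
transitivity (\int[distribution P UV']_z (z.1 * z.2)%:E)%E.
  by rewrite (integral_distribution (X := UV')) //; exact: integrable_indep_mul.
transitivity (\int[distribution P U' \x distribution P V']_z (z.1 * z.2)%:E)%E.
  by apply: eq_measure_integral => A mA _; exact/esym/joint.
rewrite -(integral12_prod_meas1 int_mul) /fubini_F /=.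
have iV' : (distribution P V').-integrable setT (EFin : R -> \bar R).
  by apply: (integrable_pushforward mV).
have iU' : (distribution P U').-integrable setT (EFin : R -> \bar R).
  by apply: (integrable_pushforward mU).
under eq_integral => x _.
  under eq_integral => y _ do rewrite /= EFinM.
  rewrite integralZl //= (integral_distribution (X := V')) //=.
  rewrite -(fineK fV); over.
rewrite integralZr //= fineK //; congr (_ * _)%E.
by rewrite (integral_distribution (X := U')).
Qed.

End independent_expectation.

(** * Almost sure convergence of series of centred independent variables *)

Section random_series.
Context (d : measure_display) (T : measurableType d) (R : realType) (P : probability T R).
Variables (Z : nat -> T -> R) (v : nat -> R).
Hypothesis indepZ : mutually_independent P Z.
Hypothesis iZ : forall n, P.-integrable setT (EFin \o Z n).
Hypothesis iZ2 : forall n, P.-integrable setT (fun w => (Z n w ^+ 2)%:E).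
Hypothesis Z0 : forall n, (\int[P]_w (Z n w)%:E = 0)%E.
Hypothesis Zv : forall n, (\int[P]_w (Z n w ^+ 2)%:E = (v n)%:E)%E.

Definition psum m k w := \sum_(m <= i < k) Z i w.

Lemma measurable_psum m k : measurable_fun setT (psum m k).
Proof.
move=> _ B mB; rewrite setTI; apply: (sigma_rectangles_measurable indepZ (m := m) (k := k)).
by apply: block_preimage => //; exact: block_measurable_sum.
Qed.

Lemma v_ge0 n : 0 <= v n.
Proof. by rewrite -lee_fin -Zv; apply: integral_ge0 => w _; rewrite lee_fin sqr_ge0. Qed.

Lemma psum_indep m k (A B : set R) : (m <= k)%N -> measurable A -> measurable B ->
  P (psum m k @^-1` A `&` Z k @^-1` B) = (P (psum m k @^-1` A) * P (Z k @^-1` B))%E.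
Proof.
move=> mk mA mB; apply: (blocks_indep indepZ (m := m) (k := k) (l := k.+1)).
- by rewrite mk leqnSn.
- by apply: block_preimage => //; exact: block_measurable_sum.
- by apply: block_preimage => //; apply: block_measurable_X; rewrite leqnn ltnSn.
Qed.

Lemma psum_recr m k w : (m <= k)%N -> psum m k.+1 w = psum m k w + Z k w.
Proof. by move=> mk; rewrite /psum big_nat_recr. Qed.

Lemma psum_cat m k l w : (m <= k <= l)%N -> psum m l w = psum m k w + psum k l w.
Proof. by move=> /andP[mk kl]; rewrite /psum (@big_cat_nat _ _ _ k). Qed.

Lemma psum_moments m k : (m <= k)%N ->
  [/\ P.-integrable setT (EFin \o psum m k),
      P.-integrable setT (fun w => (psum m k w ^+ 2)%:E) &
      (\int[P]_w (psum m k w ^+ 2)%:E = (\sum_(m <= i < k) v i)%:E)%E].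
Proof.
elim: k => [|k ih]; rewrite ?leqn0 => mk.
  have E w : psum m 0 w = 0 by rewrite /psum (eqP mk) big_geq.
  rewrite /comp; split; [under eq_fun do rewrite E|under eq_fun do rewrite E expr0n|].
  - exact: integrable0.
  - exact: integrable0.
  - by under eq_integral do rewrite E expr0n; rewrite integral0 (eqP mk) big_geq.
move: mk; rewrite leq_eqVlt => /orP[/eqP ->|].
  have E w : psum k.+1 k.+1 w = 0 by rewrite /psum big_geq.
  rewrite /comp; split; [under eq_fun do rewrite E|under eq_fun do rewrite E expr0n|].
  - exact: integrable0.
  - exact: integrable0.
  - by under eq_integral do rewrite E expr0n; rewrite integral0 big_geq.
rewrite ltnS => mk; have [i1 i2 i3] := ih mk.
have iM := integrable_indep_mul i1 (iZ k) (fun A B mA mB => psum_indep mk mA mB).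
have eM := integral_indep_mul i1 (iZ k) (fun A B mA mB => psum_indep mk mA mB).
have E w : (psum m k.+1 w ^+ 2)%:E = ((psum m k w ^+ 2)%:E +
    (2%:E * (psum m k w * Z k w)%:E + (Z k w ^+ 2)%:E))%E.
  by rewrite psum_recr // -EFinM -!EFinD; congr EFin; ring.
have iM2 : P.-integrable setT (fun w => 2%:E * (psum m k w * Z k w)%:E)%E.
  exact: integrableZl.
have iM3 : P.-integrable setT (fun w => 2%:E * (psum m k w * Z k w)%:E + (Z k w ^+ 2)%:E)%E.
  exact: integrableD.
split.
- rewrite (_ : _ \o _ = fun w => ((psum m k w)%:E + (Z k w)%:E)%E); last first.
    by apply/funext => w /=; rewrite psum_recr.
  exact: (integrableD measurableT i1 (iZ k)).
- under eq_fun do rewrite E; exact: integrableD.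
- under eq_integral do rewrite E.
  rewrite integralD //= integralD //= integralZl //= eM Z0 mule0 mule0 add0e i3 Zv.
  by rewrite -EFinD big_nat_recr.
Qed.

Definition exceed (e : R) m k := [set w | (e < `|psum m k w|)%R].

Lemma block_exceed e m k a b : (m <= a)%N -> (b <= k)%N ->
  <<s rectangles Z m k >> (exceed e a b).
Proof.
move=> ma bk; rewrite (_ : exceed e a b = psum a b @^-1` (~` `[- e, e])); last first.
  by apply/seteqP; split => w /=; rewrite /exceed /= in_itv /= -ler_norml ltNge => /negP.
by apply: block_preimage; [exact: block_measurable_sum|exact: measurableC].
Qed.

Lemma measurable_exceed e m k : measurable (exceed e m k).
Proof. exact: (sigma_rectangles_measurable indepZ (block_exceed e (leqnn m) (leqnn k))). Qed.

Lemma chebyshev_psum m k e : (m <= k)%N -> 0 < e ->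
  (P (exceed e m k) <= ((\sum_(m <= i < k) v i) / e ^+ 2)%:E)%E.
Proof.
move=> mk e0; have [_ i2 E2] := psum_moments mk.
set A := exceed e m k; have mA : measurable A by exact: measurable_exceed.
have h : ((e ^+ 2)%:E * P A <= (\sum_(m <= i < k) v i)%:E)%E.
  rewrite -E2 -integral_cst //.
  apply: (@le_trans _ _ (\int[P]_(w in A) (psum m k w ^+ 2)%:E)%E).
    apply: ge0_le_integral => //=.
    - by move=> w _; rewrite lee_fin sqr_ge0.
    - by apply: measurable_funTS; have /measurable_int := i2.
    - move=> w /= ew; rewrite lee_fin -[leRHS]real_normK ?num_real //.
      by rewrite lerXn2r ?nnegrE // ltW.
  apply: ge0_subset_integral => //; first by have /measurable_int := i2.
  by move=> w _; rewrite lee_fin sqr_ge0.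
by rewrite mulrC EFinM lee_pdivlMl ?exprn_gt0.
Qed.

(* Ottaviani's maximal inequality, with the first passage times encoded by [seqDU]. *)
Lemma ottaviani m n e : (m <= n)%N -> 0 < e ->
  \sum_(m <= i < n) v i <= e ^+ 2 / 2 ->
  (P (\big[setU/set0]_(j < (n - m).+1) exceed (2 * e) m (m + j)) <=
   (2 * (\sum_(m <= i < n) v i) / e ^+ 2)%:E)%E.
Proof.
move=> mn e0 Ve; set V := \sum_(_ <= i < _) _ in Ve *.
pose F j := exceed (2 * e) m (m + j); pose D := seqDU F.
(* After a first passage above 2 e at time m + j, the later increment stays within e with
   probability at least 1/2 by Chebyshev, independently of the passage; the whole sum then exceeds
   e, an event that Chebyshev controls once more. *)
pose B j := ~` exceed e (m + j) n.
have mF j : measurable (F j) by exact: measurable_exceed.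
have bD j : <<s rectangles Z m (m + j) >> (D j).
  rewrite /D /seqDU.
  apply: (@measurableD _ (g_sigma_algebraType (rectangles Z m (m + j)))).
    exact: block_exceed.
  apply: (@bigsetU_measurable _ (g_sigma_algebraType (rectangles Z m (m + j)))) => i _.
  by apply: block_exceed => //; rewrite leq_add2l ltnW.
have mD j : measurable (D j) by exact: (sigma_rectangles_measurable indepZ (bD j)).
have mB j : measurable (B j) by apply: measurableC; exact: measurable_exceed.
have PB j : (j < (n - m).+1)%N -> (2^-1%:E <= P (B j))%E.
  rewrite ltnS => jn; have mjn : (m + j <= n)%N by rewrite -leq_subRL.
  rewrite probability_setC; last exact: measurable_exceed.
  have := chebyshev_psum mjn e0; set p := P _ => pe.
  have pf : p \is a fin_num by apply: fin_num_measure; exact: measurable_exceed.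
  move: pe; rewrite -(fineK pf) -EFinB !lee_fin => pe.
  have : (\sum_(m + j <= i < n) v i) / e ^+ 2 <= 2^-1.
    rewrite ler_pdivrMr ?exprn_gt0 // mulrC (le_trans _ Ve) //.
    rewrite /V [leRHS](@big_cat_nat _ _ _ (m + j)) ?leq_addr //= lerDr sumr_ge0 // => i _.
    exact: v_ge0.
  by move=> h; lra.
have DB j : (j < (n - m).+1)%N -> D j `&` B j `<=` exceed e m n.
  rewrite ltnS => jn; have mjn : (m + j <= n)%N by rewrite -leq_subRL.
  move=> w [[/= Fj _]]; rewrite /B /exceed /= => /negP; rewrite -leNgt => Bj.
  have := @psum_cat m (m + j) n w; rewrite leq_addr mjn => /(_ isT) ->.
  have := lerB_normD (psum m (m + j) w) (psum (m + j) n w).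
  by move: Fj; rewrite /F /exceed /= => Fj h; lra.
rewrite (_ : \big[_/_]_(j < _) _ = \big[setU/set0]_(j < (n - m).+1) D j); last first.
  exact: bigsetU_seqDU.
have tD : trivIset setT D by exact: trivIset_seqDU.
rewrite measure_bigsetU //.
have key : (\sum_(i < (n - m).+1) P (D i `&` B i) <= (V / e ^+ 2)%:E)%E.
  rewrite -(@measure_bigsetU _ _ _ P (fun i => D i `&` B i)); last 2 first.
  - by move=> i; exact: measurableI.
  - by apply: trivIset_setIr.
  apply: le_trans (chebyshev_psum mn e0); apply: le_measure.
  - by rewrite inE; apply: bigsetU_measurable => i _; exact: measurableI.
  - by rewrite inE; exact: measurable_exceed.
  - by rewrite -(bigcup_mkord _ (fun i => D i `&` B i)) => w [i /= il]; exact: DB.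
have h2 : (2^-1%:E * \sum_(i < (n - m).+1) P (D i) <= \sum_(i < (n - m).+1) P (D i `&` B i))%E.
  rewrite ge0_sume_distrr //; apply: lee_sum => i _.
  rewrite (blocks_indep indepZ (m := m) (k := m + i) (l := n)).
  - by rewrite muleC lee_wpmul2l // PB.
  - by have := ltn_ord i; rewrite ltnS => ?; rewrite leq_addr -leq_subRL.
  - exact: bD.
  - apply: (@measurableC _ (g_sigma_algebraType (rectangles Z (m + i) n))).
    exact: block_exceed.
have := le_trans h2 key; rewrite lee_pdivrMl // -EFinM mulrA.
by [].
Qed.

Lemma maximal_tail m e delta : 0 < e ->
  (forall n, \sum_(m <= i < n) v i <= delta) -> delta <= e ^+ 2 / 2 ->
  (P (\bigcup_j exceed (2 * e) m (m + j)) <= (2 * delta / e ^+ 2)%:E)%E.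
Proof.
move=> e0 vd de; rewrite -bigcup_bigsetU_bigcup.
pose F j := \big[setU/set0]_(i < j.+1) exceed (2 * e) m (m + i).
have mF j : measurable (F j) by apply: bigsetU_measurable => i _; exact: measurable_exceed.
have ndF : {homo F : i j / (i <= j)%N >-> (i <= j)%O}.
  move=> i j ij; apply/subsetPset => w.
  rewrite /F -!(bigcup_mkord _ (fun k => exceed (2 * e) m (m + k))) => -[k /= ki Fk].
  by exists k => //=; exact: leq_trans ki _.
have cvgF := @nondecreasing_cvg_mu _ _ _ P F mF _ _.
have {}cvgF : (P \o F) x @[x --> \oo] --> P (\bigcup_n F n).
  by apply: cvgF => //; exact: bigcupT_measurable.
rewrite -(cvg_lim _ cvgF) //.
apply: lime_le; first by apply: cvgP; exact: cvgF.
apply: nearW => j; have mj := leq_addr j m.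
have := @ottaviani m (m + j) e mj e0; rewrite addKn => /(_ (le_trans (vd _) de)).
move=> /le_trans; apply; rewrite lee_fin ler_wpM2r ?invr_ge0 ?sqr_ge0 //.
by rewrite ler_wpM2l.
Qed.

Hypothesis v_cauchy : forall e, 0 < e ->
  exists m0, forall m n, (m0 <= m)%N -> \sum_(m <= i < n) v i <= e.

(** The event that the partial sums are not Cauchy. The starting index of the series does not enter,
    so one null set serves every M. The factor 2 matches the threshold of [maximal_tail]. *)
Definition divergence_set :=
  \bigcup_p \bigcap_m \bigcup_j exceed (2 * p.+1%:R^-1) m (m + j).

Lemma measurable_divergence_set : measurable divergence_set.
Proof.
apply: bigcupT_measurable => p; apply: bigcapT_measurable => m.
by apply: bigcupT_measurable => j; exact: measurable_exceed.
Qed.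

Lemma divergence_set_null : P divergence_set = 0%E.
Proof.
apply/(negligibleP _ measurable_divergence_set).
apply: negligible_bigcup => p.
have mE : measurable (\bigcap_m \bigcup_j exceed (2 * p.+1%:R^-1) m (m + j)).
  apply: bigcapT_measurable => m.
  by apply: bigcupT_measurable => j; exact: measurable_exceed.
apply/negligibleP => //; apply/eqP; rewrite eq_le measure_ge0 andbT.
apply/lee_addgt0Pr => x x0; rewrite add0e.
set e : R := p.+1%:R^-1; have e0 : 0 < e by rewrite invr_gt0.
(* The first entry meets the hypothesis of [maximal_tail], the second brings the resulting bound 2
   delta / e^2 below x. *)
pose delta := Num.min (e ^+ 2 / 2) (x * e ^+ 2 / 2).
have d0 : 0 < delta by rewrite lt_min !divr_gt0 ?mulr_gt0 ?exprn_gt0.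
have [m0 m0P] := v_cauchy d0.
apply: (@le_trans _ _ (P (\bigcup_j exceed (2 * e) m0 (m0 + j)))).
  apply: le_measure; rewrite ?inE //.
    by apply: bigcupT_measurable => j; exact: measurable_exceed.
  by move=> w /(_ m0 I).
apply: le_trans (maximal_tail e0 (fun n => m0P m0 n (leqnn _)) _) _.
  by rewrite /delta ge_min lexx.
rewrite lee_fin ler_pdivrMr ?exprn_gt0 // mulrC -ler_pdivlMr //.
by rewrite /delta ge_min lexx orbT.
Qed.

Lemma psum_cvgP M w : cvgn (fun K => psum M K w) <-> ~ divergence_set w.
Proof.
split.
  move=> /cvg_ex[l /= /cvgrPdist_lt Sl] [p _ Nw].
  have e0 : (0 : R) < p.+1%:R^-1 by rewrite invr_gt0.
  have [m0 _ m0P] := Sl _ e0.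
  pose m := maxn m0 M; have [j _] := Nw m I; rewrite /exceed /=; apply/negP; rewrite -leNgt.
  have h1 := m0P m (leq_maxl _ _).
  have h2 : `|l - psum M (m + j) w| < p.+1%:R^-1.
    by apply: m0P => /=; rewrite (leq_trans (leq_maxl m0 M)) // leq_addr.
  have := @psum_cat M m (m + j) w; rewrite leq_maxr leq_addr => /(_ isT) E.
  have -> : psum m (m + j) w = (l - psum M m w) - (l - psum M (m + j) w) by rewrite E; ring.
  by rewrite (le_trans (ler_normB _ _)) // mulr_natl mulr2n ltW // ltrD.
move=> Nw; apply/cauchy_cvgP/cauchy_exP => e e0.
have [p pe] : exists p, 2 * p.+1%:R^-1 < e :> R.
  near \oo => p; exists p; rewrite mulrC ltr_pdivrMl // -ltr_pdivrMr //.
  apply: (@lt_trans _ _ p%:R); last by rewrite ltr_nat.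
  by near: p; exact: nbhs_infty_gtr.
have [m mP] : exists m, forall j, `|psum m (m + j) w| <= 2 * p.+1%:R^-1.
  apply: contrapT => /forallNP h; apply: Nw; exists p => // m _.
  have /existsNP[j /negP] := h m; rewrite -ltNge => ?; by exists j.
(* The partial sum from M to m, continued additively to m < M; it is the centre of a ball containing
   all late partial sums. *)
pose x := if (M <= m)%N then psum M m w else - psum m M w.
exists x; exists (maxn m M) => // K /=; rewrite geq_max => /andP[mK MK].
rewrite /ball /= (_ : x - psum M K w = - psum m K w).
  by rewrite normrN (le_lt_trans _ pe) // -(subnKC mK).
rewrite /x; case: ifPn => [Mm|].
  by rewrite (@psum_cat M m K w) ?Mm //; ring.
by rewrite -ltnNge => /ltnW mM; rewrite (@psum_cat m M K w) ?mM //; ring.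
Unshelve. all: by end_near. Qed.

Definition series_lim M w := limn (fun K => psum M K w).

Lemma measurable_series_lim M : measurable_fun setT (series_lim M).
Proof.
have mN := measurable_divergence_set.
rewrite -(setUv divergence_set); apply/measurable_funU => //; first exact: measurableC.
split.
  (* On the divergence set [limn] returns its default value, so the limit is constant there. *)
  apply: (@eq_measurable_fun _ _ _ _ _ (fun=> point)) => [w|]; last exact: measurable_cst.
  rewrite inE => Nw; apply/esym/dvgP.
  by move=> /psum_cvgP.
apply: (@measurable_fun_cvg _ _ _ _ (psum M)).
  by move=> K; apply: measurable_funTS; exact: measurable_psum.
by move=> w /(psum_cvgP M).
Qed.

Lemma series_lim_ae M : {ae P, forall w, setT w -> psum M K w @[K --> \oo] --> series_lim M w}.
Proof.
exists divergence_set; split; [exact: measurable_divergence_set|exact: divergence_set_null|].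
by move=> w /= /not_implyP[_ h]; apply: contrapT => /(psum_cvgP M).
Qed.

Lemma cvg_expectation_series M (h : R -> R) : continuous h -> (forall x, `|h x| <= 1) ->
  \int[P]_w h (psum M K w) @[K --> \oo] --> \int[P]_w h (series_lim M w).
Proof.
move=> ch h1; have mh : measurable_fun setT h by exact: continuous_measurable_fun.
have mhS K : measurable_fun setT (fun w => (h (psum M K w))%:E).
  by apply/measurable_EFinP; apply: measurableT_comp => //; exact: measurable_psum.
have mhL : measurable_fun setT (fun w => (h (series_lim M w))%:E).
  by apply/measurable_EFinP; apply: measurableT_comp => //; exact: measurable_series_lim.
have i1 : P.-integrable setT (cst 1%:E).
  exact: finite_measure_integrable_cst.
have hae : {ae P, forall w, setT w -> (h (psum M K w))%:E @[K --> \oo] --> (h (series_lim M w))%:E}.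
  apply: filterS (series_lim_ae M) => w /(_ I) cw _.
  by apply: cvg_EFin; [exact: nearW|apply: continuous_cvg => //; exact: ch].
have hb : {ae P, forall w K, setT w -> (`|(h (psum M K w))%:E| <= cst 1%:E w)%E}.
  by apply: aeW => w K _; rewrite /= lee_fin.
have [hi _ hc] := dominated_convergence measurableT mhS mhL hae i1 hb.
apply: fine_cvg; rewrite fineK //.
by apply: integrable_fin_num.
Qed.

Lemma v_sum_bounded : exists C, forall m n, \sum_(m <= i < n) v i <= C.
Proof.
have [m0 m0P] := v_cauchy ltr01; exists (\sum_(0 <= i < m0) v i + 1) => m n.
have mono a b : (a <= b)%N -> \sum_(0 <= i < a) v i <= \sum_(0 <= i < b) v i.
  move=> ab; rewrite [leRHS](@big_cat_nat _ _ _ a) //= lerDl sumr_ge0 // => i _.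
  exact: v_ge0.
apply: (@le_trans _ _ (\sum_(0 <= i < n) v i)).
  have [mn|nm] := leqP m n; last first.
    by rewrite big_geq ?(ltnW nm) // sumr_ge0 // => i _; exact: v_ge0.
  rewrite [leRHS](@big_cat_nat _ _ _ m) //= lerDr sumr_ge0 // => i _.
  exact: v_ge0.
have [nm|/ltnW mn] := leqP n m0; first by rewrite (le_trans (mono _ _ nm)) // lerDl.
by rewrite (@big_cat_nat _ _ _ m0) //= lerD2l m0P.
Qed.

(** Fatou's lemma with |y| <= 1 + y^2: the second moments of the partial sums are bounded by
    [v_sum_bounded]. Integrability is what the Fubini argument in [smoothing_fourier] asks for. *)
Lemma integrable_series_lim M : P.-integrable setT (EFin \o series_lim M).
Proof.
have mN := measurable_divergence_set; have mNC := measurableC mN.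
have mY : measurable_fun setT (EFin \o series_lim M).
  by apply/measurable_EFinP; exact: measurable_series_lim.
apply/(negligible_integrable mN measurableT mY divergence_set_null).
rewrite setTD; apply/integrableP; split; first exact: measurable_funTS.
have [C CP] := v_sum_bounded.
pose f K w := `|psum M K w|%:E.
have mf K : measurable_fun (~` divergence_set) (f K).
  apply: measurable_funTS; apply/measurable_EFinP.
  by apply: measurableT_comp; [exact: normr_measurable|exact: measurable_psum].
have f0 K w : (~` divergence_set) w -> (0 <= f K w)%E by rewrite lee_fin.
have := fatou P mNC mf f0.
rewrite (eq_integral (fun w => `|(EFin \o series_lim M) w|%E)); last first.
  move=> w; rewrite inE => /(psum_cvgP M) cw.
  have fw : f K w @[K --> \oo] --> `|series_lim M w|%:E.
    by apply: cvg_EFin; [exact: nearW|exact: cvg_norm].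
  by rewrite is_cvg_limn_einfE; [exact/cvg_lim|apply/cvg_ex; eexists; exact: fw].
move=> /le_lt_trans; apply; apply: (@le_lt_trans _ _ (1 + C)%:E); last exact: ltry.
rewrite limn_einf_lim; apply: lime_le; first exact: is_cvg_einfs.
(* The index is raised to [maxn K M], as the moment formula concerns partial sums that start at M
   and end no earlier. *)
apply: nearW => K; apply: (@le_trans _ _ (\int[P]_(w in ~` divergence_set) f (maxn K M) w)%E).
  by apply: ereal_inf_lbound; exists (maxn K M) => //=; exact: leq_maxl.
have [_ i2 E2] := psum_moments (leq_maxr K M).
apply: (@le_trans _ _ (\int[P]_w f (maxn K M) w)%E).
  apply: ge0_subset_integral => //; last by move=> w _; rewrite lee_fin.
  apply/measurable_EFinP.
  by apply: measurableT_comp; [exact: normr_measurable|exact: measurable_psum].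
apply: (@le_trans _ _ (\int[P]_w (1 + (psum M (maxn K M) w ^+ 2)%:E))%E).
  apply: ge0_le_integral => //.
  - by move=> w _; rewrite lee_fin.
  - apply/measurable_EFinP.
    by apply: measurableT_comp; [exact: normr_measurable|exact: measurable_psum].
  - by apply: emeasurable_funD => //; have /measurable_int := i2.
  - move=> w _; rewrite -EFinD lee_fin -[X in _ + X]real_normK ?num_real //.
    by set y := `|_|; have := sqr_ge0 (y - 1); nra.
rewrite ge0_integralD //; last 2 first.
- by move=> w _; rewrite lee_fin sqr_ge0.
- by have /measurable_int := i2.
have -> : (\int[P]__ 1 = 1)%E by rewrite integral_cst // mul1e; exact: probability_setT.
by rewrite E2 -EFinD lee_fin lerD2l.
Qed.

End random_series.

(** * The gamma law *)

Section density.
Local Open Scope ereal_scope.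
Context (d : measure_display) (T : measurableType d) (R : realType).
Variables (mu nu : {measure set T -> \bar R}) (g : T -> R).
Hypotheses (g0 : forall x, (0 <= g x)%R) (mg : measurable_fun setT g).
Hypothesis nuE : forall A, measurable A -> nu A = \int[mu]_(x in A) (g x)%:E.

Import HBNNSimple.

Let integral_density_nnsfun (h : {nnsfun T >-> R}) :
  \int[nu]_x (h x)%:E = \int[mu]_x ((h x)%:E * (g x)%:E).
Proof.
transitivity (\sum_(k \in range h) k%:E * nu (h @^-1` [set k])).
  by rewrite integralT_nnsfun sintegralE.
have mfib k : measurable (h @^-1` [set k]) by exact: measurable_funPTI.
have E k x : (k * \1_(h @^-1` [set k]) x)%:E * (g x)%:E =
   k%:E * ((fun x => (g x)%:E) \_ (h @^-1` [set k])) x.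
  rewrite patchE indicE; case: ifPn => _ /=; first by rewrite mulr1.
  by rewrite mulr0 mul0e mule0.
transitivity (\sum_(k \in range h) \int[mu]_x
    (k%:E * ((fun x => (g x)%:E) \_ (h @^-1` [set k])) x)); last first.
  rewrite -ge0_integral_fsum //; last 2 first.
  - move=> k; apply: measurable_funeM; apply/(measurable_restrict _ _ _) => //.
    by apply: measurable_funTS; exact/measurable_EFinP.
  - move=> k x _; rewrite -E -EFinM lee_fin mulr_ge0 //.
    exact: nnfun_muleindic_ge0.
  apply: eq_integral => x _; rewrite [in RHS]fimfunE -fsumEFin //.
  rewrite ge0_mule_fsuml; last by move=> k; exact: nnfun_muleindic_ge0.
  by apply: eq_fsbigr => k _; rewrite -E.
apply: eq_fsbigr => k; rewrite inE => -[y _ <-].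
rewrite ge0_integralZl //=; last 3 first.
- apply/(measurable_restrict _ _ _) => //.
  by apply: measurable_funTS; exact/measurable_EFinP.
- by move=> x _; rewrite patchE; case: ifPn => // _; rewrite lee_fin.
- by rewrite lee_fin.
by rewrite nuE // -integral_mkcond.
Qed.

Lemma ge0_integral_density (h : T -> \bar R) : measurable_fun setT h ->
  (forall x, 0 <= h x) -> \int[nu]_x h x = \int[mu]_x (h x * (g x)%:E).
Proof.
move=> mh h0; pose f_ := nnsfun_approx measurableT mh.
transitivity (limn (fun n => \int[nu]_x (f_ n x)%:E)).
  rewrite -monotone_convergence //.
  - apply: eq_integral => y _; apply/esym/cvg_lim => //.
    by apply: cvg_nnsfun_approx.
  - by move=> n; exact/measurable_EFinP/measurable_funP.
  - by move=> n y _; rewrite lee_fin.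
  - by move=> y _ m n mn; rewrite lee_fin; exact/lefP/nd_nnsfun_approx.
rewrite [X in limn X](_ : _ = (fun n => \int[mu]_x ((f_ n x)%:E * (g x)%:E))); last first.
  by apply/funext => n; exact: integral_density_nnsfun.
rewrite -monotone_convergence //; last 3 first.
- move=> n; apply: emeasurable_funM; last exact/measurable_EFinP.
  by apply/measurable_EFinP/measurable_funP.
- by move=> n x _; rewrite mule_ge0 // lee_fin.
- move=> x _ m n mn; rewrite lee_wpmul2r ?lee_fin //.
  exact/lefP/nd_nnsfun_approx.
apply: eq_integral => x _; apply/cvg_lim => //.
by apply: cvgeMr => //; apply: cvg_nnsfun_approx.
Qed.

End density.

Lemma integrableZ_EFin (d : measure_display) (T : measurableType d) (R : realType)
  (mu : {measure set T -> \bar R}) (D : set T) (f : T -> R) (k : R) : measurable D ->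
  mu.-integrable D (fun x => (f x)%:E) -> mu.-integrable D (fun x => (k * f x)%:E).
Proof. by move=> mD fi; under eq_fun do rewrite EFinM; exact: integrableZl. Qed.

Section derive_pointwise.
Context {R : realType} (f g : R -> R) (x df dg : R).
Hypotheses (fd : is_derive x 1 f df) (gd : is_derive x 1 g dg).

Lemma is_derive_addf : is_derive x 1 (fun y => f y + g y) (df + dg).
Proof. exact: is_deriveD. Qed.

Lemma is_derive_subf : is_derive x 1 (fun y => f y - g y) (df - dg).
Proof. exact: is_deriveB. Qed.

Lemma is_derive_mulf : is_derive x 1 (fun y => f y * g y) (f x * dg + g x * df).
Proof. exact: is_deriveM. Qed.

End derive_pointwise.

(** * The fundamental theorem of calculus on an open half-line *)

Section improper_FTC.
Context {R : realType}.
Local Notation mu := (@lebesgue_measure R).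

Lemma FTC2_EFin (f F : R -> R) (a b : R) : a < b ->
  (forall x, a <= x <= b -> is_derive x 1 F (f x)) ->
  (forall x, a <= x <= b -> {for x, continuous f}) ->
  (\int[mu]_(x in `[a, b]) (f x)%:E = (F b - F a)%:E)%E.
Proof.
move=> ab dF cf.
have cF x : a <= x <= b -> {for x, continuous F}.
  by move=> /dF[dx _]; apply/differentiable_continuous/derivable1_diffP.
rewrite (@continuous_FTC2 _ f F a b ab) ?EFinB //.
- apply: continuous_in_subspaceT => x; rewrite inE /= in_itv /=; exact: cf.
- split.
  + by move=> x; rewrite in_itv /= => /andP[/ltW ax /ltW xb]; have [] := dF x (introT andP (conj ax xb)).
  + by apply: cvg_at_right_filter; apply: cF; rewrite lexx ltW.
  + by apply: cvg_at_left_filter; apply: cF; rewrite lexx ltW.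
- move=> x; rewrite in_itv /= => /andP[/ltW ax /ltW xb]; rewrite derive1E.
  by have [] := dF x (introT andP (conj ax xb)).
Qed.

Lemma Rintegral_FTC (f F : R -> R) (a b : R) : a < b ->
  (forall x, a <= x <= b -> is_derive x 1 F (f x)) ->
  (forall x, a <= x <= b -> {for x, continuous f}) ->
  \int[mu]_(x in `[a, b]) f x = F b - F a.
Proof. by move=> ab dF cf; rewrite /Rintegral (FTC2_EFin ab dF cf). Qed.

(** The half-line is exhausted by [a + 1/(n+1), a + n + 2] and |f| dominates. Both ends are limits
    because the gamma density may blow up at 0 and sin (tx) / t is not given by its formula
    there. *)
Lemma Rintegral_FTC_Ioy (f F : R -> R) (a l0 l1 : R) :
  (forall x, a < x -> is_derive x 1 F (f x)) ->
  (forall x, a < x -> {for x, continuous f}) ->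
  mu.-integrable `]a, +oo[ (EFin \o f) ->
  F x @[x --> a^'+] --> l0 -> F x @[x --> +oo] --> l1 ->
  \int[mu]_(x in `]a, +oo[) f x = l1 - l0.
Proof.
move=> dF cf intf F0 F1.
pose a_ n : R := a + n.+1%:R^-1; pose b_ n : R := a + n.+2%:R.
have a_a n : a < a_ n by rewrite ltrDl invr_gt0.
have ab n : a_ n < b_ n.
  by rewrite ltrD2l (@le_lt_trans _ _ 1) ?ltr1n // invf_le1 // ler1n.
have Eab n : (\int[mu]_(x in `[a_ n, b_ n]) (f x)%:E = (F (b_ n) - F (a_ n))%:E)%E.
  by apply: FTC2_EFin => // x /andP[ax _]; [apply: dF|apply: cf]; exact: lt_le_trans ax.
have a_cvg : F (a_ n) @[n --> \oo] --> l0.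
  move/cvg_at_rightP : F0; apply; split=> //.
  rewrite -[X in _ --> X]addr0; apply: cvgD; [exact: cvg_cst|exact: cvg_harmonic].
have b_cvg : F (b_ n) @[n --> \oo] --> l1.
  move/cvg_pinftyP : F1; apply.
  apply/cvgryPge => A; near=> n; rewrite -lerBlDl (@le_trans _ _ n%:R) ?ler_nat //.
    by near: n; exact: nbhs_infty_ger.
  by rewrite (leq_trans (leqnSn n)).
have mf : measurable_fun `]a, +oo[ (EFin \o f) by have /measurable_int := intf.
have subab n : `[a_ n, b_ n] `<=` `]a, +oo[.
  by move=> x /=; rewrite !in_itv /= andbT => /andP[+ _]; exact: lt_le_trans.
pose f_ n x := ((EFin \o f) \_ `[a_ n, b_ n]) x.
have mf_ n : measurable_fun `]a, +oo[ (f_ n).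
  apply/(measurable_restrict _ _ _) => //.
  by apply: measurable_funS mf => //; exact: subIsetl.
have f_f : {ae mu, forall x, `]a, +oo[%classic x -> f_ ^~ x @ \oo --> (EFin \o f) x}.
  apply: aeW => x /=; rewrite in_itv /= andbT => ax.
  apply: (@cvg_near_cst _ _ _ ); near=> n; rewrite /f_ patchE ifT // inE /= in_itv /=.
  apply/andP; split.
    rewrite /a_ -lerBrDl invf_ple ?posrE ?subr_gt0 // (@le_trans _ _ n%:R) ?ler_nat //.
    by near: n; exact: nbhs_infty_ger.
  rewrite /b_ -lerBlDl (@le_trans _ _ n%:R) ?ler_nat //.
    by near: n; exact: nbhs_infty_ger.
  by rewrite (leq_trans (leqnSn n)).
have iabs : mu.-integrable `]a, +oo[ (fun x => `|(f x)%:E|%E) by exact: integrable_abse.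
have f_b : {ae mu, forall x n, `]a, +oo[%classic x -> (`|f_ n x| <= `|(f x)%:E|)%E}.
  apply: aeW => x n _; rewrite /f_ patchE; case: ifPn => // _.
  by rewrite abse0 lee_fin.
have [||||| _ _ cvgf] := @dominated_convergence _ _ R mu (`]a, +oo[%classic : set R)
  (measurable_itv _) f_ (EFin \o f) (fun x => `|(f x)%:E|%E);
  [exact: mf_|exact: mf|exact: f_f|exact: iabs|exact: f_b|].
have Ef n : (\int[mu]_(x in `]a, +oo[) f_ n x = (F (b_ n) - F (a_ n))%:E)%E.
  by rewrite -Eab /f_ -integral_mkcondr setIidr //; exact: subab.
have h : (F (b_ n) - F (a_ n))%:E @[n --> \oo] -->
    (\int[mu]_(x in `]a, +oo[) (f x)%:E)%E.
  by under eq_fun do rewrite -Ef; exact: cvgf.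
have h' : F (b_ n) - F (a_ n) @[n --> \oo] --> \int[mu]_(x in `]a, +oo[) f x.
  apply: (@fine_cvg _ _ _ _ (fun n => (F (b_ n) - F (a_ n))%:E)).
  by rewrite fineK //; exact: integrable_fin_num.
by rewrite -(cvg_lim (@Rhausdorff R) h') (cvg_lim (@Rhausdorff R) (cvgB b_cvg a_cvg)).
Unshelve. all: by end_near. Qed.

(** Fatou's lemma on the exhausting segments; bounds for left endpoints c <= a + 1 are enough, as
    those of the exhaustion are such. *)
Lemma ge0_integrable_Ioy (f : R -> R) (a B : R) : (forall x, a < x -> 0 <= f x) ->
  (forall x, a < x -> {for x, continuous f}) ->
  (forall c d, a < c -> c <= a + 1 -> c < d ->
     (\int[mu]_(x in `[c, d]) (f x)%:E <= B%:E)%E) ->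
  mu.-integrable `]a, +oo[ (EFin \o f).
Proof.
move=> f0 cf fB.
have mf : measurable_fun `]a, +oo[ (EFin \o f).
  apply/measurable_EFinP; apply: open_continuous_measurable_fun => //.
  by move=> x; rewrite inE /= in_itv /= andbT; exact: cf.
pose a_ n : R := a + n.+1%:R^-1; pose b_ n : R := a + n.+2%:R.
have a_a n : a < a_ n by rewrite ltrDl invr_gt0.
have ab n : a_ n < b_ n.
  by rewrite ltrD2l (@le_lt_trans _ _ 1) ?ltr1n // invf_le1 // ler1n.
have subab n : `[a_ n, b_ n] `<=` `]a, +oo[.
  by move=> x /=; rewrite !in_itv /= andbT => /andP[+ _]; exact: lt_le_trans.
pose f_ n x := ((EFin \o f) \_ `[a_ n, b_ n]) x.
have mf_ n : measurable_fun `]a, +oo[ (f_ n).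
  apply/(measurable_restrict _ _ _) => //.
  by apply: measurable_funS mf => //; exact: subIsetl.
have f_0 n x : `]a, +oo[%classic x -> (0 <= f_ n x)%E.
  rewrite /= in_itv /= andbT => ax; rewrite /f_ patchE; case: ifPn => // _.
  by rewrite lee_fin f0.
have := @fatou _ _ R mu (`]a, +oo[%classic : set R) (measurable_itv _) f_ mf_ f_0.
have -> : (\int[mu]_(x in `]a, +oo[) limn_einf (f_ ^~ x) =
    \int[mu]_(x in `]a, +oo[) `|(EFin \o f) x|)%E.
  apply: eq_integral => x; rewrite inE /= in_itv /= andbT => ax.
  have cvf : f_ n x @[n --> \oo] --> `|(f x)%:E|%E.
    apply: (@cvg_near_cst _ _ _); near=> n; rewrite /f_ patchE ifT.
      by rewrite gee0_abs // lee_fin f0.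
    rewrite inE /= in_itv /=; apply/andP; split.
      rewrite /a_ -lerBrDl invf_ple ?posrE ?subr_gt0 // (@le_trans _ _ n%:R) ?ler_nat //.
      by near: n; exact: nbhs_infty_ger.
    rewrite /b_ -lerBlDl (@le_trans _ _ n%:R) ?ler_nat //.
      by near: n; exact: nbhs_infty_ger.
    by rewrite (leq_trans (leqnSn n)).
  by rewrite is_cvg_limn_einfE; [exact/cvg_lim|apply/cvg_ex; eexists; exact: cvf].
move=> fat; apply/integrableP; split => //.
apply: (le_lt_trans fat); apply: (@le_lt_trans _ _ B%:E); last exact: ltry.
rewrite limn_einf_lim; apply: lime_le; first exact: is_cvg_einfs.
apply: nearW => n; apply: (@le_trans _ _ (\int[mu]_(x in `]a, +oo[) f_ n x)%E).
  by apply: ereal_inf_lbound; exists n => //=.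
rewrite /f_ -integral_mkcondr setIidr; last exact: subab.
apply: fB => //; first by rewrite lerD2l invf_le1 // ler1n.
Unshelve. all: by end_near. Qed.

End improper_FTC.

Section derivation_under_integral.
Context (R : realType) (d : measure_display) (T : measurableType d).
Variables (mu : {measure set T -> \bar R}) (D : set T) (f df : R -> T -> R) (G : T -> R).

Lemma is_derive_under_integral (t : R) : measurable D ->
  (forall x, mu.-integrable D (EFin \o f x)) ->
  (forall (x : R) y, D y -> is_derive x 1 (f ^~ y) (df x y)) ->
  mu.-integrable D (EFin \o G) ->
  (forall x y, D y -> `|df x y| <= G y) ->
  is_derive t 1 (fun x => \int[mu]_(y in D) f x y) (\int[mu]_(y in D) df t y).
Proof.
move=> mD fi fd Gi dfG.
have tI : `]t - 1, t + 1[%classic t by rewrite /= in_itv /= ltrBlDr ltrDl ltr01.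
have fd1 x y : D y -> derivable (f ^~ y) x 1 by move=> /(fd x)[].
have fd2 x y : D y -> partial1of2 f x y = df x y.
  by rewrite partial1of2E => /(fd x)[].
have iG : mu.-integrable D (EFin \o (fun y => `|G y|)) by exact: integrable_abse Gi.
have dG x y : `]t - 1, t + 1[%classic x -> D y -> `|partial1of2 f x y| <= `|G y|.
  by move=> _ Dy; rewrite fd2 // (le_trans (dfG _ _ Dy)) // ler_norm.
have h := derivable_under_integral mD tI (fun x _ => fi x) (fun x y _ Dy => fd1 x y Dy)
  (fun y => normr_ge0 (G y)) iG dG.
have e := differentiation_under_integral mD tI (fun x _ => fi x) (fun x y _ Dy => fd1 x y Dy)
  (fun y => normr_ge0 (G y)) iG dG.
apply: DeriveDef => //; rewrite -derive1E e.
by apply: eq_Rintegral => y; rewrite inE; exact: fd2.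
Qed.

End derivation_under_integral.

(** * Moments and characteristic function of the gamma law *)

Section gamma_law.
Context {R : realType} (d : measure_display) (T : measurableType d) (P : probability T R).
Variables (r : R) (X : T -> R).
Hypotheses (r0 : 0 < r) (mX : measurable_fun setT X) (lawX : has_gamma_rr_law P r X).
Local Notation mu := (@lebesgue_measure R).
Local Notation D := (`]0, +oo[%classic : set R).

Let c := r `^ r / Gamma_fun r.

Let c_ge0 : 0 <= c.
Proof.
rewrite divr_ge0 ?powR_ge0 // /Gamma_fun; apply: Rintegral_ge0 => x _.
by rewrite mulr_ge0 ?powR_ge0 ?expR_ge0.
Qed.

Let w (s x : R) := x `^ s * expR (- (r * x)).

Lemma gamma_pdfE x : gamma_rr_pdf r x = c * w (r - 1) x.
Proof. by rewrite /gamma_rr_pdf /w mulrA. Qed.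

Lemma gamma_pdf_ge0 x : 0 <= gamma_rr_pdf r x.
Proof. by rewrite gamma_pdfE mulr_ge0 // /w mulr_ge0 ?powR_ge0 ?expR_ge0. Qed.

Lemma measurable_gamma_pdf : measurable_fun setT (gamma_rr_pdf r).
Proof.
rewrite (_ : gamma_rr_pdf r = fun x => c * w (r - 1) x); last first.
  by apply/funext => x; exact: gamma_pdfE.
apply: measurable_funM => //; apply: measurable_funM; first exact: measurable_powR.
by apply: measurableT_comp => //; apply: measurableT_comp => //; exact: measurable_funM.
Qed.

Let X' : {RV P >-> measurableTypeR R} :=
  HB.pack (X : T -> measurableTypeR R) (isMeasurableFun.Build _ _ _ (measurableTypeR R) X mX).
Let g0 := gamma_rr_pdf r \_ D.

Let mg0 : measurable_fun setT g0.
Proof.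
apply/(measurable_restrict _ _ _) => //; apply: measurable_funTS.
exact: measurable_gamma_pdf.
Qed.

Lemma ge0_expectation_gamma (h : R -> R) : measurable_fun setT h -> (forall x, 0 <= h x) ->
  (\int[P]_v (h (X v))%:E = \int[mu]_(x in D) (h x * gamma_rr_pdf r x)%:E)%E.
Proof.
move=> mh h0.
transitivity (\int[distribution P X']_x (h x)%:E)%E.
  by rewrite (ge0_integral_distribution X') //; exact/measurable_EFinP.
rewrite (@ge0_integral_density _ _ _ mu (distribution P X') g0) //.
- rewrite [RHS]integral_mkcond; apply: eq_integral => x _.
  by rewrite /g0 /patch; case: ifPn => _ //; rewrite mule0.
- by move=> x; rewrite /g0 patchE; case: ifPn => // _; exact: gamma_pdf_ge0.
- move=> A mA; transitivity (P (X @^-1` A)) => //; rewrite lawX // integral_mkcondr.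
  by apply: eq_integral => x _; rewrite /g0 /patch; case: ifPn.
- exact/measurable_EFinP.
Qed.

Lemma gamma_integrable (h : R -> R) : measurable_fun setT h ->
  P.-integrable setT (fun v => (h (X v))%:E) <->
  mu.-integrable D (fun x => (h x * gamma_rr_pdf r x)%:E).
Proof.
move=> mh; have ma : measurable_fun setT (fun x => `|h x|) by exact: measurableT_comp.
have E : (\int[P]_v `|(h (X v))%:E| = \int[mu]_(x in D) `|(h x * gamma_rr_pdf r x)%:E|)%E.
  rewrite (ge0_expectation_gamma ma) //; apply: eq_integral => x _.
  by rewrite /= normrM (ger0_norm (gamma_pdf_ge0 _)).
split => /integrableP[_ hoo]; apply/integrableP; split.
- apply: measurable_funTS; apply/measurable_EFinP; apply: measurable_funM => //.
  exact: measurable_gamma_pdf.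
- by rewrite -E.
- by apply/measurable_EFinP; exact: measurableT_comp.
- by rewrite E.
Qed.

Lemma expectation_gamma (h : R -> R) : measurable_fun setT h ->
  P.-integrable setT (fun v => (h (X v))%:E) ->
  \int[P]_v h (X v) = \int[mu]_(x in D) (h x * gamma_rr_pdf r x).
Proof.
move=> mh ih; rewrite /Rintegral integralE [in RHS]integralE; congr (fine (_ - _)).
  rewrite (_ : (fun v => (h (X v))%:E)^\+%E = fun v => (Num.max (h (X v)) 0)%:E); last first.
    by apply/funext => v; rewrite funeposE EFin_max.
  rewrite (@ge0_expectation_gamma (fun x => Num.max (h x) 0)) //.
  - apply: eq_integral => x _; rewrite funeposE -EFin_max maxr_pMl ?gamma_pdf_ge0 // mul0r //.
  - exact: measurable_maxr.
  - by move=> x; rewrite le_max lexx orbT.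
rewrite (_ : (fun v => (h (X v))%:E)^\-%E = fun v => (Num.max (- h (X v)) 0)%:E); last first.
  by apply/funext => v; rewrite funenegE EFin_max EFinN.
rewrite (@ge0_expectation_gamma (fun x => Num.max (- h x) 0)) //.
- apply: eq_integral => x _; rewrite funenegE -EFinN -EFin_max maxr_pMl ?gamma_pdf_ge0 // mul0r mulNr //.
- by apply: measurable_maxr => //; exact: measurableT_comp.
- by move=> x; rewrite le_max lexx orbT.
Qed.

(** Read off from the fact that the density represents a probability law, instead of from
    convergence of the Gamma integral. *)
Lemma gamma_pdf_integrable : mu.-integrable D (fun x => (gamma_rr_pdf r x)%:E).
Proof.
rewrite (_ : (fun x => _) = fun x => (cst 1 x * gamma_rr_pdf r x)%:E); last first.
  by apply/funext => x; rewrite mul1r.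
by apply/gamma_integrable => //; exact: finite_measure_integrable_cst.
Qed.

Let is_derive_w (s x : R) : 0 < x ->
  is_derive x 1 (w (s + 1)) ((s + 1) * w s x - r * w (s + 1) x).
Proof.
move=> x0; have h1 := is_derive1_powR (s + 1) x0.
have h2 := is_derive_expR_comp (is_deriveN (is_derive_scale_id r x)).
apply: (is_derive_eq (is_deriveM h1 h2)); rewrite /GRing.scale /= /w addrK; ring.
Qed.

Let continuous_w (s x : R) : 0 < x -> {for x, continuous (w s)}.
Proof.
move=> x0; have := is_derive_w (s - 1) x0; rewrite subrK => -[dw _].
by apply/differentiable_continuous/derivable1_diffP.
Qed.

Let w_ge0 (s x : R) : 0 <= w s x. Proof. by rewrite mulr_ge0 ?powR_ge0 ?expR_ge0. Qed.

Let cvg_w0 (s : R) : 0 < s -> w s x @[x --> 0^'+] --> 0.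
Proof.
move=> s0; rewrite -[X in _ --> X](mul0r (expR (- (r * 0)))).
apply: cvgM; first exact: powR_cvg0.
apply: cvg_at_right_filter; apply: continuous_cvg; first exact: continuous_expR.
by apply: cvgN; apply: cvgMr; exact: cvg_id.
Qed.

Let cvg_wy (s : R) : w s x @[x --> +oo] --> 0.
Proof.
near \oo => m.
have sm : s <= m%:R by near: m; exact: nbhs_infty_ger.
apply/cvgr0Pnorm_le => e e0; near=> x.
have x1 : 1 <= x by near: x; exact: nbhs_pinfty_ge.
have x0 : 0 < x by exact: lt_le_trans x1.
rewrite ger0_norm //; apply: (@le_trans _ _ (x ^+ m * expR (- (r * x)))).
  by rewrite /w ler_wpM2r ?expR_ge0 // -(powR_mulrn m (ltW x0)) ler_powR.
have h := @texp_le_expR R m.+2 (r * x) (ltW (mulr_gt0 r0 x0)).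
rewrite big_ord_recr /= in h.
have {}h : (m.+1)`!%:R^-1 * (r * x) ^+ m.+1 <= expR (r * x).
  apply: le_trans h; rewrite lerDr sumr_ge0 // => i _.
  by rewrite mulr_ge0 ?invr_ge0 // exprn_ge0 // ltW // mulr_gt0.
rewrite expRN ler_pdivrMr ?expR_gt0 //; apply: le_trans (ler_wpM2l (ltW e0) h).
rewrite exprMn [x ^+ m.+1]exprS !mulrA ler_peMl ?exprn_ge0 ?(ltW x0) //.
rewrite mulrC -ler_pdivrMr; last by rewrite !mulr_gt0 ?exprn_gt0 // invr_gt0 ltr0n fact_gt0.
by near: x; apply: nbhs_pinfty_ge; rewrite num_real.
Unshelve. all: by end_near. Qed.

(** Integrating w_(s+1)' = (s + 1) w_s - r w_(s+1) over [a, b] bounds the integral of w_(s+1) by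
    that of w_s and the boundary value at a, which is at most 1 because a <= 1. The constant [c] is
    carried along since the induction starts from integrability of the density itself. *)
Let integrable_cw_step (s : R) : 0 < s + 1 -> mu.-integrable D (EFin \o (fun x => c * w s x)) ->
  mu.-integrable D (EFin \o (fun x => c * w (s + 1) x)).
Proof.
move=> s0 iw.
have iwf : (\int[mu]_(x in D) (c * w s x)%:E)%E \is a fin_num by exact: integrable_fin_num.
pose I := fine (\int[mu]_(x in D) (c * w s x)%:E)%E.
apply: (@ge0_integrable_Ioy _ _ 0 (((s + 1) * I + c) / r)).
- by move=> x _; rewrite mulr_ge0.
- by move=> x x0; apply: cvgMr; exact: continuous_w.
move=> a b a0; rewrite add0r => a1 ab.
have csub : `[a, b] `<=` D.
  by move=> x /=; rewrite !in_itv /= andbT => /andP[+ _]; exact: lt_le_trans.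
have iab (g : R -> R) : (forall x, 0 < x -> {for x, continuous g}) ->
    mu.-integrable `[a, b] (EFin \o g).
  move=> cg; apply: continuous_compact_integrable; first exact: segment_compact.
  apply: continuous_in_subspaceT => x; rewrite inE /= in_itv /= => /andP[ax _].
  by apply: cg; exact: lt_le_trans ax.
have i1 : mu.-integrable `[a, b] (EFin \o (fun x => c * w s x)).
  by apply: iab => x x0; apply: cvgMr; exact: continuous_w.
have i2 : mu.-integrable `[a, b] (EFin \o (fun x => c * w (s + 1) x)).
  by apply: iab => x x0; apply: cvgMr; exact: continuous_w.
have ftc : \int[mu]_(x in `[a, b]) ((s + 1) * (c * w s x) - r * (c * w (s + 1) x)) =
    c * w (s + 1) b - c * w (s + 1) a.
  apply: (@Rintegral_FTC _ _ (fun x => c * w (s + 1) x)) => //.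
  - move=> x /andP[ax _]; have x0 : 0 < x by exact: lt_le_trans ax.
    apply: (is_derive_eq (is_derive_scale (is_derive_w s x0) c)); ring.
  - move=> x /andP[ax _]; have x0 : 0 < x by exact: lt_le_trans ax.
    by apply: cvgB; apply: cvgMr; apply: cvgMr; exact: continuous_w.
rewrite RintegralB // in ftc; last 2 first.
- by apply: (integrableZl _ _ i1).
- by apply: (integrableZl _ _ i2).
rewrite (RintegralZl (s + 1) _ i1) // (RintegralZl r _ i2) // in ftc.
have E2 : (\int[mu]_(x in `[a, b]) (c * w (s + 1) x)%:E)%E =
    (\int[mu]_(x in `[a, b]) (c * w (s + 1) x))%:E.
  by rewrite /Rintegral fineK //; exact: integrable_fin_num.
have J1 : \int[mu]_(x in `[a, b]) (c * w s x) <= I.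
  rewrite /Rintegral fine_le //; first exact: integrable_fin_num.
  apply: ge0_subset_integral => //; first by have /measurable_int := iw.
  by move=> x _; rewrite lee_fin mulr_ge0.
rewrite E2 lee_fin ler_pdivlMr //.
have wa : c * w (s + 1) a <= c.
  rewrite ler_piMr // /w mulr_ile1 ?powR_ge0 ?expR_ge0 //.
    by rewrite -[leRHS](powRr0 a) ger_powR ?a0 // ltW.
  by rewrite -[leRHS]expR0 ler_expR oppr_le0 mulr_ge0 ?ltW.
have wb : 0 <= c * w (s + 1) b by rewrite mulr_ge0.
have := ler_wpM2l (ltW s0) J1.
rewrite [leLHS]mulrC; set A := \int[mu]_(x in _) _ in ftc *.
set B := \int[mu]_(x in _) _ in ftc *; move: ftc => /eqP; rewrite subr_eq => /eqP ftc h.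
by lra.
Qed.

Let gamma_pdf_powE k x : 0 < x -> x ^+ k * gamma_rr_pdf r x = c * w (r - 1 + k%:R) x.
Proof.
move=> x0; rewrite gamma_pdfE /w -(powR_mulrn k (ltW x0)) [in RHS]powRD; last first.
  by rewrite (gt_eqF x0) implybT.
ring.
Qed.

Lemma gamma_moment_integrable k : mu.-integrable D (fun x => (x ^+ k * gamma_rr_pdf r x)%:E).
Proof.
apply: (@eq_integrable _ _ _ mu D _ (EFin \o (fun x => c * w (r - 1 + k%:R) x))) => //.
  by move=> x; rewrite inE /= in_itv /= andbT => x0; rewrite gamma_pdf_powE.
elim: k => [|k ih].
  apply: (@eq_integrable _ _ _ mu D _ (fun x => (gamma_rr_pdf r x)%:E)) => //.
    by move=> x _ /=; rewrite gamma_pdfE addr0.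
  exact: gamma_pdf_integrable.
rewrite -natr1 addrA; apply: integrable_cw_step => //.
by rewrite addrAC subrK ltr_wpDr.
Qed.

Section stein.
Variables (h dh : R -> R) (A : R).
Hypotheses (ch : continuous h) (cdh : continuous dh).
Hypothesis hd : forall x : R, is_derive x 1 h (dh x).
Hypothesis hA : forall x, 0 < x -> `|h x| <= A * (1 + x).
Hypothesis dhA : forall x, 0 < x -> `|dh x| <= A.

(** Times the density p, the integrand is the derivative of x p(x) h(x), which vanishes at 0 because
    r > 0 and at infinity because h grows at most linearly. The choices h = 1 and h = id give the
    moments, cosines and sines the equation of the characteristic function. *)
Lemma gamma_stein :
  P.-integrable setT (fun v => ((r - r * X v) * h (X v) + X v * dh (X v))%:E) /\
  \int[P]_v ((r - r * X v) * h (X v) + X v * dh (X v)) = 0.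
Proof.
pose H x := (r - r * x) * h x + x * dh x.
have A0 : 0 <= A by rewrite (le_trans _ (dhA ltr01)).
have cH : continuous H.
  move=> x; apply: cvgD; apply: cvgM; [|exact: ch|exact: cvg_id|exact: cdh].
  by apply: cvgB; [exact: cvg_cst|apply: cvgMr; exact: cvg_id].
have mH : measurable_fun setT H by exact: continuous_measurable_fun.
have iH : mu.-integrable D (fun x => (H x * gamma_rr_pdf r x)%:E).
  pose C := 2 * r * A + A.
  apply: (@le_integrable _ _ _ mu D _ _
     (fun x => (C%:E * ((x ^+ 0 * gamma_rr_pdf r x)%:E + (x ^+ 2 * gamma_rr_pdf r x)%:E))%E)) => //.
  - apply: measurable_funTS; apply/measurable_EFinP; apply: measurable_funM => //.
    exact: measurable_gamma_pdf.
  - move=> x /=; rewrite in_itv /= andbT => x0.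
    move: (gamma_rr_pdf r x) (gamma_pdf_ge0 x) => p pge0.
    rewrite lee_fin expr0 -mulrDl [C * _]mulrA normrM [leRHS]ger0_norm; last first.
      by rewrite mulr_ge0 // mulr_ge0 ?addr_ge0 ?sqr_ge0 // mulr_ge0 // mulr_ge0 // ltW.
    rewrite (ger0_norm pge0) ler_wpM2r // (le_trans (ler_normD _ _)) // !normrM.
    have h1 : `|r - r * x| <= r * (1 + x).
      by rewrite (le_trans (ler_normB _ _)) // normrM !gtr0_norm // mulrDr mulr1.
    have h2 := ler_pM (normr_ge0 _) (normr_ge0 _) h1 (hA x0).
    have h3 := ler_wpM2l (normr_ge0 x) (dhA x0); rewrite gtr0_norm // in h3.
    rewrite [`|x|]gtr0_norm // (le_trans (lerD h2 h3)) //.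
    have rA : 0 <= r * A by rewrite mulr_ge0 // ltW.
    have q1 : (1 + x) * (1 + x) <= 2 * (1 + x ^+ 2) by have := sqr_ge0 (x - 1); lra.
    have q2 : x <= 1 + x ^+ 2 by have := sqr_ge0 (x - 1); lra.
    have := ler_wpM2l rA q1; have := ler_wpM2l A0 q2; rewrite /C.
    set u := x ^+ 2; rewrite !mulrDr !mulrDl !mulr1; lra.
  - apply: integrableZl => //; apply: integrableD => //; exact: gamma_moment_integrable.
have iP : P.-integrable setT (fun v => (H (X v))%:E) by apply/gamma_integrable.
split => //; rewrite (expectation_gamma mH iP).
transitivity (0 - 0 : R); last by rewrite subrr.
apply: (@Rintegral_FTC_Ioy _ _ (fun x => c * w r x * h x) 0 0 0).
- move=> x x0; have := is_derive_w (r - 1) x0; rewrite subrK => dw.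
  apply: (is_derive_eq (is_deriveM (is_derive_scale dw c) (hd x))).
  rewrite /GRing.scale /= /H gamma_pdfE.
  have -> : w r x = x * w (r - 1) x.
    by rewrite /w mulrA mulr_powRB1 // ltW.
  ring.
- move=> x x0; apply: cvgM; first exact: cH.
  rewrite (_ : gamma_rr_pdf r = fun x => c * w (r - 1) x); last first.
    by apply/funext => y; exact: gamma_pdfE.
  by apply: cvgMr; exact: continuous_w.
- exact: iH.
- rewrite -[X in _ --> X](mul0r (h 0)); apply: cvgM; last by apply: cvg_at_right_filter; exact: ch.
  by rewrite -[X in _ --> X](mulr0 c); apply: cvgMr; exact: cvg_w0.
- apply/norm_cvg0P.
  apply: (@squeeze_cvgr _ _ _ _ (cst 0) (fun x => c * A * (w r x + w (r + 1) x))).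
  + near=> x; have x0 : 0 < x by near: x; exact: nbhs_pinfty_gt.
    rewrite normr_ge0 /= normrM (ger0_norm (mulr_ge0 c_ge0 (w_ge0 _ _))).
    have -> : w (r + 1) x = x * w r x.
      by rewrite /w mulrA -(mulr_powRB1 (ltW x0) (addr_gt0 r0 ltr01)) addrK.
    have := ler_wpM2l (mulr_ge0 c_ge0 (w_ge0 r x)) (hA x0).
    by move=> /le_trans; apply; rewrite le_eqVlt; apply/orP; left; apply/eqP; ring.
  + exact: cvg_cst.
  + rewrite -(mulr0 (c * A)); apply: cvgMr; rewrite -[X in _ --> X](addr0 0).
    by apply: cvgD; exact: cvg_wy.
Unshelve. all: by end_near. Qed.

End stein.

Lemma gamma_power_integrable k : P.-integrable setT (fun v => (X v ^+ k)%:E).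
Proof.
apply/(@gamma_integrable (fun x => x ^+ k)); first exact: exprn_measurable.
exact: gamma_moment_integrable.
Qed.

Lemma gamma_mean : \int[P]_v X v = 1.
Proof.
have i1 := gamma_power_integrable 1.
have [] := @gamma_stein (cst 1) (cst 0) 1.
- by move=> x; exact: cvg_cst.
- by move=> x; exact: cvg_cst.
- by move=> x x0; rewrite normr1 mul1r lerDl ltW.
- by move=> x x0; rewrite normr0.
move=> _; rewrite (@eq_Rintegral _ _ _ P _ (fun v => r - r * X v)); last first.
  by move=> v _; rewrite /cst mulr1 mulr0 addr0.
rewrite RintegralB //; last 2 first.
- exact: finite_measure_integrable_cst.
- exact: integrableZ_EFin.
rewrite RintegralZl // Rintegral_cst //= -/(P setT) probability_setT mulr1 => /eqP.
by rewrite -{1}(mulr1 r) -mulrBr mulf_eq0 (gt_eqF r0) /= subr_eq0 => /eqP.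
Qed.

Lemma gamma_second_moment : \int[P]_v (X v ^+ 2) = 1 + r^-1.
Proof.
have i1 := gamma_power_integrable 1; have i2 := gamma_power_integrable 2.
have [] := @gamma_stein id (cst 1) 1.
- by move=> x; exact: cvg_id.
- by move=> x; exact: cvg_cst.
- by move=> x x0; rewrite gtr0_norm // mul1r lerDr.
- by move=> x x0; rewrite normr1.
move=> _; rewrite (@eq_Rintegral _ _ _ P _ (fun v => (r + 1) * X v - r * X v ^+ 2)); last first.
  by move=> v _; rewrite /cst /= expr2; ring.
rewrite RintegralB //; last 2 first.
- exact: integrableZ_EFin.
- exact: integrableZ_EFin.
rewrite !RintegralZl // gamma_mean => h.
apply: (mulfI (lt0r_neq0 r0)); rewrite mulrDr mulr1 mulfV ?gt_eqF //.
by move: h => /eqP; rewrite subr_eq0 mulr1 => /eqP.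
Qed.

Section cf.

Let fc t := \int[P]_v cos (t * X v).
Let fs t := \int[P]_v sin (t * X v).
Let fa t := \int[P]_v (X v * cos (t * X v)).
Let fb t := \int[P]_v (X v * sin (t * X v)).

Let mtrig (g : R -> R) t : continuous g -> measurable_fun setT (fun v => g (t * X v)).
Proof.
move=> cg; apply: measurableT_comp; first exact: continuous_measurable_fun.
by apply: measurable_funM.
Qed.

Let itrig (g : R -> R) t : continuous g -> (forall x, `|g x| <= 1) ->
  P.-integrable setT (fun v => (g (t * X v))%:E) /\
  P.-integrable setT (fun v => (X v * g (t * X v))%:E).
Proof.
move=> cg g1; split.
  apply: (@le_integrable _ _ _ P _ measurableT _ (cst 1%:E)).
  - by apply/measurable_EFinP; exact: mtrig.
  - by move=> v _; rewrite /= lee_fin normr1.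
  - exact: finite_measure_integrable_cst.
apply: (@le_integrable _ _ _ P _ measurableT _ (fun v => (X v ^+ 1)%:E)).
- by apply/measurable_EFinP; apply: measurable_funM => //; exact: mtrig.
- by move=> v _; rewrite /= lee_fin normrM expr1 ler_piMr.
- exact: gamma_power_integrable.
Qed.

Let isin t := itrig t (@continuous_sin R) (@sin_max R).
Let icos t := itrig t (@continuous_cos R) (@cos_max R).

Let is_derive_trig (g dg : R -> R) (t : R) : continuous g -> (forall x, `|g x| <= 1) ->
  (forall x : R, is_derive x 1 g (dg x)) -> (forall x, `|dg x| <= 1) ->
  is_derive t 1 (fun t => \int[P]_v g (t * X v)) (\int[P]_v (X v * dg (t * X v))).
Proof.
move=> cg g1 gd dg1.
apply: (@is_derive_under_integral _ _ _ P setT (fun t v => g (t * X v))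
  (fun t v => X v * dg (t * X v)) (fun v => `|X v ^+ 1|)) => //.
- by move=> x; have [] := itrig x cg g1.
- move=> x v _; have hm : is_derive x 1 (fun y => y * X v) (X v).
    rewrite (_ : (fun y => y * X v) = fun y => X v * y); first exact: is_derive_scale_id.
    by apply/funext => y; rewrite mulrC.
  by apply: (is_derive_eq (is_derive1_comp (gd _) hm)); rewrite mulrC.
- exact: integrable_abse (gamma_power_integrable 1).
- by move=> x v _; rewrite normrM expr1 ler_piMr.
Qed.

Let fc_derive (t : R) : is_derive t 1 fc (- fb t).
Proof.
have -> : - fb t = \int[P]_v (X v * (fun x => - sin x) (t * X v)).
  rewrite /fb -mulN1r -RintegralZl //; last by have [] := isin t.
  by apply: eq_Rintegral => v _; rewrite mulrN mulN1r.
apply: is_derive_trig; first exact: continuous_cos.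
- by move=> x; exact: cos_max.
- by move=> x; rewrite normrN sin_max.
Qed.

Let fs_derive (t : R) : is_derive t 1 fs (fa t).
Proof.
apply: is_derive_trig; first exact: continuous_sin.
- by move=> x; exact: sin_max.
- by move=> x; exact: cos_max.
Qed.

Let stein1 t : r * fc t = r * fa t + t * fb t.
Proof.
have tA : `|t| <= 1 + `|t| by rewrite lerDr.
have [] := @gamma_stein (fun x => cos (t * x)) (fun x => t * (- sin (t * x))) (1 + `|t|).
- move=> x; apply: continuous_comp; last exact: continuous_cos.
  by apply: cvgMr; exact: cvg_id.
- move=> x; apply: cvgMr; apply: cvgN.
  apply: continuous_comp; last exact: continuous_sin.
  by apply: cvgMr; exact: cvg_id.
- move=> x; apply: (is_derive_eq (is_derive_cos_comp (is_derive_scale_id t x))); ring.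
- move=> x x0; rewrite (le_trans (cos_max _)) // mulrDl mul1r mulrDr mulr1.
  by rewrite -addrA lerDl !addr_ge0 ?mulr_ge0 // ltW.
- by move=> x x0; rewrite normrM normrN (le_trans _ tA) // ler_piMr // sin_max.
move=> _; have [ic iXc] := icos t; have [is_ iXs] := isin t.
rewrite (@eq_Rintegral _ _ _ P _ (fun v => r * cos (t * X v) -
   (r * (X v * cos (t * X v)) + t * (X v * sin (t * X v))))); last first.
  by move=> v _; ring.
have j1 := integrableZ_EFin r measurableT iXc; have j2 := integrableZ_EFin t measurableT iXs.
rewrite RintegralB //; last 2 first.
- exact: integrableZ_EFin.
- exact: (integrableD measurableT j1 j2).
rewrite RintegralD // !RintegralZl // => /eqP; rewrite subr_eq0 => /eqP.
done.
Qed.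

Let stein2 t : r * fs t = r * fb t - t * fa t.
Proof.
have tA : `|t| <= 1 + `|t| by rewrite lerDr.
have [] := @gamma_stein (fun x => sin (t * x)) (fun x => t * cos (t * x)) (1 + `|t|).
- move=> x; apply: continuous_comp; last exact: continuous_sin.
  by apply: cvgMr; exact: cvg_id.
- move=> x; apply: cvgMr.
  apply: continuous_comp; last exact: continuous_cos.
  by apply: cvgMr; exact: cvg_id.
- move=> x; apply: (is_derive_eq (is_derive_sin_comp (is_derive_scale_id t x))); ring.
- move=> x x0; rewrite (le_trans (sin_max _)) // mulrDl mul1r mulrDr mulr1.
  by rewrite -addrA lerDl !addr_ge0 ?mulr_ge0 // ltW.
- by move=> x x0; rewrite normrM (le_trans _ tA) // ler_piMr // cos_max.
move=> _; have [ic iXc] := icos t; have [is_ iXs] := isin t.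
rewrite (@eq_Rintegral _ _ _ P _ (fun v => r * sin (t * X v) -
   (r * (X v * sin (t * X v)) - t * (X v * cos (t * X v))))); last first.
  by move=> v _; ring.
have j1 := integrableZ_EFin r measurableT iXs; have j2 := integrableZ_EFin t measurableT iXc.
rewrite RintegralB //; last 2 first.
- exact: integrableZ_EFin.
- exact: (integrableB measurableT j1 j2).
rewrite RintegralB // !RintegralZl // => /eqP; rewrite subr_eq0 => /eqP.
done.
Qed.

(** The candidate (1 - it/r)^(-r) has modulus exp (- A t) and argument [th t]. *)
Let A t := r / 2 * ln (1 + (r^-1 * t) ^+ 2).
Let th t := r * atan (r^-1 * t).

Let is_derive_A (t : R) : is_derive t 1 A ((r^-1 * t) / (1 + (r^-1 * t) ^+ 2)).
Proof.
have p : 0 < 1 + (r^-1 * t) ^+ 2 by rewrite ltr_pwDl // sqr_ge0.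
have h1 : is_derive t 1 (fun t => 1 + (r^-1 * t) ^+ 2) (0 + 2%:R * (r^-1 * t) ^+ 1 * r^-1).
  exact: (is_deriveD (is_derive_cst (1 : R) t 1) (is_derive_expr (is_derive_scale_id r^-1 t) 2)).
have h2 := is_derive_scale (is_derive_ln_comp h1 p) (r / 2).
apply: (is_derive_eq h2).
set u := r^-1 * t in p *; have pn := lt0r_neq0 p; have rn := lt0r_neq0 r0.
by field; rewrite rn pn.
Qed.

Let is_derive_th (t : R) : is_derive t 1 th ((1 + (r^-1 * t) ^+ 2)^-1).
Proof.
have p : 0 < 1 + (r^-1 * t) ^+ 2 by rewrite ltr_pwDl // sqr_ge0.
apply: (is_derive_eq (is_derive_scale (is_derive_atan_comp (is_derive_scale_id r^-1 t)) r)).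
rewrite mulrA mulfV ?mul1r //; exact: lt0r_neq0.
Qed.

Let fab t : let u := r^-1 * t in
  fa t = (fc t - u * fs t) / (1 + u ^+ 2) /\ fb t = (fs t + u * fc t) / (1 + u ^+ 2).
Proof.
move=> u; have p : 1 + u ^+ 2 != 0 by rewrite gt_eqF // ltr_pwDl // sqr_ge0.
have -> : fc t = fa t + u * fb t.
  apply: (mulfI (lt0r_neq0 r0)); rewrite stein1 mulrDr /u; field; exact: lt0r_neq0.
have -> : fs t = fb t - u * fa t.
  apply: (mulfI (lt0r_neq0 r0)); rewrite stein2 mulrBr /u; field; exact: lt0r_neq0.
by split; apply: (mulIf p); rewrite divfK //; ring.
Qed.

(* By the two Stein identities the characteristic function [f] satisfies
   [f' = 'i f / (1 - 'i t / r)], so that its quotient by the candidate is constant. *)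
Lemma gamma_char t : fc t = expR (- A t) * cos (th t) /\ fs t = expR (- A t) * sin (th t).
Proof.
(* [U] and [V] are the real and imaginary parts of the quotient, expected to be 1 and 0. *)
pose U t := expR (A t) * (fc t * cos (th t) + fs t * sin (th t)).
pose V t := expR (A t) * (fs t * cos (th t) - fc t * sin (th t)).
have dU (x : R) : is_derive x 1 U 0.
  have := is_derive_mulf (is_derive_expR_comp (is_derive_A x))
   (is_derive_addf (is_derive_mulf (fc_derive x) (is_derive_cos_comp (is_derive_th x)))
      (is_derive_mulf (fs_derive x) (is_derive_sin_comp (is_derive_th x)))).
  move=> h; apply: (is_derive_eq h).
  have [-> ->] := fab x; set u := r^-1 * x.
  have p : 1 + u ^+ 2 != 0 by rewrite gt_eqF // ltr_pwDl // sqr_ge0.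
  by field.
have dV (x : R) : is_derive x 1 V 0.
  have := is_derive_mulf (is_derive_expR_comp (is_derive_A x))
   (is_derive_subf (is_derive_mulf (fs_derive x) (is_derive_cos_comp (is_derive_th x)))
      (is_derive_mulf (fc_derive x) (is_derive_sin_comp (is_derive_th x)))).
  move=> h; apply: (is_derive_eq h).
  have [-> ->] := fab x; set u := r^-1 * x.
  have p : 1 + u ^+ 2 != 0 by rewrite gt_eqF // ltr_pwDl // sqr_ge0.
  by field.
have A0 : A 0 = 0 by rewrite /A mulr0 expr0n addr0 ln1 mulr0.
have th0 : th 0 = 0 by rewrite /th mulr0 atan0 mulr0.
have c0 : fc 0 = 1.
  rewrite /fc (@eq_Rintegral _ _ _ P _ (cst 1)) => [|v _]; last by rewrite mul0r cos0.
  have P1 : fine (P setT) = 1 by rewrite probability_setT.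
  by rewrite Rintegral_cst // mul1r; exact: P1.
have s0 : fs 0 = 0.
  rewrite /fs (@eq_Rintegral _ _ _ P _ (cst 0)) => [|v _]; last by rewrite mul0r sin0.
  by rewrite Rintegral_cst // mul0r.
have U1 : U t = 1.
  by rewrite (is_derive_0_is_cst t 0 dU) /U A0 th0 c0 s0 expR0 cos0 sin0; ring.
have V0 : V t = 0.
  by rewrite (is_derive_0_is_cst t 0 dV) /V A0 th0 c0 s0 expR0 cos0 sin0; ring.
have q := cos2Dsin2 (th t).
have e1 : fc t * cos (th t) + fs t * sin (th t) = expR (- A t).
  by apply: (mulfI (lt0r_neq0 (expR_gt0 (A t)))); rewrite -/(U t) U1 expRxMexpNx_1.
have e2 : fs t * cos (th t) - fc t * sin (th t) = 0.
  by apply: (mulfI (lt0r_neq0 (expR_gt0 (A t)))); rewrite -/(V t) V0 mulr0.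
split.
- rewrite -e1 -{1}(mulr1 (fc t)) -q; apply/eqP; rewrite -subr_eq0; apply/eqP.
  by transitivity (- sin (th t) * (fs t * cos (th t) - fc t * sin (th t)));
    [ring|rewrite e2 mulr0].
- rewrite -e1 -{1}(mulr1 (fs t)) -q; apply/eqP; rewrite -subr_eq0; apply/eqP.
  by transitivity (cos (th t) * (fs t * cos (th t) - fc t * sin (th t)));
    [ring|rewrite e2 mulr0].
Qed.

End cf.

End gamma_law.

(** * Fourier transforms of Gaussian functions *)

Section normal_cdf.
Context {R : realType}.
Local Notation mu := (@lebesgue_measure R).
Local Notation Phi := (@std_normal_cdf R).
Local Notation phi := (@std_normal_pdf R).

Lemma std_normal_pdfE : phi = normal_pdf 0 1.
Proof.
rewrite normal_pdfE ?oner_eq0 //; apply/funext => x.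
by rewrite /std_normal_pdf /normal_peak /normal_fun subr0 expr1n mul1r mulrC.
Qed.

Lemma continuous_std_normal_pdf : continuous phi.
Proof. by rewrite std_normal_pdfE; apply: continuous_normal_pdf; rewrite oner_eq0. Qed.

Lemma integrable_std_normal_pdf : mu.-integrable setT (EFin \o phi).
Proof. by rewrite std_normal_pdfE; exact: integrable_normal_pdf. Qed.

Lemma is_derive_std_normal_cdf (x : R) : is_derive x 1 Phi (phi x).
Proof.
have ip : mu.-integrable [set` Interval -oo%O (BRight (x + 1))] (EFin \o phi).
  by apply: integrableS integrable_std_normal_pdf.
have xx : x < x + 1 by rewrite ltrDl.
have [||dx ex] := continuous_FTC1 xx ip; [by rewrite ltNyr|exact: continuous_std_normal_pdf|].
by split; [exact: dx|rewrite -derive1E; exact: ex].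
Qed.

(** The identity seen as a random variable under the standard normal law, so that general facts
    about distribution functions transfer to Phi. *)
Let idR : measurableTypeR R -> R := idfun.
#[local] HB.instance Definition _ :=
  @isMeasurableFun.Build _ _ _ _ idR (@measurable_id _ _ setT).
Let idRV : {RV (normal_prob (0 : R) 1) >-> R} := idR.

Let PhiE x : (Phi x)%:E = cdf idRV x.
Proof.
rewrite /std_normal_cdf /Rintegral /cdf /distribution /pushforward preimage_id.
rewrite /normal_prob std_normal_pdfE fineK //.
apply: integrable_fin_num => //; apply: (@integrableS _ _ _ mu setT) => //.
exact: integrable_normal_pdf.
Qed.

Lemma std_normal_cdf_ge0 x : 0 <= Phi x.
Proof. by rewrite -lee_fin PhiE cdf_ge0. Qed.

Lemma std_normal_cdf_le1 x : Phi x <= 1.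
Proof. by rewrite -lee_fin PhiE cdf_le1. Qed.

Lemma std_normal_cdf_nd : {homo Phi : x y / x <= y}.
Proof. by move=> x y xy; rewrite -lee_fin !PhiE; exact: cdf_nondecreasing. Qed.

Lemma cvg_std_normal_cdfy : Phi x @[x --> +oo] --> (1 : R).
Proof.
have := @cvg_cdfy1 _ _ _ _ idRV.
rewrite (_ : cdf idRV = EFin \o Phi); last by apply/funext => x; rewrite -PhiE.
by move=> /fine_cvg.
Qed.

Lemma cvg_std_normal_cdfNy : Phi x @[x --> -oo] --> (0 : R).
Proof.
have := @cvg_cdfNy0 _ _ _ _ idRV.
rewrite (_ : cdf idRV = EFin \o Phi); last by apply/funext => x; rewrite -PhiE.
by move=> /fine_cvg.
Qed.

Lemma continuous_std_normal_cdf : continuous Phi.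
Proof.
move=> x; have [dx _] := is_derive_std_normal_cdf x.
by apply/differentiable_continuous/derivable1_diffP.
Qed.

Lemma std_normal_cdfN (x : R) : Phi x + Phi (- x) = 1.
Proof.
have phiN y : phi (- y) = phi y by rewrite /std_normal_pdf sqrrN.
pose F x := Phi x + Phi (- x).
have dF (y : R) : is_derive y 1 F 0.
  have hN : is_derive y 1 (fun y : R => - y) (- 1) by exact: is_deriveN.
  have h := is_derive_addf (is_derive_std_normal_cdf y)
    (is_derive1_comp (is_derive_std_normal_cdf (- y)) hN).
  by apply: (is_derive_eq h); rewrite phiN mulrN1 subrr.
have Fy : F x @[x --> +oo] --> (1 + 0 : R).
  apply: cvgD; first exact: cvg_std_normal_cdfy.
  by have /cvgNy_compNP := cvg_std_normal_cdfNy.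
have Fc : F y @[y --> +oo] --> F x.
  rewrite (_ : F = cst (F x)); first exact: cvg_cst.
  by apply/funext => y; exact: is_derive_0_is_cst.
by have := cvg_unique _ Fc Fy; rewrite addr0; apply.
Qed.

Lemma std_normal_cdf0 : Phi 0 = 2^-1.
Proof. by have := std_normal_cdfN 0; rewrite oppr0; lra. Qed.

End normal_cdf.

(** * Sine and cosine integrals against Gaussian factors *)

Section gauss_transform.
Context {R : realType}.
Local Notation mu := (@lebesgue_measure R).
Local Notation D := (`]0, +oo[%classic : set R).
Local Notation Phi := (@std_normal_cdf R).
Local Notation phi := (@std_normal_pdf R).

Lemma integrable_oneDsqrV : mu.-integrable D (fun t => ((1 + t ^+ 2)^-1)%:E).
Proof.
have p (t : R) : 0 <= (1 + t ^+ 2)^-1 by rewrite invr_ge0 addr_ge0 ?sqr_ge0.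
have i0 : mu.-integrable `[0, +oo[ (fun t => ((1 + t ^+ 2)^-1)%:E).
  apply/integrableP; split.
    apply: measurable_funTS; apply/measurable_EFinP; apply: continuous_measurable_fun.
    exact: continuous_oneDsqrV.
  under eq_integral do rewrite gee0_abs ?lee_fin //.
  by have := @integral0y_oneDsqr R; rewrite /oneDsqr => ->; exact: ltry.
apply: (@integrableS _ _ _ mu `[0, +oo[ D) => // x /=.
by rewrite !in_itv /= !andbT; exact: ltW.
Qed.

(** The characteristic function of a centred normal law of variance e^2. It occurs in two roles: e =
    1 is the limit law, and e tending to 0 is the smoothing. *)
Definition gauss_scaled (e t : R) := expR (- ((e * t) ^+ 2 / 2)).
Local Notation Gs := gauss_scaled.

Lemma gauss_scaled_ge0 e t : 0 <= Gs e t. Proof. exact: expR_ge0. Qed.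

Lemma gauss_scaled_le1 e t : Gs e t <= 1.
Proof. by rewrite -[leRHS]expR0 ler_expR oppr_le0 divr_ge0 ?sqr_ge0. Qed.

Lemma is_derive_gauss_scaled (e t : R) : is_derive t 1 (Gs e) (- (e ^+ 2 * t * Gs e t)).
Proof.
have h1 := is_derive_scale (is_derive_expr (is_derive_scale_id e t) 2) (- 2^-1).
have h2 := is_derive_expR_comp h1.
rewrite (_ : Gs e = fun y => expR (- 2^-1 * (e * y) ^+ 2)); last first.
  by apply/funext => y; rewrite /Gs mulNr mulrC.
by apply: (is_derive_eq h2); rewrite expr1; field.
Qed.

Lemma continuous_gauss_scaled e : continuous (Gs e).
Proof.
move=> t; have [dt _] := is_derive_gauss_scaled e t.
by apply/differentiable_continuous/derivable1_diffP.
Qed.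

Lemma ge_expR_term m (x : R) : 0 <= x -> m`!%:R^-1 * x ^+ m <= expR x.
Proof.
move=> x0; have := @texp_le_expR R m.+1 x x0; rewrite big_ord_recr /=.
apply: le_trans; rewrite lerDr sumr_ge0 // => i _.
by rewrite mulr_ge0 ?invr_ge0 // exprn_ge0.
Qed.

Lemma gauss_scaled_moment e m t : 0 < e ->
  t ^+ (2 * m) * Gs e t <= m`!%:R * (2 / e ^+ 2) ^+ m.
Proof.
move=> e0; rewrite /Gs expRN ler_pdivrMr ?expR_gt0 //.
have h := @ge_expR_term m ((e * t) ^+ 2 / 2) (divr_ge0 (sqr_ge0 _) (ler0n _ 2)).
have c0 : 0 <= m`!%:R * (2 / e ^+ 2) ^+ m.
  by rewrite mulr_ge0 // exprn_ge0 // divr_ge0 ?sqr_ge0.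
apply: le_trans (ler_wpM2l c0 h); rewrite mulrACA mulfV ?pnatr_eq0 -?lt0n ?fact_gt0 // mul1r.
rewrite -exprMn exprM; have -> // : 2 / e ^+ 2 * ((e * t) ^+ 2 / 2) = t ^+ 2.
by field; rewrite gt_eqF.
Qed.

Lemma gauss_scaled_integrable e k : 0 < e -> mu.-integrable D (fun t => (t ^+ k * Gs e t)%:E).
Proof.
move=> e0; pose c m := m`!%:R * (2 / e ^+ 2) ^+ m.
(* The four summands bound the four even moments obtained by expanding (1 + t^(2k)) (1 + t^2), the
   first factor being there to dominate t^k. *)
pose C := c 0%N + c 1%N + (c k + c k.+1).
apply: (@le_integrable _ _ _ mu D _ _ (fun t => (C * (1 + t ^+ 2)^-1)%:E)) => //.
- apply: measurable_funTS; apply/measurable_EFinP; apply: continuous_measurable_fun => t.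
  by apply: cvgM; [exact: exprn_continuous|exact: continuous_gauss_scaled].
- move=> t /=; rewrite in_itv /= andbT => t0.
  have p : 0 < 1 + t ^+ 2 by rewrite ltr_pwDl // sqr_ge0.
  rewrite lee_fin ger0_norm; last by rewrite mulr_ge0 ?gauss_scaled_ge0 // exprn_ge0 // ltW.
  rewrite (le_trans _ (ler_norm _)) // ler_pdivlMr //.
  have tk : t ^+ k <= 1 + t ^+ (2 * k).
    case: (leP t 1) => t1.
      apply: (@le_trans _ _ 1); first by rewrite exprn_ile1 // ltW.
      by rewrite lerDl exprn_ge0 // ltW.
    by rewrite (@le_trans _ _ (t ^+ (2 * k))) ?lerDr // ler_eXn2l // mul2n -addnn leq_addr.
  have h m : t ^+ (2 * m) * Gs e t <= c m by exact: gauss_scaled_moment.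
  have := lerD (lerD (h 0%N) (h 1%N)) (lerD (h k) (h k.+1)).
  apply: le_trans; have G0 := gauss_scaled_ge0 e t.
  have -> : t ^+ (2 * 0) * Gs e t + t ^+ (2 * 1) * Gs e t +
      (t ^+ (2 * k) * Gs e t + t ^+ (2 * k.+1) * Gs e t) =
      (1 + t ^+ (2 * k)) * (1 + t ^+ 2) * Gs e t.
    by rewrite muln0 muln1 mulnS exprD expr0; ring.
  by rewrite mulrAC ler_wpM2r // ler_wpM2r // ltW.
- by apply: integrableZ_EFin => //; exact: integrable_oneDsqrV.
Qed.

(* [osc j y] is [- 'Im ('i ^+ j * exp (- 'i y))]. *)
Fixpoint osc (j : nat) (y : R) : R :=
  match j with 0 => sin y | 1 => - cos y | j'.+2 => - osc j' y end.

Lemma nat_ind2 (Q : nat -> Prop) : Q 0%N -> Q 1%N -> (forall j, Q j -> Q j.+2) ->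
  forall j, Q j.
Proof.
move=> Q0 Q1 QS j; suff [] : Q j /\ Q j.+1 by [].
by elim: j => [//|j [q0 q1]]; split => //; exact: QS.
Qed.

Lemma normr_osc j y : `|osc j y| <= 1.
Proof.
elim/nat_ind2: j y => [|| j ih] y /=; first exact: sin_max.
  by rewrite normrN cos_max.
by rewrite normrN.
Qed.

Lemma is_derive_osc j (y : R) : is_derive y 1 (osc j) (- osc j.+1 y).
Proof.
elim/nat_ind2: j y => [|| j ih] y.
- by apply: (is_derive_eq (is_derive_sin y)); rewrite /= opprK.
- exact: (is_deriveN (is_derive_cos y)).
- exact: (is_deriveN (ih y)).
Qed.

Lemma continuous_osc j : continuous (osc j).
Proof.
move=> t; have [dt _] := is_derive_osc j t.
by apply/differentiable_continuous/derivable1_diffP.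
Qed.

Lemma normr_sin_le (y : R) : `|sin y| <= `|y|.
Proof.
wlog y0 : y / 0 <= y.
  move=> h; case: (leP 0 y) => [/h//|yn]; rewrite -normrN -sinN -[leRHS]normrN.
  by apply: h; rewrite oppr_ge0 ltW.
rewrite [leRHS]ger0_norm // ler_norml; apply/andP; split.
  have := @derive_ge0_le R (fun y => sin y + y) (fun y => cos y + 1) 0 y y0.
  rewrite sin0 addr0 -subr_ge0 subr0 -[- y <= _]subr_ge0 opprK; apply.
  by move=> u _; rewrite -lerBlDr sub0r cos_geN1.
have := @derive_ge0_le R (fun y => y - sin y) (fun y => 1 - cos y) 0 y y0.
rewrite sin0 subr0 subr_ge0; apply.
by move=> u _; rewrite subr_ge0 cos_le1.
Qed.

(** Up to the sign (-1)^j, the j-th derivative in x of sin (tx) / t. Writing t^j / t keeps the case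
    j = 0 in the same formula. *)
Definition fourier_kernel j (x t : R) := t ^+ j / t * osc j (t * x).
Local Notation fker := fourier_kernel.

Lemma fourier_kernel_le j (x t : R) : 0 < t -> `|fker j.+1 x t| <= t ^+ j.
Proof.
move=> t0; rewrite /fker exprSr mulfK ?gt_eqF // normrM.
have tj : 0 <= t ^+ j by rewrite exprn_ge0 // ltW.
by rewrite ger0_norm // ler_piMr // normr_osc.
Qed.

Lemma fourier_kernel0_le (x t : R) : 0 < t -> `|fker 0 x t| <= `|x|.
Proof.
move=> t0; rewrite /fker expr0 mul1r normrM gtr0_norm ?invr_gt0 //.
rewrite mulrC ler_pdivrMr // (le_trans (normr_sin_le _)) // normrM mulrC.
by rewrite (gtr0_norm t0).
Qed.

Lemma normr_fourier_kernel j (x t : R) : 0 < t -> `|fker j x t| <= `|x| + t ^+ j.-1.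
Proof.
move=> t0; case: j => [|j]; first by rewrite (le_trans (fourier_kernel0_le _ _)) // lerDl.
by rewrite (le_trans (fourier_kernel_le _ _ _)) // lerDr.
Qed.

Lemma continuous_fourier_kernel j (x t : R) : 0 < t -> {for t, continuous (fker j x)}.
Proof.
move=> t0; have c1 : {for t, continuous (fun u : R => osc j (u * x))}.
  apply: (@continuous_comp _ _ _ (fun u : R => u * x) (osc j)); last exact: continuous_osc.
  by apply: cvgMl; exact: cvg_id.
apply: cvgM; last exact: c1.
apply: cvgM; first exact: exprn_continuous.
by apply: cvgV; [rewrite gt_eqF|exact: cvg_id].
Qed.

Lemma measurable_fourier_kernel j x : measurable_fun D (fker j x).
Proof.
apply: open_continuous_measurable_fun => //.
by move=> t; rewrite inE /= in_itv /= andbT; exact: continuous_fourier_kernel.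
Qed.

Lemma is_derive_fourier_kernel j (x t : R) : 0 < t ->
  is_derive x 1 (fker j ^~ t) (- fker j.+1 x t).
Proof.
move=> t0; have h := is_derive1_comp (is_derive_osc j (t * x)) (is_derive_scale_id t x).
apply: (is_derive_eq (is_derive_scale h (t ^+ j / t))).
by rewrite /fker exprS; field; rewrite gt_eqF.
Qed.

Definition gauss_term j e x := \int[mu]_(t in D) (fker j x t * Gs e t).
Local Notation gterm := gauss_term.

Lemma gauss_term_integrable j e x : 0 < e ->
  mu.-integrable D (fun t => (fker j x t * Gs e t)%:E).
Proof.
move=> e0.
apply: (@le_integrable _ _ _ mu D _ _
  (fun t => (`|x| * (t ^+ 0 * Gs e t))%:E + (t ^+ j.-1 * Gs e t)%:E)%E) => //.
- apply/measurable_EFinP; apply: measurable_funM; first exact: measurable_fourier_kernel.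
  by apply: measurable_funTS; apply: continuous_measurable_fun; exact: continuous_gauss_scaled.
- move=> t /=; rewrite in_itv /= andbT => t0; have G0 := gauss_scaled_ge0 e t.
  rewrite lee_fin normrM (ger0_norm G0) expr0 mul1r -mulrDl (le_trans _ (ler_norm _)) //.
  by rewrite ler_wpM2r // normr_fourier_kernel.
- apply: integrableD => //; last exact: gauss_scaled_integrable.
  by apply: integrableZ_EFin => //; exact: gauss_scaled_integrable.
Qed.

Lemma is_derive_gauss_term j e (x : R) : 0 < e ->
  is_derive x 1 (gterm j e) (- gterm j.+1 e x).
Proof.
move=> e0.
have -> : - gterm j.+1 e x = \int[mu]_(t in D) (- fker j.+1 x t * Gs e t).
  rewrite /gterm -mulN1r -RintegralZl //; last exact: gauss_term_integrable.
  by apply: eq_Rintegral => t _; rewrite mulN1r mulNr.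
apply: (@is_derive_under_integral _ _ _ mu D (fun x t => fker j x t * Gs e t)
  (fun x t => - fker j.+1 x t * Gs e t) (fun t => t ^+ j * Gs e t)) => //.
- by move=> y; exact: gauss_term_integrable.
- move=> y t /=; rewrite in_itv /= andbT => t0.
  have h := is_derive_fourier_kernel j y t0.
  rewrite (_ : (fun y => _) = fun y => Gs e t * fker j y t); last first.
    by apply/funext => z; rewrite mulrC.
  by apply: (is_derive_eq (is_derive_scale h (Gs e t))); rewrite mulrC.
- exact: gauss_scaled_integrable.
- move=> y t /=; rewrite in_itv /= andbT => t0.
  rewrite normrM normrN (ger0_norm (gauss_scaled_ge0 _ _)) ler_wpM2r ?gauss_scaled_ge0 //.
  exact: fourier_kernel_le.
Qed.

Lemma cvg_gauss_scaled e : 0 < e -> Gs e t @[t --> +oo] --> 0.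
Proof.
move=> e0; apply/cvgr0Pnorm_le => d d0; near=> t.
have t1 : 1 <= t by near: t; exact: nbhs_pinfty_ge.
have h := gauss_scaled_moment 1 t e0.
rewrite ger0_norm ?gauss_scaled_ge0 //.
have t2 : t <= t ^+ (2 * 1) by rewrite muln1 expr2 ler_peMl // (le_trans ler01).
have {}h := le_trans (ler_wpM2r (gauss_scaled_ge0 e t) t2) h.
have t0 : 0 < t by exact: lt_le_trans t1.
rewrite -(ler_pM2l t0) (le_trans h) // -ler_pdivrMr //.
Unshelve. all: by end_near. Qed.

(** Integrate the t-derivative of sin (tx) times the Gaussian factor, which vanishes at both ends.
    As [gterm 2] is minus the derivative of [gterm 1], this is a first-order linear equation for
    [gterm 1]. *)
Lemma gauss_term_ode e x : 0 < e -> e ^+ 2 * gterm 2 e x = x * gterm 1 e x.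
Proof.
move=> e0; apply/eqP; rewrite -subr_eq0; apply/eqP.
have i1 := gauss_term_integrable 1 x e0; have i2 := gauss_term_integrable 2 x e0.
have j1 : mu.-integrable D (fun t => (x * (fker 1 x t * Gs e t))%:E) by exact: integrableZ_EFin.
have j2 : mu.-integrable D (fun t => (e ^+ 2 * (fker 2 x t * Gs e t))%:E) by exact: integrableZ_EFin.
rewrite /gterm -!RintegralZl // -RintegralB //.
rewrite (@eq_Rintegral _ _ _ mu D (fun t => x * cos (t * x) * Gs e t -
    e ^+ 2 * t * sin (t * x) * Gs e t)); last first.
  move=> t; rewrite inE /= in_itv /= andbT => t0.
  by rewrite /fker /=; field; rewrite gt_eqF.
have mulx (t : R) : is_derive t 1 (fun t => t * x) x.
  rewrite (_ : (fun t => _) = fun t => x * t); first exact: is_derive_scale_id.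
  by apply/funext => y; rewrite mulrC.
transitivity (0 - 0 : R); last by rewrite subrr.
apply: (@Rintegral_FTC_Ioy _ _ (fun t => sin (t * x) * Gs e t) 0 0 0).
- move=> t t0.
  have h := is_derive_mulf (is_derive_sin_comp (mulx t)) (is_derive_gauss_scaled e t).
  by apply: (is_derive_eq h); ring.
- move=> t t0; have cm : {for t, continuous (fun u : R => u * x)}.
    by apply: cvgMl; exact: cvg_id.
  have c1 : {for t, continuous (fun u : R => cos (u * x))}.
    by apply: (@continuous_comp _ _ _ (fun u : R => u * x)) => //; exact: continuous_cos.
  have c2 : {for t, continuous (fun u : R => sin (u * x))}.
    by apply: (@continuous_comp _ _ _ (fun u : R => u * x)) => //; exact: continuous_sin.
  apply: cvgB; (apply: cvgM; last exact: continuous_gauss_scaled).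
    by apply: cvgMr; exact: c1.
  by apply: cvgM; [apply: cvgMr; exact: cvg_id|exact: c2].
- apply: (@eq_integrable _ _ _ mu D _ (fun t => (e ^+ 2 * (fker 2 x t * Gs e t))%:E -
    (x * (fker 1 x t * Gs e t))%:E)%E) => //; last exact: integrableB.
  move=> t; rewrite inE /= in_itv /= andbT => t0.
  by rewrite -EFinB /fker /=; congr (_%:E); field; rewrite gt_eqF.
- apply: cvg_at_right_filter.
  suff : sin (t * x) * Gs e t @[t --> (0 : R)] --> sin (0 * x) * Gs e 0.
    by rewrite mul0r sin0 mul0r.
  apply: cvgM; last exact: continuous_gauss_scaled.
  apply: (@continuous_comp _ _ _ (fun u : R => u * x)); last exact: continuous_sin.
  by apply: cvgMl; exact: cvg_id.
- apply/norm_cvg0P; apply: (@squeeze_cvgr _ _ _ _ (cst 0) (Gs e)).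
  + apply: nearW => t; rewrite normr_ge0 /= normrM (ger0_norm (gauss_scaled_ge0 e t)).
    by rewrite ler_piMl ?gauss_scaled_ge0 // sin_max.
  + exact: cvg_cst.
  + exact: cvg_gauss_scaled.
Qed.

Let s2pi : R := Num.sqrt (pi *+ 2).
Let s2pi_gt0 : 0 < s2pi. Proof. by rewrite sqrtr_gt0 mulrn_wgt0 // pi_gt0. Qed.
Let s2pi_sqr : s2pi ^+ 2 = 2 * pi.
Proof. by rewrite /s2pi sqr_sqrtr; [rewrite mulr_natl|apply: mulrn_wge0; exact: pi_ge0]. Qed.

Lemma gauss_scaledE e t : Gs e t = s2pi * phi (e * t).
Proof. by rewrite /std_normal_pdf mulrC divfK ?gt_eqF // /Gs mulNr. Qed.

Lemma gauss_scaled_integral e : 0 < e -> \int[mu]_(t in D) Gs e t = s2pi / (2 * e).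
Proof.
move=> e0; have -> : s2pi / (2 * e) = s2pi / e * 1 - s2pi / e * Phi 0.
  by rewrite std_normal_cdf0; field; rewrite gt_eqF.
apply: (@Rintegral_FTC_Ioy _ _ (fun t => s2pi / e * Phi (e * t)) 0).
- move=> t t0.
  have h := is_derive1_comp (is_derive_std_normal_cdf (e * t)) (is_derive_scale_id e t).
  apply: (is_derive_eq (is_derive_scale h (s2pi / e))).
  by rewrite gauss_scaledE; field; rewrite gt_eqF.
- by move=> t _; exact: continuous_gauss_scaled.
- apply: (@eq_integrable _ _ _ mu D _ (fun t => (t ^+ 0 * Gs e t)%:E)) => //.
    by move=> t _; rewrite expr0 mul1r.
  exact: gauss_scaled_integrable.
- apply: cvg_at_right_filter; apply: cvgMr.
  rewrite -[X in _ --> Phi X](mulr0 e).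
  apply: (@continuous_comp _ _ _ (fun u : R => e * u)); last exact: continuous_std_normal_cdf.
  by apply: cvgMr; exact: cvg_id.
- apply: cvgMr; apply: (@cvg_comp _ _ _ (fun t => e * t) Phi); last exact: cvg_std_normal_cdfy.
  by apply: gt0_cvgMry => //; exact: cvg_id.
Qed.

(** By [gauss_term_ode] the product with exp (x^2 / (2 e^2)) is constant; at x = 0 it is minus the
    Gaussian integral over the half-line. *)
Lemma gauss_term1E e x : 0 < e -> gterm 1 e x = - (pi / e * phi (e^-1 * x)).
Proof.
move=> e0.
pose F x := gterm 1 e x * expR ((e^-1 * x) ^+ 2 / 2).
have dF (y : R) : is_derive y 1 F 0.
  have h1 := is_derive_scale (is_derive_expr (is_derive_scale_id e^-1 y) 2) (2^-1).
  have h2 := is_derive_expR_comp h1.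
  rewrite (_ : F = fun x => gterm 1 e x * expR (2^-1 * (e^-1 * x) ^+ 2)); last first.
    by apply/funext => z; rewrite /F [_ / 2]mulrC.
  apply: (is_derive_eq (is_derive_mulf (is_derive_gauss_term 1 y e0) h2)).
  have -> : gterm 2 e y = e ^- 2 * (y * gterm 1 e y).
    by rewrite -gauss_term_ode // mulrA mulVf ?mul1r // sqrf_eq0 gt_eqF.
  by rewrite expr1; field; rewrite gt_eqF.
have F0 : F 0 = - (s2pi / (2 * e)).
  rewrite /F mulr0 expr0n mul0r expR0 mulr1 /gterm -gauss_scaled_integral //.
  have -> : \int[mu]_(t in D) Gs e t = \int[mu]_(t in D) (t ^+ 0 * Gs e t).
    by apply: eq_Rintegral => t _; rewrite expr0 mul1r.
  rewrite -mulN1r -RintegralZl //; last exact: gauss_scaled_integrable.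
  apply: eq_Rintegral => t; rewrite inE /= in_itv /= andbT => t0.
  by rewrite /fker /= mulr0 cos0 expr1 mulfV ?gt_eqF // expr0 !mul1r.
have : F x = - (s2pi / (2 * e)) by rewrite (is_derive_0_is_cst x 0 dF).
move=> /(congr1 (fun z => z * expR (- ((e^-1 * x) ^+ 2 / 2)))).
rewrite /F -[X in X = _ -> _]mulrA expRxMexpNx_1 mulr1 => ->.
rewrite /std_normal_pdf -/s2pi mulNr [- _ ^+ 2 / 2]mulNr; congr (- _).
have -> : pi = s2pi ^+ 2 / 2 by rewrite s2pi_sqr; field.
by field; rewrite !gt_eqF.
Qed.

(** Both sides have the same derivative by [gauss_term1E] and vanish at x = 0. This is the inversion
    formula for a centred normal law of variance e^2, the prototype from which the general one is
    derived. *)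
Lemma gauss_term0E e x : 0 < e -> gterm 0 e x = pi * (Phi (e^-1 * x) - 2^-1).
Proof.
move=> e0; pose F x := gterm 0 e x - pi * Phi (e^-1 * x).
have dF (y : R) : is_derive y 1 F 0.
  have h := is_derive1_comp (is_derive_std_normal_cdf (e^-1 * y)) (is_derive_scale_id e^-1 y).
  apply: (is_derive_eq (is_derive_subf (is_derive_gauss_term 0 y e0) (is_derive_scale h pi))).
  by rewrite gauss_term1E // opprK; field; rewrite gt_eqF.
have F0 : F 0 = - (pi / 2).
  rewrite /F mulr0 std_normal_cdf0 /gterm (@eq_Rintegral _ _ _ mu D (cst 0)).
    by rewrite Rintegral_cst // mul0r sub0r.
  by move=> t _; rewrite /fker /= mulr0 sin0 mulr0 mul0r.
have : F x = - (pi / 2) by rewrite (is_derive_0_is_cst x 0 dF).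
by rewrite /F mulrBr => /eqP; rewrite subr_eq => /eqP ->; rewrite addrC.
Qed.

Let g (y : R) := expR (- (y ^+ 2) / 2).

Lemma gauss_term_derive1n j x :
  gterm j.+1 1 x = - (pi / s2pi) * (-1) ^+ j * (g^`(j))%classic x.
Proof.
have pn : - (pi / s2pi) != 0 by rewrite oppr_eq0 mulf_neq0 ?invr_eq0 ?gt_eqF // pi_gt0.
elim: j x => [|j ih] x.
  rewrite derive1n0 expr0 mulr1 gauss_term1E // /std_normal_pdf -/s2pi invr1 mul1r mulr1.
  by rewrite /g; field; rewrite gt_eqF.
pose c : R := (- (pi / s2pi) * (-1) ^+ j)^-1.
have cn : - (pi / s2pi) * (-1) ^+ j != 0 by rewrite mulf_neq0 // signr_eq0.
have E : (g^`(j))%classic = fun x => c * gterm j.+1 1 x.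
  by apply/funext => y; rewrite ih mulrA /c mulVf // mul1r.
rewrite derive1nS E derive1E.
have [_ ->] := is_derive_scale (is_derive_gauss_term j.+1 x ltr01) c.
by rewrite exprS mulN1r mulrN mulNr [c * _]mulrN mulrN opprK mulrA /c mulfV // mul1r.
Qed.

(** Differentiation in x lowers to the Gaussian itself at index 1, so index j + 1 matches the
    Hermite polynomial of degree j; this shift is the origin of the -1 in zeta. *)
Lemma gauss_term_hermite j x : gterm j.+1 1 x = - (pi * (phi x * hermite j x)).
Proof.
rewrite gauss_term_derive1n /std_normal_pdf -/s2pi /hermite -/g.
have e1 : expR (- (x ^+ 2) / 2) * expR (x ^+ 2 / 2) = 1.
  by rewrite -expRD mulNr addNr expR0.
transitivity (- (pi / s2pi * (-1) ^+ j * (g^`(j))%classic x *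
   (expR (- (x ^+ 2) / 2) * expR (x ^+ 2 / 2)))); last by ring.
by rewrite e1; ring.
Qed.

End gauss_transform.

Section integral_sum.
Context (d : measure_display) (T : measurableType d) (R : realType).
Variables (mu : {measure set T -> \bar R}) (D : set T) (I : Type) (h : I -> T -> R).
Hypotheses (mD : measurable D) (ih : forall i, mu.-integrable D (fun x => (h i x)%:E)).

Lemma integrable_sum_EFin (s : seq I) : mu.-integrable D (fun x => (\sum_(i <- s) h i x)%:E).
Proof.
rewrite (_ : (fun x => _) = fun x => (\sum_(i <- s) (h i x)%:E)%E); last first.
  by apply/funext => x; rewrite sumEFin.
exact: integrable_sum.
Qed.

Lemma Rintegral_sum (s : seq I) :
  \int[mu]_(x in D) (\sum_(i <- s) h i x) = \sum_(i <- s) \int[mu]_(x in D) h i x.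
Proof.
elim: s => [|i s IH].
  rewrite big_nil /Rintegral (eq_integral (cst 0%E)) ?integral0 //.
  by move=> x _; rewrite big_nil.
rewrite big_cons -IH -RintegralD //; [|exact: ih|exact: integrable_sum_EFin].
by apply: eq_Rintegral => x _; rewrite big_cons.
Qed.

End integral_sum.

(** * Fourier inversion *)

Section inversion.
Context {R : realType} (d : measure_display) (T : measurableType d) (P : probability T R).
Variable X : T -> R.
Hypotheses (mX : measurable_fun setT X) (iX : P.-integrable setT (EFin \o X)).
Local Notation mu := (@lebesgue_measure R).
Local Notation D := (`]0, +oo[%classic : set R).
Local Notation Phi := (@std_normal_cdf R).
Local Notation phi := (@std_normal_pdf R).
Local Notation Gs := gauss_scaled.
Local Notation fker := fourier_kernel.
Local Notation gterm := gauss_term.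

Let fc t := \int[P]_v cos (t * X v).
Let fs t := \int[P]_v sin (t * X v).
(** By [sinE] this is the expectation of sin (t (x - X)), the integrand of the Gil-Pelaez inversion
    formula. *)
Let psi x t := sin (t * x) * fc t - cos (t * x) * fs t.

Let mtrig (g : R -> R) (a b : R) : continuous g -> measurable_fun setT (fun v => g (a + b * X v)).
Proof.
move=> cg; apply: measurableT_comp; first exact: continuous_measurable_fun.
by apply: measurable_funD => //; exact: measurable_funM.
Qed.

Let ibounded (g : T -> R) : measurable_fun setT g -> (forall v, `|g v| <= 1) ->
  P.-integrable setT (fun v => (g v)%:E).
Proof.
move=> mg g1; apply: (@le_integrable _ _ _ P _ measurableT _ (cst 1%:E)).
- exact/measurable_EFinP.
- by move=> v _; rewrite /= lee_fin normr1.
- exact: finite_measure_integrable_cst.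
Qed.

Let iXx x : P.-integrable setT (fun v => (x - X v)%:E).
Proof.
have i1 : P.-integrable setT (fun v : T => x%:E) by exact: finite_measure_integrable_cst.
exact: (integrableB measurableT i1 iX).
Qed.

Let sinE x t : \int[P]_v sin (t * (x - X v)) = psi x t.
Proof.
have ic : P.-integrable setT (fun v => (cos (t * X v))%:E).
  apply: ibounded => [|v]; last exact: cos_max.
  by have := mtrig 0 t (@continuous_cos R); under eq_fun do rewrite add0r.
have is_ : P.-integrable setT (fun v => (sin (t * X v))%:E).
  apply: ibounded => [|v]; last exact: sin_max.
  by have := mtrig 0 t (@continuous_sin R); under eq_fun do rewrite add0r.
rewrite /psi /fc /fs -!RintegralZl // -RintegralB //; last 2 first.
- exact: integrableZ_EFin.
- exact: integrableZ_EFin.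
by apply: eq_Rintegral => v _; rewrite mulrBr sinB.
Qed.

Section fubini.
Variables (x e : R).
Hypothesis e0 : 0 < e.

(** The integrand for Fubini, made total on the product: the indicator restricts to t > 0, and 1 / t
    is written as a real power, whose measurability holds on the whole line. *)
Let f (z : T * measurableTypeR R) : R :=
  (z.2 : R) `^ (-1) * sin ((z.2 : R) * (x - X z.1)) * Gs e z.2 * \1_D z.2.

Let mf : measurable_fun setT f.
Proof.
have m1 : measurable_fun setT (fun z : T * measurableTypeR R => X z.1).
  by apply: measurableT_comp => //; exact: measurable_fst.
have m2 : measurable_fun setT (fun z : T * measurableTypeR R => (z.2 : R)).
  exact: measurable_snd.
apply: measurable_funM; last first.
  by apply: (@measurableT_comp _ _ _ _ _ _ (\1_D : measurableTypeR R -> R)) => //; exact: measurable_indic.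
apply: measurable_funM; last first.
  apply: (@measurableT_comp _ _ _ _ _ _ (Gs e : measurableTypeR R -> R)) => //.
  by apply: continuous_measurable_fun; exact: continuous_gauss_scaled.
apply: measurable_funM.
  by apply: (@measurableT_comp _ _ _ _ _ _ (fun u : measurableTypeR R => u `^ (-1))) => //; exact: measurable_powR.
apply: measurableT_comp; first by apply: continuous_measurable_fun; exact: continuous_sin.
by apply: measurable_funM => //; exact: measurable_funB.
Qed.

Let fE v t : f (v, t) = ((fun t => fker 0 (x - X v) t * Gs e t) \_ D) t.
Proof.
rewrite /f /= patchE indicE; case: ifPn => tD; last by rewrite mulr0.
rewrite mulr1 /fker expr0 mul1r powR_inv1 //.
by move: tD; rewrite inE /= in_itv /= andbT; exact: ltW.
Qed.

Let K := \int[mu]_(t in D) (t ^+ 0 * Gs e t).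

Let iG := @gauss_scaled_integrable R e 0 e0.

Let f_abs v : (\int[mu]_t `|(f (v, t))%:E| <= (`|x - X v| * K)%:E)%E.
Proof.
have -> : (\int[mu]_t `|(f (v, t))%:E| = \int[mu]_(t in D) `|(fker 0 (x - X v) t * Gs e t)%:E|)%E.
  rewrite [RHS]integral_mkcond; apply: eq_integral => t _.
  by rewrite fE /patch; case: ifPn => // _; exact: abse0.
have -> : (`|x - X v| * K)%:E = (\int[mu]_(t in D) (`|x - X v| * (t ^+ 0 * Gs e t))%:E)%E.
  rewrite /K -RintegralZl // /Rintegral fineK //.
  by apply: integrable_fin_num => //; exact: integrableZ_EFin.
have ig := gauss_term_integrable 0 (x - X v) e0.
apply: ge0_le_integral => //.
- by apply: measurableT_comp => //; have /measurable_int := ig.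
- have iA : mu.-integrable D (fun t => (`|x - X v| * (t ^+ 0 * Gs e t))%:E).
    exact: integrableZ_EFin.
  by have /measurable_int := iA.
- move=> t /=; rewrite in_itv /= andbT => t0; rewrite lee_fin normrM expr0 mul1r.
  by rewrite (ger0_norm (gauss_scaled_ge0 _ _)) ler_wpM2r ?gauss_scaled_ge0 // fourier_kernel0_le.
Qed.

Let if12 : (P \x mu)%E.-integrable setT (EFin \o f).
Proof.
apply/(@integrable12ltyP _ _ T (measurableTypeR R) R P mu (EFin \o f)).
  exact/measurable_EFinP.
apply: (@le_lt_trans _ _ (\int[P]_v (K * `|x - X v|)%:E)%E); last first.
  have := integrableZ_EFin K measurableT (integrable_abse (iXx x)).
  by move=> /integrable_fin_num => /(_ measurableT); rewrite fin_numE -ltey => /andP[].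
apply: ge0_le_integral => //.
- by move=> v _; exact: integral_ge0.
- apply: (@measurable_fun_fubini_tonelli_F _ _ T (measurableTypeR R) R mu (fun z => `|(f z)%:E|%E)) => //.
  by apply: measurableT_comp => //; exact/measurable_EFinP.
- by have /measurable_int := integrableZ_EFin K measurableT (integrable_abse (iXx x)).
- by move=> v _; rewrite [K * _]mulrC; exact: f_abs.
Qed.

Let GE t : (\int[P]_v (f (v, t))%:E = ((fun t => (psi x t / t * Gs e t)%:E) \_ D) t)%E.
Proof.
rewrite patchE; case: ifPn => tD; last first.
  rewrite (eq_integral (cst 0%E)) ?integral0 // => v _.
  by rewrite fE patchE (negbTE tD).
transitivity (\int[P]_v ((Gs e t / t) * sin (t * (x - X v)))%:E)%E.
  by apply: eq_integral => v _; rewrite fE patchE tD /fker expr0 mul1r [in RHS]mulrC mulrA [in RHS]mulrAC [_^-1 * _]mulrC.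
have is_ : P.-integrable setT (fun v => (sin (t * (x - X v)))%:E).
  apply: ibounded => [|v]; last exact: sin_max.
  have := mtrig (t * x) (- t) (@continuous_sin R).
  by under eq_fun do rewrite mulNr -mulrBr.
rewrite -[LHS]fineK; last by apply: integrable_fin_num => //; exact: integrableZ_EFin.
by rewrite -/(Rintegral _ _ _) RintegralZl // sinE mulrC [Gs e t / t]mulrC mulrA.
Qed.

(** Fubini applies because |sin (t (x - X)) / t| <= |x - X| is integrable for P, while the Gaussian
    factor is integrable in t. *)
Lemma smoothing_fourier :
  mu.-integrable D (fun t => (psi x t / t * Gs e t)%:E) /\
  \int[P]_v gterm 0 e (x - X v) = \int[mu]_(t in D) (psi x t / t * Gs e t).
Proof.
split.
  have iabs : P.-integrable setT (fun v => `|x - X v|%:E) by exact: integrable_abse (iXx x).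
  apply: (@le_integrable _ _ _ mu D _ _
    (fun t => (\int[P]_v `|x - X v| * (t ^+ 0 * Gs e t))%:E)) => //.
  - have := @measurable_fubini_G _ _ T (measurableTypeR R) R P mu _ if12.
    have EG : fubini_G P (EFin \o f) = (fun t => (psi x t / t * Gs e t)%:E) \_ D.
      by apply/funext => t; exact: GE.
    rewrite EG.
    by move=> h; apply/(measurable_restrictT _ _).
  - move=> t /=; rewrite in_itv /= andbT => t0; have G0 := gauss_scaled_ge0 e t.
    rewrite lee_fin (le_trans _ (ler_norm _)) // expr0 mul1r normrM (ger0_norm G0) ler_wpM2r //.
    have ms : measurable_fun setT (fun v => sin (t * (x - X v))).
      have := mtrig (t * x) (- t) (@continuous_sin R).
      by under eq_fun do rewrite mulNr -mulrBr.
    have is_ : P.-integrable setT (fun v => (sin (t * (x - X v)))%:E).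
      by apply: ibounded => // v; exact: sin_max.
    rewrite mulrC -sinE -RintegralZl //.
    have ik : P.-integrable setT (fun v => (t^-1 * sin (t * (x - X v)))%:E).
      exact: integrableZ_EFin.
    apply: (le_trans (le_normr_Rintegral measurableT ik)).
    apply: le_Rintegral => //; first exact: (integrable_abse ik).
    move=> v _; have := fourier_kernel0_le (x - X v) t0.
    by rewrite /fourier_kernel expr0 mul1r.
  - exact: integrableZ_EFin.
have := @Fubini _ _ T (measurableTypeR R) R P mu _ if12.
rewrite (eq_integral (fun v => (gterm 0 e (x - X v))%:E)); last first.
  move=> v _; have ig := gauss_term_integrable 0 (x - X v) e0.
  rewrite /gterm /Rintegral fineK; last exact: integrable_fin_num.
  rewrite [RHS]integral_mkcond; apply: eq_integral => t _.
  by rewrite /= fE /patch; case: ifPn.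
have EG : (\int[mu]_t \int[P]_v (f (v, t))%:E = \int[mu]_(t in D) (psi x t / t * Gs e t)%:E)%E.
  by rewrite [RHS]integral_mkcond; apply: eq_integral => t _; exact: GE.
by move=> h; rewrite /Rintegral h EG.
Qed.

End fubini.

Lemma smoothing_cdf x e : 0 < e ->
  \int[P]_v Phi (e^-1 * (x - X v)) = 2^-1 + pi^-1 * \int[mu]_(t in D) (psi x t / t * Gs e t).
Proof.
move=> e0; have [_ <-] := smoothing_fourier x e0.
have iPhi : P.-integrable setT (fun v => (Phi (e^-1 * (x - X v)))%:E).
  apply: ibounded => [|v]; last by rewrite ger0_norm ?std_normal_cdf_ge0 // std_normal_cdf_le1.
  have := mtrig (e^-1 * x) (- e^-1) (@continuous_std_normal_cdf R).
  by under eq_fun do rewrite mulNr -mulrBr.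
have ih : P.-integrable setT (fun v : T => (2^-1 : R)%:E) by exact: finite_measure_integrable_cst.
have -> : \int[P]_v gterm 0 e (x - X v) = \int[P]_v (pi * (Phi (e^-1 * (x - X v)) - 2^-1)).
  by apply: eq_Rintegral => v _; rewrite gauss_term0E.
have P1 : fine (P setT) = 1 by rewrite probability_setT.
rewrite RintegralZl //; last exact: (integrableB measurableT iPhi ih).
rewrite mulrA mulVf ?mul1r; last by rewrite gt_eqF // pi_gt0.
by rewrite RintegralB // Rintegral_cst // P1 mulr1 addrC subrK.
Qed.

(** Moving the smoothed function by b to the right or, in [smoothing_cdf_le], to the left turns it
    into a one-sided bound for the distribution function; for fixed b the correction by Phi
    disappears as e tends to 0. *)
Lemma smoothing_cdf_ge x e (b : R) : 0 < e -> 0 < b ->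
  fine (P [set v | X v <= x]) * Phi (e^-1 * b) <= \int[P]_v Phi (e^-1 * (x + b - X v)).
Proof.
move=> e0 b0; set A := [set v | _].
have mA : measurable A.
  by rewrite (_ : A = X @^-1` `]-oo, x]) // -[X @^-1` _]setTI; exact: mX.
have iPhi : P.-integrable setT (fun v => (Phi (e^-1 * (x + b - X v)))%:E).
  apply: ibounded => [|v]; last by rewrite ger0_norm ?std_normal_cdf_ge0 // std_normal_cdf_le1.
  have := mtrig (e^-1 * (x + b)) (- e^-1) (@continuous_std_normal_cdf R).
  by under eq_fun do rewrite mulNr -mulrBr.
have i1 : P.-integrable setT (EFin \o (\1_A : T -> R)).
  apply: ibounded => [|v]; first exact: measurable_indic.
  by rewrite indicE; case: (_ \in _); rewrite ?normr1 ?normr0.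
have -> : fine (P A) * Phi (e^-1 * b) = \int[P]_v (Phi (e^-1 * b) * \1_A v).
  by rewrite RintegralZl // /Rintegral integral_indic // setIT mulrC.
apply: le_Rintegral => //; first exact: integrableZ_EFin.
move=> v _; rewrite indicE; case: (boolP (v \in A)) => vA; last first.
  by rewrite mulr0 std_normal_cdf_ge0.
rewrite mulr1 std_normal_cdf_nd // ler_pM2l ?invr_gt0 //.
by move: vA; rewrite inE /A /= => vA; rewrite addrAC lerDr subr_ge0.
Qed.

Lemma smoothing_cdf_le x e (b : R) : 0 < e -> 0 < b ->
  \int[P]_v Phi (e^-1 * (x - b - X v)) <=
  fine (P [set v | X v <= x]) + Phi (- (e^-1 * b)).
Proof.
move=> e0 b0; set A := [set v | _].
have mA : measurable A.
  by rewrite (_ : A = X @^-1` `]-oo, x]) // -[X @^-1` _]setTI; exact: mX.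
have iPhi : P.-integrable setT (fun v => (Phi (e^-1 * (x - b - X v)))%:E).
  apply: ibounded => [|v]; last by rewrite ger0_norm ?std_normal_cdf_ge0 // std_normal_cdf_le1.
  have := mtrig (e^-1 * (x - b)) (- e^-1) (@continuous_std_normal_cdf R).
  by under eq_fun do rewrite mulNr -mulrBr.
have i1 : P.-integrable setT (EFin \o (\1_A : T -> R)).
  apply: ibounded => [|v]; first exact: measurable_indic.
  by rewrite indicE; case: (_ \in _); rewrite ?normr1 ?normr0.
have ic : P.-integrable setT (fun v : T => (Phi (- (e^-1 * b)))%:E).
  exact: finite_measure_integrable_cst.
have P1 : fine (P setT) = 1 by rewrite probability_setT.
have -> : fine (P A) + Phi (- (e^-1 * b)) = \int[P]_v (\1_A v + Phi (- (e^-1 * b))).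
  by rewrite RintegralD // Rintegral_cst // P1 mulr1 /Rintegral integral_indic // setIT.
apply: le_Rintegral => //; first exact: (integrableD measurableT i1 ic).
move=> v _; rewrite indicE; case: (boolP (v \in A)) => vA.
  by rewrite (le_trans (std_normal_cdf_le1 _)) // lerDl std_normal_cdf_ge0.
rewrite add0r std_normal_cdf_nd // -mulrN ler_pM2l ?invr_gt0 //.
move: vA; rewrite notin_setE /A /= => /negP; rewrite -ltNge => vA.
by rewrite addrAC -[leRHS]add0r lerD2r subr_le0 ltW.
Qed.

Section comparison.
Variables (I : finType) (c : I -> R) (m : I -> nat) (B : R).
Hypothesis cfB : forall t, 0 < t ->
  normc ((fc t +i* fs t) - (expR (- (t ^+ 2 / 2)))%:C *
    \sum_k (c k)%:C * (t%:C * 'i) ^+ m k) <= B * (t / (1 + t ^+ 2)).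

Let Im_osc (t y : R) j :
  Im ((cos y -i* sin y) * (t%:C * 'i) ^+ j) = - (t ^+ j * osc j y).
Proof.
elim/nat_ind2: j => [||j ih].
- by rewrite !expr0 mulr1 mul1r.
- by rewrite !expr1 /=; ring.
- have -> : (t%:C * 'i) ^+ j.+2 = (- (t ^+ 2))%:C * (t%:C * 'i) ^+ j.
    rewrite -[j.+2]add2n exprD exprMn sqr_i mulrN1 -rmorphXn /= -rmorphN //.
  rewrite mulrCA Im_realM ih /= -[j.+2]add2n exprD; ring.
Qed.

(** Multiply the difference of transforms by exp (- itx), take the imaginary part and divide by t:
    the bound B t / (1 + t^2) becomes integrable, uniformly in x. *)
Lemma psi_bound x t : 0 < t ->
  `|psi x t / t - \sum_k c k * (fker (m k) x t * Gs 1 t)| <= B * (1 + t ^+ 2)^-1.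
Proof.
move=> t0; have := cfB t0; set q := \sum_k (c k)%:C * (t%:C * 'i) ^+ m k => cfBt.
set u : R[i] := cos (t * x) -i* sin (t * x).
have nu : normc u = 1.
  by apply/eqP; rewrite -(@eqrXn2 _ 2) ?normc_ge0 // normc_sqr /= sqrrN cos2Dsin2 expr1n.
have E : psi x t / t - \sum_k c k * (fker (m k) x t * Gs 1 t) =
    - (Im (u * ((fc t +i* fs t) - (expR (- (t ^+ 2 / 2)))%:C * q)) / t).
  have Q : Im (u * q) = - \sum_k c k * (t ^+ m k * osc (m k) (t * x)).
    rewrite /q mulr_sumr [LHS]raddf_sum /= -sumrN; apply: eq_bigr => k _.
    by rewrite mulrCA Im_realM Im_osc mulrN.
  have S : \sum_k c k * (fker (m k) x t * Gs 1 t) =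
      (\sum_k c k * (t ^+ m k * osc (m k) (t * x))) * (expR (- (t ^+ 2 / 2)) / t).
    rewrite mulr_suml; apply: eq_bigr => k _; rewrite /fker /Gs mul1r.
    by field; rewrite gt_eqF.
  rewrite mulrBr ImB [u * (_%:C * _)]mulrCA Im_realM Q S /psi /=.
  by field; rewrite gt_eqF.
rewrite E normrN normrM [`|t^-1|]gtr0_norm ?invr_gt0 // ler_pdivrMr //.
rewrite (le_trans (normc_Im _)) // normcM nu mul1r.
by rewrite -[leRHS]mulrA [_^-1 * t]mulrC.
Qed.

Let S x t := \sum_k c k * (fker (m k) x t * Gs 1 t).
Let J := \int[mu]_(t in D) (1 + t ^+ 2)^-1.

Let iS x : mu.-integrable D (fun t => (S x t)%:E).
Proof.
apply: (@integrable_sum_EFin _ _ _ mu D I (fun k t => c k * (fker (m k) x t * Gs 1 t))) => // k.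
by apply: integrableZ_EFin => //; exact: gauss_term_integrable.
Qed.

Let iSG x e : mu.-integrable D (fun t => (S x t * Gs e t)%:E).
Proof.
apply: (@le_integrable _ _ _ mu D _ _ (fun t => (S x t)%:E)) => //.
- apply/measurable_EFinP; apply: measurable_funM.
    by apply/measurable_EFinP; have /measurable_int := iS x.
  by apply: measurable_funTS; apply: continuous_measurable_fun; exact: continuous_gauss_scaled.
- move=> t _; rewrite /= lee_fin normrM ler_piMr // ger0_norm ?gauss_scaled_ge0 //.
  exact: gauss_scaled_le1.
Qed.

(** The smoothing factor is at most 1, so the bound does not depend on e; this is what permits e to
    tend to 0 with the law of X fixed. *)
Let smoothing_bound x e : 0 < e ->
  `|\int[P]_v Phi (e^-1 * (x - X v)) - (2^-1 + pi^-1 * \int[mu]_(t in D) (S x t * Gs e t))| <=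
  B * J / pi.
Proof.
move=> e0; rewrite smoothing_cdf // opprD addrACA subrr add0r -mulrBr normrM.
rewrite gtr0_norm ?invr_gt0 ?pi_gt0 // mulrC ler_pM2r ?invr_gt0 ?pi_gt0 //.
have [ip _] := smoothing_fourier x e0; have iSe := iSG x e.
have iB : mu.-integrable D (fun t => (B * (1 + t ^+ 2)^-1)%:E).
  by apply: integrableZ_EFin => //; exact: integrable_oneDsqrV.
rewrite -RintegralB // /J -RintegralZl //; last exact: integrable_oneDsqrV.
have id : mu.-integrable D (EFin \o (fun t => psi x t / t * Gs e t - S x t * Gs e t)).
  by apply: (integrableB _ ip iSe).
apply: (le_trans (le_normr_Rintegral _ id)) => //.
apply: le_Rintegral => //; first exact: (integrable_abse id).
move=> t /=; rewrite in_itv /= andbT => t0.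
rewrite -mulrBl normrM (ger0_norm (gauss_scaled_ge0 _ _)).
apply: le_trans (psi_bound x t0); rewrite ler_piMr //; exact: gauss_scaled_le1.
Qed.

Let G x := \sum_k c k * gterm (m k) 1 x.

Let GE' x : G x = \int[mu]_(t in D) S x t.
Proof.
rewrite /S (@Rintegral_sum _ _ _ mu D I (fun k t => c k * (fker (m k) x t * Gs 1 t))) => //.
  by apply: eq_bigr => k _; rewrite /gterm -RintegralZl //; exact: gauss_term_integrable.
by move=> k; apply: integrableZ_EFin => //; exact: gauss_term_integrable.
Qed.

Let cvg_SG x : \int[mu]_(t in D) (S x t * Gs n.+1%:R^-1 t) @[n --> \oo] --> G x.
Proof.
rewrite GE'; pose f_ n t := (S x t * Gs n.+1%:R^-1 t)%:E.
have mf_ n : measurable_fun D (f_ n) by have /measurable_int := iSG x n.+1%:R^-1.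
have mS : measurable_fun D (fun t => (S x t)%:E) by have /measurable_int := iS x.
have f_f : {ae mu, forall t, D t -> f_ ^~ t @ \oo --> (S x t)%:E}.
  apply: aeW => t _; apply: cvg_EFin; first exact: nearW.
  rewrite -[X in _ --> X]mulr1 /f_ /=; apply: cvgMr.
  have e1 : expR (- ((0 * t * (0 * t)) / 2)) = 1 :> R by rewrite !mul0r oppr0 expR0.
  rewrite -[X in _ --> X]e1 /Gs; under eq_fun do rewrite expr2.
  apply: continuous_cvg; first exact: continuous_expR.
  have ct : n.+1%:R^-1 * t @[n --> \oo] --> 0 * t by apply: cvgMl; exact: cvg_harmonic.
  by apply: cvgN; apply: cvgMl; apply: cvgM.
have f_b : {ae mu, forall t n, D t -> (`|f_ n t| <= `|(S x t)%:E|)%E}.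
  apply: aeW => t n _; rewrite /f_ /= lee_fin normrM ler_piMr // ger0_norm ?gauss_scaled_ge0 //.
  exact: gauss_scaled_le1.
have iabs : mu.-integrable D (fun t => `|(S x t)%:E|%E) by exact: integrable_abse (iS x).
have [||||| _ _ cvgf] := @dominated_convergence _ _ R mu D (measurable_itv _) f_
  (fun t => (S x t)%:E) (fun t => `|(S x t)%:E|%E);
  [exact: mf_|exact: mS|exact: f_f|exact: iabs|exact: f_b|].
apply: (@fine_cvg _ _ _ _ (fun n => (\int[mu]_(t in D) f_ n t)%E)).
by rewrite fineK //; exact: integrable_fin_num.
Qed.

Let continuous_G : continuous G.
Proof.
rewrite /G => x; elim: (index_enum I) => [|k s ih].
  rewrite (_ : (fun x => _) = cst 0); first exact: cvg_cst.
  by apply/funext => y; rewrite big_nil.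
rewrite (_ : (fun x => _) = fun x => c k * gterm (m k) 1 x + \sum_(k <- s) c k * gterm (m k) 1 x);
  last by apply/funext => y; rewrite big_cons.
apply: cvgD; last exact: ih.
apply: cvgMr; have [dt _] := is_derive_gauss_term (m k) x (@ltr01 R).
by apply/differentiable_continuous/derivable1_diffP.
Qed.

(** First e tends to 0 with the shift b fixed, then b tends to 0. The second limit uses continuity
    of the approximating function [G] only, so that X may have atoms. *)
Lemma cdf_comparison x :
  `|fine (P [set v | X v <= x]) - (2^-1 + pi^-1 * G x)| <= B * J / pi.
Proof.
set F := fine _; set K := B * J / pi.
have e0 n : 0 < n.+1%:R^-1 :> R by rewrite invr_gt0.
have cGx y : 2^-1 + pi^-1 * \int[mu]_(t in D) (S y t * Gs n.+1%:R^-1 t) @[n --> \oo] -->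
    2^-1 + pi^-1 * G y.
  by apply: cvgD; [exact: cvg_cst|apply: cvgMr; exact: cvg_SG].
have nby (b : R) : 0 < b -> (n.+1%:R^-1)^-1 * b @[n --> \oo] --> +oo.
  move=> b0; apply/cvgryPge => A; near=> n; rewrite invrK -ler_pdivrMr //.
  rewrite (@le_trans _ _ n%:R) ?ler_nat //; near: n; exact: nbhs_infty_ger.
have up (b : R) : 0 < b -> F <= 2^-1 + pi^-1 * G (x + b) + K.
  move=> b0; rewrite -[F]mulr1.
  apply: (@ler_cvg_to _ \oo _ _ (fun n => F * Phi ((n.+1%:R^-1)^-1 * b))
    (fun n => 2^-1 + pi^-1 * \int[mu]_(t in D) (S (x + b) t * Gs n.+1%:R^-1 t) + K)).
  - by apply: cvgMr; apply: cvg_comp (nby b b0) _; exact: cvg_std_normal_cdfy.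
  - by apply: cvgD; [exact: cGx|exact: cvg_cst].
  - apply: nearW => n; apply: (le_trans (smoothing_cdf_ge x (e0 n) b0)).
    by have := smoothing_bound (x + b) (e0 n); rewrite ler_norml => /andP[_]; rewrite lerBlDr [X in _ <= X -> _]addrC.
have lo (b : R) : 0 < b -> 2^-1 + pi^-1 * G (x - b) - K <= F.
  move=> b0; rewrite -[leRHS]addr0.
  apply: (@ler_cvg_to _ \oo _ _ (fun n => 2^-1 + pi^-1 * \int[mu]_(t in D) (S (x - b) t * Gs n.+1%:R^-1 t) - K)
     (fun n => F + Phi (- ((n.+1%:R^-1)^-1 * b)))).
  - by apply: cvgB; [exact: cGx|exact: cvg_cst].
  - apply: cvgD; first exact: cvg_cst.
    apply: (@cvg_comp _ _ _ _ (fun y => Phi (- y)) _ _ _ (nby b b0)).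
    by have /cvgNy_compNP := @cvg_std_normal_cdfNy R.
  - apply: nearW => n; apply: le_trans (smoothing_cdf_le x (e0 n) b0).
    by have := smoothing_bound (x - b) (e0 n); rewrite ler_norml => /andP[+ _]; rewrite lerBrDr [X in X <= _ -> _]addrC.
have cG (s : R) : 2^-1 + pi^-1 * G (x + s * n.+1%:R^-1) @[n --> \oo] --> 2^-1 + pi^-1 * G x.
  apply: cvgD; first exact: cvg_cst.
  apply: cvgMr; apply: continuous_cvg; first exact: continuous_G.
  rewrite -[X in _ --> X]addr0; apply: cvgD; first exact: cvg_cst.
  by rewrite -[X in _ --> X](mulr0 s); apply: cvgMr; exact: cvg_harmonic.
rewrite ler_norml; apply/andP; split.
- rewrite lerBrDr addrC.
  apply: (@ler_cvg_to _ \oo _ _ (fun n => 2^-1 + pi^-1 * G (x + (-1) * n.+1%:R^-1) - K) (cst F)).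
  + by apply: cvgB; [exact: cG|exact: cvg_cst].
  + exact: cvg_cst.
  + by apply: nearW => n; rewrite mulN1r; exact: lo.
- rewrite lerBlDr addrC.
  apply: (@ler_cvg_to _ \oo _ _ (cst F) (fun n => 2^-1 + pi^-1 * G (x + 1 * n.+1%:R^-1) + K)).
  + exact: cvg_cst.
  + by apply: cvgD; [exact: cG|exact: cvg_cst].
  + by apply: nearW => n; rewrite mul1r; exact: up.
Unshelve. all: by end_near. Qed.

End comparison.

End inversion.

(** * Regularly varying weights *)

Section regular_variation.
Context {R : realType} (gam : R) (l : R -> R) (lam : nat -> R).
Hypotheses (hgam : 1 / 2 < gam) (hl : slowly_varying l).
Hypothesis hlam : forall n, (0 < n)%N -> lam n = l n%:R * n%:R `^ (- gam).
Hypothesis lam_pos : forall n, (0 < n)%N -> 0 < lam n.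
Hypothesis lam_noninc : forall m n, (0 < m)%N -> (m <= n)%N -> lam n <= lam m.

Let cvg_ratio : lam (2 * n)%N / lam n @[n --> \oo] --> 2 `^ (- gam).
Proof.
have [_ /(_ 2 (ltr0Sn _ 1))] := hl.
move=> h2; have hn : l (2 * n%:R) / l n%:R @[n --> \oo] --> (1 : R).
  exact: (@cvg_comp _ _ _ (fun n : nat => n%:R : R) (fun x => l (2 * x) / l x) _ _ _ (@cvgr_idn R) h2).
rewrite -[X in _ --> X]mul1r.
apply: (@cvg_trans _ ((fun n : nat => l (2 * n%:R) / l n%:R * 2 `^ (- gam)) @ \oo)); last first.
  by apply: cvgMl.
apply: near_eq_cvg; near=> n.
have n0 : (0 < n)%N by near: n; exact: nbhs_infty_gt.
have nR : (0 : R) < n%:R by rewrite ltr0n.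
rewrite !hlam ?muln_gt0 // natrM powRM // -mulf_div; congr (_ * _).
by rewrite mulfK // gt_eqF // powR_gt0.
Unshelve. all: by end_near. Qed.

(** Slow variation at the ratio 2 gives lambda_(2n) / lambda_n --> q = 2^(- gamma), and gamma > 1/2
    means 2 q^2 < 1. The midpoint [rho] between 2 q^2 and 1, and q / 2, leave room for the limit. *)
Lemma regular_variation_bounds : exists rho c1 : R, exists2 M0 : nat,
  0 < rho < 1 /\ 0 < c1 & forall M, (M0 <= M)%N ->
    (0 < M)%N /\ c1 * lam M <= lam (2 * M) /\ 2 * lam (2 * M) ^+ 2 <= rho * lam M ^+ 2.
Proof.
have cvr := cvg_ratio; set q : R := 2 `^ (- gam) in cvr.
have q0 : 0 < q by rewrite powR_gt0.
have q2 : 2 * q ^+ 2 < 1.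
  have q2E : q ^+ 2 = 2 `^ (- (2 * gam)).
    by rewrite -powR_mulrn ?powR_ge0 // -powRrM; congr (_ `^ _); ring.
  rewrite q2E -{1}(powRr1 (ler0n R 2)) -powRD; last by rewrite pnatr_eq0 implybT.
  rewrite /powR pnatr_eq0 /= -[ltRHS]expR0 ltr_expR pmulr_llt0 ?ln_gt0 ?ltr1n //.
  by move: hgam; lra.
pose rho := (1 + 2 * q ^+ 2) / 2.
have q2p : 0 < 2 * q ^+ 2 by rewrite mulr_gt0 // exprn_gt0.
exists rho, (q / 2).
have near1 : \forall n \near \oo, (0 < n)%N /\ q / 2 < lam (2 * n)%N / lam n.
  near=> n; split; first by near: n; exact: nbhs_infty_gt.
  by near: n; apply: (cvgr_gt q cvr); rewrite ltr_pdivrMr // ltr_pMr // ltr1n.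
have near2 : \forall n \near \oo, 2 * (lam (2 * n)%N / lam n) ^+ 2 < rho.
  have c2 : 2 * (lam (2 * n)%N / lam n) ^+ 2 @[n --> \oo] --> 2 * q ^+ 2.
    by under eq_fun do rewrite expr2; rewrite expr2; apply: cvgMr; apply: cvgM.
  by apply: (cvgr_lt _ c2); rewrite /rho; lra.
have [M0 _ M0P] := filterI near1 near2.
exists M0; first by rewrite /rho; split; [apply/andP; split; lra|rewrite divr_gt0].
move=> M MM0; have [/= [n0 h1] h2] := M0P M MM0.
have p := lam_pos n0; split => //; split.
  by rewrite -ler_pdivlMr // ltW.
by rewrite -ler_pdivrMr ?exprn_gt0 // -mulrA -expr_div_n ltW.
Unshelve. all: by end_near. Qed.

(** Monotonicity bounds the sum over [L, 2L) by L lambda_L^2, and doubling L multiplies this by at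
    most [rho]: the dyadic blocks form a geometric series of sum (1 - rho)^-1. The first block alone
    gives the lower bound. *)
Lemma tail_squares_bounds : exists c1 Cu : R, exists2 M0 : nat, 0 < c1 /\ 0 < Cu &
  forall M, (M0 <= M)%N -> [/\ (0 < M)%N,
    forall m, (M <= m < M + M)%N -> c1 * lam M <= lam m,
    forall K, \sum_(M <= n < K) lam n ^+ 2 <= Cu * (M%:R * lam M ^+ 2) &
    c1 ^+ 2 * (M%:R * lam M ^+ 2) <= \sum_(M <= n < M + M) lam n ^+ 2].
Proof.
have [rho [c1 [M0 [/andP[rho0 rho1] c10] bnd]]] := regular_variation_bounds.
exists c1, (1 - rho)^-1; exists M0; first by rewrite invr_gt0 subr_gt0.
move=> M MM0; have [n0 [h1 _]] := bnd M MM0.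
have lo m : (M <= m < M + M)%N -> c1 * lam M <= lam m.
  move=> /andP[Mm mM]; apply: (le_trans h1); apply: lam_noninc.
    exact: leq_trans Mm.
  by rewrite mul2n -addnn ltnW.
have block L : (0 < L)%N -> \sum_(L <= n < 2 * L) lam n ^+ 2 <= L%:R * lam L ^+ 2.
  move=> L0; have -> : L%:R * lam L ^+ 2 = \sum_(L <= n < 2 * L) lam L ^+ 2.
    by rewrite sumr_const_nat mul2n -addnn addnK mulr_natl.
  rewrite big_nat [leRHS]big_nat; apply: ler_sum => n /andP[Ln _].
  rewrite ler_sqr ?nnegrE; [exact: lam_noninc|rewrite ltW // lam_pos //|rewrite ltW // lam_pos //].
  exact: leq_trans Ln.
(* Induction over all L at once, peeling off the first block; the constant reproduces itself because
   1 + rho / (1 - rho) = 1 / (1 - rho). *)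
have dyadic j : forall L, (M0 <= L)%N ->
    \sum_(L <= n < 2 ^ j * L) lam n ^+ 2 <= (1 - rho)^-1 * (L%:R * lam L ^+ 2).
  elim: j => [|j ih] L LM0; have [L0 [_ hL]] := bnd L LM0.
    rewrite expn0 mul1n big_geq // mulr_ge0 ?invr_ge0 ?subr_ge0 ?(ltW rho1) //.
    by rewrite mulr_ge0 // sqr_ge0.
  have L2 : (L <= 2 * L)%N by rewrite mul2n -addnn leq_addr.
  rewrite (@big_cat_nat _ _ _ (2 * L)) //=; last first.
    by rewrite expnSr -mulnA leq_pmull // expn_gt0.
  rewrite expnSr -mulnA.
  have h := lerD (block L L0) (ih (2 * L)%N (leq_trans LM0 L2)).
  apply: (le_trans h); rewrite natrM.
  have hh : (1 - rho)^-1 * (2 * L%:R * lam (2 * L) ^+ 2) <=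
      (1 - rho)^-1 * (rho * (L%:R * lam L ^+ 2)).
    rewrite ler_wpM2l ?invr_ge0 ?subr_ge0 ?(ltW rho1) //.
    rewrite [2 * _]mulrC -mulrA [rho * _]mulrCA ler_wpM2l //.
  apply: (le_trans (lerD (lexx _) hh)); rewrite le_eqVlt; apply/orP; left; apply/eqP.
  by field; rewrite gt_eqF // subr_gt0.
split => //.
- move=> K; have := dyadic K M MM0; apply: le_trans.
  case: (leqP K M) => KM; first by rewrite big_geq // sumr_ge0 // => i _; rewrite sqr_ge0.
  have K2 : (K <= 2 ^ K * M)%N.
    by rewrite (leq_trans (ltnW (ltn_expl K (ltnSn 1)))) // leq_pmulr.
  by rewrite [leRHS](@big_cat_nat _ _ _ K) //= ?(ltnW KM) // lerDl sumr_ge0 // => i _; rewrite sqr_ge0.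
- have -> : c1 ^+ 2 * (M%:R * lam M ^+ 2) = \sum_(M <= n < M + M) (c1 * lam M) ^+ 2.
    by rewrite sumr_const_nat addnK exprMn -mulr_natl; ring.
  rewrite big_nat [leRHS]big_nat; apply: ler_sum => n nM.
  have Mp : 0 <= c1 * lam M by rewrite mulr_ge0 ?ltW // lam_pos.
  by rewrite ler_sqr ?nnegrE ?lo // (le_trans Mp) // lo.
Qed.

End regular_variation.

(** * Moments and transforms of the weighted gamma sums *)

Section gamma_partial_sums.
Context {R : realType} (d : measure_display) (T : measurableType d) (P : probability T R).
Variables (r : R) (eta : nat -> T -> R) (lam : nat -> R).
Hypotheses (r0 : 0 < r) (eta_indep : mutually_independent P eta).
Hypothesis eta_law : forall n, has_gamma_rr_law P r (eta n).

Definition centered n w := lam n * (eta n w - 1).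
Local Notation Z := centered.

Let meta n : measurable_fun setT (eta n). Proof. by case: eta_indep => + _; exact. Qed.

Let P1 : fine (P setT) = 1. Proof. by rewrite probability_setT. Qed.

Let i1 n : P.-integrable setT (fun w => (eta n w)%:E).
Proof. by have := gamma_power_integrable r0 (meta n) (@eta_law n) 1. Qed.

Let i2 n : P.-integrable setT (fun w => (eta n w ^+ 2)%:E).
Proof. exact: (gamma_power_integrable r0 (meta n) (@eta_law n) 2). Qed.

Let ic (c : R) : P.-integrable setT (fun w : T => c%:E).
Proof. exact: finite_measure_integrable_cst. Qed.

Let iB n : P.-integrable setT (fun w => (eta n w - 1)%:E).
Proof. exact: (integrableB measurableT (i1 n) (ic 1)). Qed.

Lemma centered_indep : mutually_independent P Z.
Proof.
split=> [n|s B us mB].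
  by apply: measurable_funM => //; exact: measurable_funB.
have mB' i : measurable ((fun y : R => lam i * (y - 1)) @^-1` B i).
  rewrite -[_ @^-1` _]setTI.
  have mi : measurable_fun setT (fun y : R => lam i * (y - 1)).
    by apply: measurable_funM => //; exact: measurable_funB.
  exact: mi.
by have [_ /(_ s _ us mB')] := eta_indep.
Qed.

Lemma centered_integrable n : P.-integrable setT (EFin \o Z n).
Proof. exact: (integrableZ_EFin (lam n) measurableT (iB n)). Qed.

Let sqrE n w : Z n w ^+ 2 = lam n ^+ 2 * (eta n w ^+ 2 - (2 * eta n w - 1)).
Proof. by rewrite /Z; ring. Qed.

Let iS n : P.-integrable setT (fun w => (eta n w ^+ 2 - (2 * eta n w - 1))%:E).
Proof.
have h1 := integrableZ_EFin 2 measurableT (i1 n).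
have h2 := integrableB measurableT h1 (ic 1).
exact: (integrableB measurableT (i2 n) h2).
Qed.

Lemma centered_sqr_integrable n : P.-integrable setT (fun w => (Z n w ^+ 2)%:E).
Proof.
under eq_fun do rewrite sqrE.
exact: (integrableZ_EFin (lam n ^+ 2) measurableT (iS n)).
Qed.

Lemma centered_mean n : (\int[P]_w (Z n w)%:E = 0)%E.
Proof.
rewrite -[LHS]fineK; last by apply: integrable_fin_num => //; exact: centered_integrable.
have iBn := iB n; have i1n := i1 n; have ic1 := ic 1.
rewrite -/(Rintegral _ _ _) /Z RintegralZl // RintegralB // Rintegral_cst // P1.
by rewrite (gamma_mean r0 (meta n) (@eta_law n)) mulr1 subrr mulr0.
Qed.

Lemma centered_variance n : (\int[P]_w (Z n w ^+ 2)%:E = (lam n ^+ 2 / r)%:E)%E.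
Proof.
rewrite -[LHS]fineK; last by apply: integrable_fin_num => //; exact: centered_sqr_integrable.
have h1 := integrableZ_EFin 2 measurableT (i1 n).
have h2 : P.-integrable setT (fun w => (2 * eta n w - 1)%:E).
  exact: (integrableB measurableT h1 (ic 1)).
have iSn := iS n; have i1n := i1 n; have i2n := i2 n; have ic1 := ic 1.
congr (_%:E); rewrite -/(Rintegral _ _ _).
under eq_Rintegral do rewrite sqrE.
rewrite RintegralZl // RintegralB // RintegralB // RintegralZl // Rintegral_cst // P1.
rewrite (gamma_mean r0 (meta n) (@eta_law n)).
rewrite (gamma_second_moment r0 (meta n) (@eta_law n)) mulr1.
by ring.
Qed.

Let ibounded (g : T -> R) : measurable_fun setT g -> (forall v, `|g v| <= 1) ->
  P.-integrable setT (fun v => (g v)%:E).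
Proof.
move=> mg g1; apply: (@le_integrable _ _ _ P _ measurableT _ (cst 1%:E)).
- exact/measurable_EFinP.
- by move=> v _; rewrite /= lee_fin normr1.
- exact: finite_measure_integrable_cst.
Qed.

Let mtrig (g : R -> R) (u : R) (W : T -> R) : continuous g -> measurable_fun setT W ->
  measurable_fun setT (fun w => g (u * W w)).
Proof.
move=> cg mW; apply: measurableT_comp; first exact: continuous_measurable_fun.
exact: measurable_funM.
Qed.

Let pcos (u : R) (W : T -> R) := \int[P]_w cos (u * W w).
Let psin (u : R) (W : T -> R) := \int[P]_w sin (u * W w).

(** Centring rotates the transform of [gamma_char] at lambda_n u by the angle - lambda_n u, which is
    the linear term subtracted from [clog]. *)
Let centered_char n u : pcos u (Z n) +i* psin u (Z n) =
  cexp (r%:C * (clog (lam n / r * u) - (lam n / r * u)%:C * 'i)).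
Proof.
have [hc hs] := gamma_char r0 (meta n) (@eta_law n) (lam n * u).
have ci : P.-integrable setT (fun w => (cos (lam n * u * eta n w))%:E).
  by apply: ibounded => [|w]; [exact: (mtrig _ (@continuous_cos R))|exact: cos_max].
have si : P.-integrable setT (fun w => (sin (lam n * u * eta n w))%:E).
  by apply: ibounded => [|w]; [exact: (mtrig _ (@continuous_sin R))|exact: sin_max].
have wE : r^-1 * (lam n * u) = lam n / r * u by ring.
rewrite wE in hc hs.
have E1 : pcos u (Z n) = cos (lam n * u) * \int[P]_w cos (lam n * u * eta n w) +
    sin (lam n * u) * \int[P]_w sin (lam n * u * eta n w).
  have ci' := integrableZ_EFin (cos (lam n * u)) measurableT ci.
  have si' := integrableZ_EFin (sin (lam n * u)) measurableT si.
  rewrite -!RintegralZl // -RintegralD //; apply: eq_Rintegral => w _.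
  have -> : u * Z n w = lam n * u * eta n w - lam n * u by rewrite /Z; ring.
  by rewrite cosB; ring.
have E2 : psin u (Z n) = cos (lam n * u) * \int[P]_w sin (lam n * u * eta n w) -
    sin (lam n * u) * \int[P]_w cos (lam n * u * eta n w).
  have ci' := integrableZ_EFin (sin (lam n * u)) measurableT ci.
  have si' := integrableZ_EFin (cos (lam n * u)) measurableT si.
  rewrite -!RintegralZl // -RintegralB //; apply: eq_Rintegral => w _.
  have -> : u * Z n w = lam n * u * eta n w - lam n * u by rewrite /Z; ring.
  by rewrite sinB; ring.
rewrite E1 E2 hc hs /cexp Re_realM Im_realM /clog /=.
set y := lam n / r * u.
have lE : lam n * u = r * y by rewrite /y; field; exact: lt0r_neq0.
have -> : r * (- (ln (1 + y ^+ 2) / 2) - (y * 0 - 0 * 1)) = - (r / 2 * ln (1 + y ^+ 2)) by ring.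
have -> : r * (atan y - (y * 1 + 0 * 0)) = r * atan y - lam n * u by rewrite lE; ring.
by rewrite cosB sinB; congr (_ +i* _); ring.
Qed.

Let indep_mul (g h : R -> R) M K u : (M <= K)%N -> continuous g -> continuous h ->
  (forall y, `|g y| <= 1) -> (forall y, `|h y| <= 1) ->
  P.-integrable setT (fun w => (g (u * psum Z M K w) * h (u * Z K w))%:E) /\
  \int[P]_w (g (u * psum Z M K w) * h (u * Z K w)) =
  \int[P]_w g (u * psum Z M K w) * \int[P]_w h (u * Z K w).
Proof.
move=> MK cg ch g1 h1.
have mZ : measurable_fun setT (Z K) by case: centered_indep => + _; exact.
have iU : P.-integrable setT (EFin \o (fun w => g (u * psum Z M K w))).
  by apply: ibounded => [|w]; [apply: mtrig => //; exact: measurable_psum centered_indep _ _|exact: g1].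
have iV : P.-integrable setT (EFin \o (fun w => h (u * Z K w))).
  by apply: ibounded => [|w]; [exact: mtrig|exact: h1].
have mpre (f : R -> R) (B : set R) : continuous f -> measurable B ->
    measurable ((fun y => f (u * y)) @^-1` B).
  move=> cf mB; rewrite -[_ @^-1` _]setTI.
  have mi : measurable_fun setT (fun y : R => f (u * y)).
    by apply: measurableT_comp; [exact: continuous_measurable_fun|exact: measurable_funM].
  exact: mi.
pose U w := g (u * psum Z M K w); pose V w := h (u * Z K w).
have ind (A B : set R) : measurable A -> measurable B ->
    P (U @^-1` A `&` V @^-1` B) = (P (U @^-1` A) * P (V @^-1` B))%E.
  move=> mA mB.
  exact: (psum_indep centered_indep MK (mpre g A cg mA) (mpre h B ch mB)).
split; first exact: (integrable_indep_mul iU iV ind).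
rewrite /Rintegral (integral_indep_mul iU iV ind) fineM //; exact: integrable_fin_num.
Qed.

Lemma partial_sum_char M K u : (M <= K)%N ->
  pcos u (psum Z M K) +i* psin u (psum Z M K) = gamma_cf r (fun n => lam n / r) M K u.
Proof.
have zero L : pcos u (psum Z L L) +i* psin u (psum Z L L) = 1.
  have -> : pcos u (psum Z L L) = 1.
    rewrite /pcos (@eq_Rintegral _ _ _ P _ (cst 1)); first by rewrite Rintegral_cst // P1 mul1r.
    by move=> w _; rewrite /psum big_geq // mulr0 cos0.
  have -> // : psin u (psum Z L L) = 0.
  rewrite /psin (@eq_Rintegral _ _ _ P _ (cst 0)); first by rewrite Rintegral_cst // mul0r.
  by move=> w _; rewrite /psum big_geq // mulr0 sin0.
rewrite /gamma_cf; elim: K => [|K ih].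
  by rewrite leqn0 => /eqP ->; rewrite big_geq // cexp0 zero.
rewrite leq_eqVlt => /orP[/eqP -> |]; first by rewrite big_geq // cexp0 zero.
rewrite ltnS => MK; rewrite big_nat_recr //= cexpD -(ih MK) -centered_char.
have [cc1 cc2] := indep_mul u MK (@continuous_cos R) (@continuous_cos R) (@cos_max R) (@cos_max R).
have [cs1 cs2] := indep_mul u MK (@continuous_cos R) (@continuous_sin R) (@cos_max R) (@sin_max R).
have [sc1 sc2] := indep_mul u MK (@continuous_sin R) (@continuous_cos R) (@sin_max R) (@cos_max R).
have [ss1 ss2] := indep_mul u MK (@continuous_sin R) (@continuous_sin R) (@sin_max R) (@sin_max R).
apply/eqP; rewrite eq_complex /=; apply/andP; split; apply/eqP.
- rewrite /pcos /psin -cc2 -ss2 -RintegralB //; apply: eq_Rintegral => w _.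
  by rewrite psum_recr // mulrDr cosD.
- rewrite /pcos /psin -cs2 -sc2 -RintegralD //; apply: eq_Rintegral => w _.
  by rewrite psum_recr // mulrDr sinD addrC.
Qed.

End gamma_partial_sums.

(** * Inversion of the Edgeworth polynomial *)

Section edgeworth_sum.
Context {R : realType} (n : nat) (s : nat -> R).
Implicit Types k : {ffun 'I_n -> 'I_n.+1}.

Definition edgeworth_coef k : R := \prod_(i < n) ((k i)`!%:R^-1 * s i ^+ k i).

Definition edgeworth_degree k : nat := \sum_(i < n) (i + 3) * k i.

(** The zero multi-index is the only one of weight 0; its term pi (Phi - 1/2) combines with the
    constant 1/2 to Phi. Every other term has positive degree and becomes a Hermite term with a
    minus sign. *)
Lemma edgeworth_gauss_sum x :
  2^-1 + pi^-1 * (\sum_k (if (weight k <= n)%N then edgeworth_coef k else 0) *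
    gauss_term (edgeworth_degree k) 1 x) =
  std_normal_cdf x - std_normal_pdf x *
    \sum_(k | (1 <= weight k <= n)%N) edgeworth_coef k * hermite (edgeworth_degree k - 1) x.
Proof.
have pi0 : pi != 0 :> R by rewrite gt_eqF // pi_gt0.
pose k0 : {ffun 'I_n -> 'I_n.+1} := [ffun=> ord0].
have w0 : weight k0 = 0%N by rewrite /weight big1 // => i _; rewrite ffunE muln0.
have wk k : (weight k == 0%N) = (k == k0).
  apply/eqP/eqP => [|-> //]; move=> /eqP; rewrite /weight sum_nat_eq0 => /forallP h.
  by apply/ffunP => i; rewrite ffunE; apply/val_inj; have := h i; rewrite muln_eq0 addn1 /= => /eqP.
have d0 : edgeworth_degree k0 = 0%N.
  by rewrite /edgeworth_degree big1 // => i _; rewrite ffunE muln0.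
have c0 : edgeworth_coef k0 = 1.
  by rewrite /edgeworth_coef big1 // => i _; rewrite ffunE fact0 invr1 expr0 mulr1.
have dk k : (weight k <= edgeworth_degree k)%N.
  by apply: leq_sum => i _; rewrite leq_mul2r leq_add2l orbT.
rewrite (bigD1 k0) //= w0 leq0n c0 d0 mul1r gauss_term0E // invr1 mul1r.
rewrite mulrDr mulrA mulVf // mul1r addrA [2^-1 + _]addrC subrK; congr (_ + _).
rewrite mulr_sumr mulr_sumr -sumrN [RHS]big_mkcond [LHS]big_mkcond /=.
apply: eq_bigr => k _; rewrite -wk lt0n.
case: (eqVneq (weight k) 0%N) => [//|]; rewrite -lt0n => kp /=.
case: ifP => _; last by rewrite mul0r mulr0.
have dp : (0 < edgeworth_degree k)%N by exact: leq_trans (dk k).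
rewrite -(prednK dp) subn1 /= gauss_term_hermite.
by rewrite 2!mulrN [edgeworth_coef k * (pi * _)]mulrCA mulKf // mulrCA.
Qed.

End edgeworth_sum.

(** * Convergence of the tail sums of powers of the weights *)

Section tail_sums.
Context {R : realType} (r : R) (lam : nat -> R).
Hypotheses (r0 : 0 < r) (lam_pos : forall n, (0 < n)%N -> 0 < lam n).
Hypothesis lam_noninc : forall m n, (0 < m)%N -> (m <= n)%N -> lam n <= lam m.
Hypothesis lam_norm : (fun K : nat => r^-1 * \sum_(1 <= n < K) lam n ^+ 2) @ \oo --> (1 : R).

Let S M k K := \sum_(M <= n < K) lam n ^+ k.

Let term_ge0 n k : (0 < n)%N -> 0 <= lam n ^+ k.
Proof. by move=> n0; rewrite exprn_ge0 // ltW // lam_pos. Qed.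

Let S_ge0 M k K : (0 < M)%N -> 0 <= S M k K.
Proof.
move=> M0; rewrite /S big_nat sumr_ge0 // => n /andP[Mn _].
by apply: term_ge0; exact: leq_trans Mn.
Qed.

Lemma tail_sum_nd M k : (0 < M)%N -> nondecreasing_seq (S M k).
Proof.
move=> M0 a b ab; rewrite /S; case: (leqP a M) => aM.
  by rewrite [leLHS]big_geq //; exact: S_ge0.
rewrite [leRHS](@big_cat_nat _ _ _ a) //= ?(ltnW aM) // lerDl.
by apply: (@S_ge0 a); exact: leq_trans aM.
Qed.

Let cvg_S1 : S 1 2 @ \oo --> r.
Proof.
have c : r * (r^-1 * S 1 2 K) @[K --> \oo] --> r * 1 by apply: cvgMr; exact: lam_norm.
rewrite -[X in _ --> X]mulr1; apply: cvg_trans c.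
by apply: near_eq_cvg; apply: nearW => K; rewrite mulrA mulfV ?gt_eqF // mul1r.
Qed.

Lemma cvg_tail_squares M : (0 < M)%N -> S M 2 @ \oo --> tailsum M (fun n => lam n ^+ 2).
Proof.
move=> M0; have h : S M 2 @ \oo --> r - S 1 2 M.
  apply: (@cvg_trans _ ((fun K => S 1 2 K - S 1 2 M) @ \oo)); last first.
    by apply: cvgB; [exact: cvg_S1|exact: cvg_cst].
  apply: near_eq_cvg; near=> K; have MK : (M <= K)%N by near: K; exact: nbhs_infty_ge.
  by rewrite /S (@big_cat_nat _ _ _ M 1 K) //= addrC addrK.
by rewrite /tailsum (cvg_lim (@Rhausdorff R) h).
Unshelve. all: by end_near. Qed.

Lemma tail_sum_le M K : (0 < M)%N -> S M 2 K <= tailsum M (fun n => lam n ^+ 2).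
Proof.
move=> M0; have c := cvg_tail_squares M0.
rewrite -(cvg_lim (@Rhausdorff R) c); apply: nondecreasing_cvgn_le; first exact: tail_sum_nd.
by apply/cvg_ex; eexists; exact: c.
Qed.

Lemma tail_squares_gt0 M : (0 < M)%N -> 0 < tailsum M (fun n => lam n ^+ 2).
Proof.
move=> M0; apply: lt_le_trans (tail_sum_le M.+1 M0).
by rewrite /S big_nat1 exprn_gt0 // lam_pos.
Qed.

Lemma tail_squares_cauchy e : 0 < e ->
  exists m0, forall m n, (m0 <= m)%N -> \sum_(m <= i < n) lam i ^+ 2 / r <= e.
Proof.
move=> e0; have er : r - e * r < r by rewrite ltrBlDr ltrDl mulr_gt0.
have [m0 _ m0P] := cvgr_gt _ cvg_S1 _ er.
exists m0.+1 => m n mm; have m1 : (0 < m)%N by exact: leq_trans mm.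
have := m0P m (ltnW mm) => /= h.
rewrite -mulr_suml ler_pdivrMr //; case: (leqP n m) => nm.
  by rewrite big_geq // mulr_ge0 // ltW.
have Sn : S 1 2 n <= r.
  rewrite -(cvg_lim (@Rhausdorff R) cvg_S1); apply: nondecreasing_cvgn_le; first exact: tail_sum_nd.
  by apply/cvg_ex; eexists; exact: cvg_S1.
have : S 1 2 n = S 1 2 m + S m 2 n by rewrite /S (@big_cat_nat _ _ _ m) // ltnW.
by rewrite /S in h Sn *; lra.
Qed.

(** The partial sums increase and, the weights being non-increasing, are at most lambda_M^i times
    the tail of squares. *)
Lemma cvg_tail_powers M i : (0 < M)%N ->
  S M i.+2 @ \oo --> tailsum M (fun n => lam n ^+ i.+2).
Proof.
move=> M0; apply: nondecreasing_is_cvgn; first exact: tail_sum_nd.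
exists (lam M ^+ i * tailsum M (fun n => lam n ^+ 2)) => _ [K _ <-].
apply: (@le_trans _ _ (lam M ^+ i * S M 2 K)); last first.
  by rewrite ler_wpM2l ?term_ge0 // tail_sum_le.
rewrite /S mulr_sumr big_nat [leRHS]big_nat; apply: ler_sum => n /andP[Mn _].
have n0 : (0 < n)%N by exact: leq_trans Mn.
rewrite -addn2 exprD ler_wpM2r ?term_ge0 // lerXn2r ?nnegrE ?lam_noninc // ltW // lam_pos //.
Qed.

End tail_sums.

(** * Choice of the scale and passage to powers of M *)

Theorem theorem5p2
  (R : realType) (d : measure_display) (T : measurableType d)
  (P : probability T R) (r : R) (hr : 0 < r)
  (eta : nat -> T -> R)
  (heta_indep : mutually_independent P eta)
  (heta_law : forall n : nat, has_gamma_rr_law P r (eta n))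
  (gam : R) (hgam : 1 / 2 < gam)
  (l : R -> R) (hl : slowly_varying l)
  (lam : nat -> R)
  (hlam : forall n : nat, (0 < n)%N -> lam n = l n%:R * n%:R `^ (- gam))
  (hlam_pos : forall n : nat, (0 < n)%N -> 0 < lam n)
  (hlam_noninc : forall m n : nat, (0 < m)%N -> (m <= n)%N -> lam n <= lam m)
  (hlam_norm : (fun K : nat => r^-1 * \sum_(1 <= n < K) lam n ^+ 2) @ \oo --> (1 : R))
  (N : nat) (hN : (2 <= N)%N) :
  let sigma (M : nat) : R := Num.sqrt (r^-1 * tailsum M (fun n => lam n ^+ 2)) in
  let Ytilde (M : nat) (w : T) : R :=
    (sigma M)^-1 * tailsum M (fun n => lam n * (eta n w - 1)) in
  let kappa (k M : nat) : R :=
    (k.-1)`!%:R / (r ^+ k.-1 * sigma M ^+ k) * tailsum M (fun n => lam n ^+ k) in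
  exists C : R, exists M0 : nat, forall M : nat, (M0 <= M)%N -> forall x : R,
    `| fine (P [set w | Ytilde M w <= x]) -
       (std_normal_cdf x - std_normal_pdf x *
          \sum_(k : {ffun 'I_(N - 2) -> 'I_(N - 1)} |
                  (1 <= \sum_(i < N - 2) (i + 1) * k i <= N - 2)%N)
            ((\prod_(i < N - 2)
                (((k i)`!%:R)^-1 * (kappa (i + 3)%N M / ((i + 3)`!)%:R) ^+ k i))
             * hermite (\sum_(i < N - 2) (i + 3) * k i - 1)%N x)) |
    <= C * M%:R `^ (- ((N%:R - 1) / 2)).
Proof.
move=> sigma Ytilde kappa.
case: N hN => [//|[//|n]] _.
have -> : (n.+2 - 2 = n)%N by rewrite !subSS subn0.
have -> : (n.+2 - 1 = n.+1)%N by rewrite subn1.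
have [c1 [Cu [M1 [c10 Cu0] bnd]]] := tail_squares_bounds hgam hl hlam hlam_pos hlam_noninc.
have c20 : 0 < (Cu * r)^-1 by rewrite invr_gt0 mulr_gt0.
have [C C0 [M2 cfb]] := @edgeworth_cf_bound R r c1 (Cu * r)^-1 n hr c10 c20.
(* For e = a_M, the two bounds on the tail of squares give (Cu r)^-1 <= M e^2 <= b: the lower one is
   the hypothesis on e in [cfb], the upper one converts e^(n+1) into a power of M. *)
pose b := (c1 ^+ 2 * r)^-1.
have b0 : 0 < b by rewrite invr_gt0 mulr_gt0 // exprn_gt0.
set delta : R := (4 * n.+1%:R)^-1 in cfb.
have d0 : 0 < delta by rewrite invr_gt0 mulr_gt0.
(* From M >= M3 on, e^2 <= b / M is at most delta^2. *)
pose M3 := Num.bound (b / delta ^+ 2).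
pose J := \int[@lebesgue_measure R]_(t in `]0, +oo[) (1 + t ^+ 2)^-1.
have J0 : 0 <= J by apply: Rintegral_ge0 => t _; rewrite invr_ge0 addr_ge0 ?sqr_ge0.
exists (C * Num.sqrt b ^+ n.+1 * J / pi), (maxn M1 (maxn M2 M3)) => M.
rewrite !geq_max => /and3P[MM1 MM2 MM3] x.
have [M0 lo up lo2] := bnd M MM1.
have MR : (0 : R) < M%:R by rewrite ltr0n.
pose S2 := tailsum M (fun m => lam m ^+ 2).
have S20 : 0 < S2 by exact: (tail_squares_gt0 hr hlam_pos hlam_norm).
have S2cvg := cvg_tail_squares hr hlam_norm M0.
have S2le K := tail_sum_le hr hlam_pos hlam_norm K M0.
pose sg := sigma M.
have sg0 : 0 < sg by rewrite /sg /sigma sqrtr_gt0 mulr_gt0 // invr_gt0.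
have sg2 : sg ^+ 2 = S2 / r.
  by rewrite /sg /sigma sqr_sqrtr; [rewrite mulrC|apply: mulr_ge0; rewrite ?invr_ge0 ltW].
pose a m := lam m / (sg * r).
have sgr : 0 < sg * r by rewrite mulr_gt0.
have e0 : 0 < a M by rewrite divr_gt0 // hlam_pos.
have e2 : a M ^+ 2 = lam M ^+ 2 / (S2 * r).
  by rewrite /a expr_div_n exprMn sg2; congr (_ / _); field; exact: lt0r_neq0.
have S2up : S2 <= Cu * (M%:R * lam M ^+ 2).
  apply: (@ler_cvg_to _ \oo _ _ _ (cst _) _ _ S2cvg); first exact: cvg_cst.
  by apply: nearW => K; exact: up.
have S2lo : c1 ^+ 2 * (M%:R * lam M ^+ 2) <= S2 by exact: le_trans lo2 (S2le _).
have Me_lo : (Cu * r)^-1 <= M%:R * a M ^+ 2.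
  rewrite e2 mulrA ler_pdivlMr ?mulr_gt0 // ler_pdivrMl ?mulr_gt0 //.
  by rewrite mulrAC ler_pM2r.
have Me_up : M%:R * a M ^+ 2 <= b.
  rewrite e2 mulrA ler_pdivrMr ?mulr_gt0 // ler_pdivlMl ?mulr_gt0 ?exprn_gt0 //.
  by rewrite mulrAC ler_pM2r.
have ed : a M <= delta.
  have bM : b <= M%:R * delta ^+ 2.
    rewrite -ler_pdivrMr ?exprn_gt0 // ltW //.
    have bd : 0 <= b / delta ^+ 2 by rewrite divr_ge0 ?sqr_ge0 // ltW.
    by apply: lt_le_trans (archi_boundP bd) _; rewrite ler_nat.
  have := le_trans Me_up bM; rewrite ler_pM2l //.
  by rewrite ler_sqr ?nnegrE ?(ltW e0) ?(ltW d0).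
pose Z := centered eta lam.
have iZ := centered_integrable lam hr heta_indep heta_law.
have iZ2 := centered_sqr_integrable lam hr heta_indep heta_law.
have Z0 := centered_mean lam hr heta_indep heta_law.
have Zv := centered_variance lam hr heta_indep heta_law.
have Zi := centered_indep lam heta_indep.
have vc := tail_squares_cauchy hr hlam_pos hlam_norm.
(* Both sides are the same [limn], so they agree also on divergent paths, where it takes its default
   value. *)
have YE w : Ytilde M w = sg^-1 * series_lim Z M w by [].
have mY : measurable_fun setT (Ytilde M).
  have mS := measurable_series_lim Zi M.
  by rewrite (funext YE); apply: measurable_funM => //; exact: mS.
have iY : P.-integrable setT (EFin \o Ytilde M).
  exact: (integrableZ_EFin sg^-1 measurableT (integrable_series_lim Zi iZ iZ2 Z0 Zv vc M)).
pose s i := kappa (i + 3)%N M / ((i + 3)`!)%:R.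
pose phi t := (\int[P]_w cos (t * Ytilde M w)) +i* (\int[P]_w sin (t * Ytilde M w)).
have psE k K : power_sum r a M K k = r / (sg * r) ^+ k * \sum_(M <= m < K) lam m ^+ k.
  rewrite /power_sum -mulrA; congr (_ * _); rewrite mulr_sumr.
  by apply: eq_bigr => m _; rewrite /a expr_div_n mulrC.
have ps2 : r / (sg * r) ^+ 2 = S2^-1.
  by rewrite exprMn sg2; field; rewrite !gt_eqF.
have cfE K t : (M <= K)%N -> gamma_cf r a M K t =
    (\int[P]_w cos (t / sg * psum Z M K w)) +i* (\int[P]_w sin (t / sg * psum Z M K w)).
  move=> MK; rewrite (partial_sum_char lam hr heta_indep heta_law (t / sg) MK) /gamma_cf.
  congr (cexp _); apply: eq_bigr => m _.
  by have -> : a m * t = lam m / r * (t / sg) by rewrite /a; field; rewrite !gt_eqF.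
have cvgh (h : R -> R) t : continuous h -> (forall y, `|h y| <= 1) ->
    \int[P]_w h (t / sg * psum Z M K w) @[K --> \oo] --> \int[P]_w h (t * Ytilde M w).
  move=> ch h1.
  have -> : \int[P]_w h (t * Ytilde M w) = \int[P]_w h (t / sg * series_lim Z M w).
    by apply: eq_Rintegral => w _; rewrite YE mulrA.
  apply: (cvg_expectation_series Zi iZ iZ2 Z0 Zv vc (h := fun y => h (t / sg * y))) => //.
  move=> y; apply: (@continuous_comp _ _ _ (fun y : R => t / sg * y) h); last exact: ch.
  by apply: cvgMr; exact: cvg_id.
have cfbt := cfb M a s (a M) phi MM2 (introT andP (conj e0 ed)) Me_lo.
have {cfb}cfbt t : 0 < t -> normc (phi t - (expR (- (t ^+ 2 / 2)))%:C * edgeworth_poly n s t) <=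
    C * a M ^+ n.+1 * (t / (1 + t ^+ 2)).
  apply: cfbt.
  - move=> m Mm; have m0 : (0 < m)%N by exact: leq_trans Mm.
    by rewrite /a divr_ge0 ?ler_pM2r ?invr_gt0 ?hlam_noninc // ltW // hlam_pos.
  - by move=> m mM; rewrite /a mulrA ler_pM2r ?invr_gt0 // lo.
  - by move=> K; rewrite psE ps2 ler_pdivrMl // mulr1 S2le.
  - have -> : (fun K => power_sum r a M K 2) = fun K => S2^-1 * \sum_(M <= m < K) lam m ^+ 2.
      by apply/funext => K; rewrite psE ps2.
    by rewrite -(mulVf (lt0r_neq0 S20)); apply: cvgMr; exact: S2cvg.
  - move=> i; have Ti : \sum_(M <= m < K) lam m ^+ i.+3 @[K --> \oo] --> tailsum M (fun m => lam m ^+ i.+3).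
      exact: (@cvg_tail_powers R r).
    have -> : (fun K => power_sum r a M K i.+3 / i.+3%:R) =
        fun K => r / (sg * r) ^+ i.+3 / i.+3%:R * \sum_(M <= m < K) lam m ^+ i.+3.
      by apply/funext => K; rewrite psE mulrAC.
    (* The quotient of factorials (i+2)! / (i+3)! leaves 1 / (i+3), the coefficient in the expansion
       of the logarithm. *)
    have -> : s i = r / (sg * r) ^+ i.+3 / i.+3%:R * tailsum M (fun m => lam m ^+ i.+3).
      rewrite /s /kappa addn3 -/sg [i.+3.-1]/= (factS i.+2) natrM exprMn [r ^+ i.+3]exprS.
      have f0 : (i.+2)`!%:R != 0 :> R by rewrite pnatr_eq0 -lt0n fact_gt0.
      have n0 : i.+3%:R != 0 :> R by rewrite pnatr_eq0.
      have sn : sg ^+ i.+3 != 0 by rewrite expf_neq0 // lt0r_neq0.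
      have rn : r ^+ i.+2 != 0 by rewrite expf_neq0 // lt0r_neq0.
      have r1 := lt0r_neq0 hr; move: f0 n0 sn rn.
      move: ((i.+2)`!%:R : R) (i.+3%:R : R) (sg ^+ i.+3) (r ^+ i.+2) (tailsum _ _).
      by move=> u1 u2 u3 u4 u5 h1 h2 h3 h4; field; rewrite h1 h2 h3 h4 r1.
    by apply: cvgMr; exact: Ti.
  - move=> u; apply: (@cvg_trans _ ((fun K => \int[P]_w cos (u / sg * psum Z M K w)) @ \oo)).
      apply: near_eq_cvg; near=> K; rewrite cfE //.
      by near: K; exact: nbhs_infty_ge.
    by apply: cvgh; [exact: continuous_cos|exact: cos_max].
  - move=> u; apply: (@cvg_trans _ ((fun K => \int[P]_w sin (u / sg * psum Z M K w)) @ \oo)).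
      apply: near_eq_cvg; near=> K; rewrite cfE //.
      by near: K; exact: nbhs_infty_ge.
    by apply: cvgh; [exact: continuous_sin|exact: sin_max].
(* The comparison sums over the whole finite type, so multi-indices of weight above n receive the
   coefficient 0. *)
have cmp := @cdf_comparison R d T P (Ytilde M) mY iY {ffun 'I_n -> 'I_n.+1}
  (fun k => if (weight k <= n)%N then edgeworth_coef s k else 0) (@edgeworth_degree n)
  (C * a M ^+ n.+1) _ x.
have {}cmp := cmp _.
rewrite edgeworth_gauss_sum in cmp.
apply: (le_trans (cmp _)) => [t t0|].
  apply: le_trans (cfbt t t0); rewrite le_eqVlt; apply/orP; left; apply/eqP; congr (normc (_ - _ * _)).
  rewrite edgeworth_polyE [RHS]big_mkcond /=; apply: eq_bigr => k _; case: ifP => _; last by rewrite mul0r.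
  by congr (_ * _ ^+ _); apply: eq_bigr => i _; rewrite addn3.
(* y = M^(-1/2), so that y^(n+1) is the required rate for N = n + 2 and a_M <= sqrt b y. *)
pose y : R := M%:R `^ (- 2^-1).
have y0 : 0 <= y by exact: powR_ge0.
have y2 : y ^+ 2 = M%:R^-1.
  rewrite -powR_mulrn // -powRrM (_ : - 2^-1 * 2 = -1 :> R); last by field.
  by rewrite powR_inv1.
have yn : M%:R `^ (- ((n.+2%:R - 1) / 2)) = y ^+ n.+1.
  rewrite -powR_mulrn // -powRrM; congr (_ `^ _).
  by rewrite -[n.+2%:R]natr1; field.
have aM : a M <= Num.sqrt b * y.
  have sy : 0 <= Num.sqrt b * y by rewrite mulr_ge0 ?sqrtr_ge0.
  rewrite -ler_sqr ?nnegrE ?sy ?(ltW e0) //.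
  by rewrite [leRHS]exprMn sqr_sqrtr ?(ltW b0) // y2 ler_pdivlMr // mulrC.
have aMn : a M ^+ n.+1 <= Num.sqrt b ^+ n.+1 * y ^+ n.+1.
  have lx (u v : R) : 0 <= u -> u <= v -> u ^+ n.+1 <= v ^+ n.+1.
    by move=> u0 uv; rewrite lerXn2r ?nnegrE // (le_trans u0).
  by rewrite -[leRHS]exprMn; exact: (lx _ _ (ltW e0) aM).
have J1 : 0 <= J / pi by rewrite divr_ge0 // pi_ge0.
rewrite yn -/J (_ : C * Num.sqrt b ^+ n.+1 * J / pi * y ^+ n.+1 =
  C * (Num.sqrt b ^+ n.+1 * y ^+ n.+1) * (J / pi)); last by ring.
by rewrite -[leLHS]mulrA ler_wpM2r // ler_wpM2l.
Unshelve. all: by end_near. Qed.
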